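(* Let $N\in\mathbb{N}$, $0<\alpha<1$ and $h>0$. Then there is a constant $C_p$, independent of $n$ and $h$, such that $$\|\mathcal{G}^{\alpha}_{n,h}\|_p\le C_p\frac{1}{(nh)^{\frac{\alpha N}{2}(1-1/p)}},\qquad n\in\mathbb{N},$$ for $p\in[1,\infty]$ if $N=1$, for $p\in[1,\infty)$ if $N=2$, and for $p\in[1,\frac{N}{N-2})$ if $N>2$.
   Context: Here $\mathbb{N}=\{1,2,\dots\}$, $\mathbb{N}_0=\{0,1,2,\dots\}$, and $\|\cdot\|_p$ is the norm of $L^p(\mathbb{R}^N)$. Discrete scaled Wright function: for $0<\alpha<1$, $\beta\ge0$, $h>0$, $n,j\in\mathbb{N}_0$, $$\varphi^h_{\alpha,\beta}(n,j)=\frac{1}{2\pi i}\int_{\Upsilon}\frac{1}{z^{n+1}}\frac{\left(1-h(\frac{1-z}{h})^{\alpha}\right)^{j}}{(\frac{1-z}{h})^{\beta}}\,dz,$$ where $\Upsilon$ is the positively oriented circle centred at $0$ of radius $r\in(0,1)$ (principal powers). Gaussian kernel: $G_t(x)=(4\pi t)^{-N/2}e^{-|x|^2/(4t)}$, $t>0$, $x\in\mathbb{R}^N$. Discrete Gaussian kernel: $\mathcal{G}_{n,h}(x)=\frac{1}{h^n\Gamma(n)}\int_0^\infty e^{-t/h}t^{n-1}G_t(x)\,dt$, $n\in\mathbb{N}$. Fundamental solution: $$\mathcal{G}^{\alpha}_{n,h}(x)=\sum_{j=1}^{\infty}\varphi^h_{\alpha,1-\alpha}(n-1,j-1)\,\mathcal{G}_{j,h}(x),\quad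 n\in\mathbb{N}.$$ *)

(* Defs.v *)
From HB Require Import structures.
From mathcomp Require Import all_boot all_order all_algebra.
From mathcomp Require Import ring lra.
From mathcomp Require Import complex.
From mathcomp Require Import all_classical all_reals all_analysis.

Set Implicit Arguments.
Unset Strict Implicit.
Unset Printing Implicit Defensive.

Import Order.TTheory GRing.Theory Num.Theory.
Import numFieldNormedType.Exports.

Local Open Scope classical_set_scope.
Local Open Scope ring_scope.
Local Open Scope complex_scope.

Section ComplexPowers.
Context {R : realType}.
Implicit Types (z : R[i]) (a t : R).

Definition cis t : R[i] := cos t +i* sin t.

(* Principal argument, by the half-angle formula; [carg_itv] and [carg_polar]
   characterise it. *)
Definition carg z : R :=
  if (complex.Im z == 0) && (complex.Re z < 0) then pi
  else 2 * atan (complex.Im z / (complex.Re z + Normc.normc z)).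

Definition cpow z a : R[i] := (Normc.normc z `^ a)%:C * cis (a * carg z).

Lemma carg_itv z : - pi < carg z <= pi.
Proof.
rewrite /carg; case: ifP => _.
  by rewrite lexx andbT; have := pi_gt0 R; lra.
have := atan_gtNpi2 (complex.Im z / (complex.Re z + Normc.normc z)).
have := atan_ltpi2 (complex.Im z / (complex.Re z + Normc.normc z)).
lra.
Qed.

Lemma carg_polar z : z = (Normc.normc z)%:C * cis (carg z).
Proof.
case: z => x y; rewrite /carg /cis /=; set m := Num.sqrt _.
have n2 : m ^+ 2 = x ^+ 2 + y ^+ 2 by rewrite /m sqr_sqrtr// addr_ge0 ?sqr_ge0.
have n0 : 0 <= m by exact: sqrtr_ge0.
case: ifPn => [/andP[/eqP y0 x0]|xy].
  have -> : m = - x by rewrite /m y0 expr0n addr0 sqrtr_sqr ltr0_norm.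
  by rewrite cospi sinpi y0; simpc.
have [m0|m0] := eqVneq m 0.
  move: n2; rewrite m0 expr0n/= => /esym/eqP.
  rewrite paddr_eq0 ?sqr_ge0// !sqrf_eq0 => /andP[/eqP-> /eqP->].
  by simpc.
have mp : 0 < m by rewrite lt_def m0.
have xm : x + m != 0.
  apply/eqP => xm0; move: xy; have -> : y = 0.
    apply/eqP; rewrite -sqrf_eq0; apply/eqP.
    have -> : y ^+ 2 = (m + x) * (m - x) by rewrite mulrC -subr_sqr n2; ring.
    by rewrite addrC in xm0; rewrite xm0 mul0r.
  by rewrite eqxx /= -leNgt; move: xm0 mp; lra.
have E : (2 : R) * atan (y / (x + m)) = atan (y / (x + m)) *+ 2.
  by rewrite mulr_natl.
rewrite E cos_mulr2n sin_mulr2n.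
set u := atan _.
have c2 : cos u ^+ 2 = (x + m) / (2 * m).
  have c0 : cos u != 0.
    by apply/lt0r_neq0/cos_gt0_pihalf; rewrite atan_gtNpi2 atan_ltpi2.
  have := cos2_tan2 c0; rewrite /u atanK -/u => h.
  apply: invr_inj; rewrite h invf_div.
  have -> : 1 + (y / (x + m)) ^+ 2 = (x ^+ 2 + y ^+ 2 + 2 * x * m + m ^+ 2)
     / (x + m) ^+ 2 by field.
  rewrite -n2.
  by field.
have su : cos u * sin u = (y / (x + m)) * cos u ^+ 2.
  have c0 : cos u != 0.
    by apply/lt0r_neq0/cos_gt0_pihalf; rewrite atan_gtNpi2 atan_ltpi2.
  have : tan u = y / (x + m) by rewrite /u atanK.
  by move=> <-; rewrite /tan; field.
by rewrite su c2; simpc; congr (_ +i* _); field; rewrite ?m0 ?xm.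
Qed.

End ComplexPowers.

(* [circle_integral r f] is the integral of [f] along the positively oriented
   circle parametrised by [t |-> r e^{it}], for t from -pi to pi. *)
Definition circle_integrand {R : realType} (r : R) (f : R[i] -> R[i]) (t : R) :
    R[i] :=
  f (r%:C * cis t) * ('i%C * (r%:C * cis t)).

Definition circle_integral {R : realType} (r : R) (f : R[i] -> R[i]) : R[i] :=
  (\int[lebesgue_measure]_(t in `[- pi, pi])
     complex.Re (circle_integrand r f t)) +i*
  (\int[lebesgue_measure]_(t in `[- pi, pi])
     complex.Im (circle_integrand r f t)).

Definition wright_fun {R : realType} (h alpha beta : R) (n j : nat) (z : R[i]) :
    R[i] :=
  (z ^+ n.+1)^-1 *
  ((1 - h%:C * cpow ((1 - z) / h%:C) alpha) ^+ j /
   cpow ((1 - z) / h%:C) beta).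

Definition wright {R : realType} (r h alpha beta : R) (n j : nat) : R[i] :=
  (2 * pi%:C * 'i%C)^-1 * circle_integral r (wright_fun h alpha beta n j).

Section WrightReal.
Context {R : realType}.
Implicit Types (z : R[i]) (f g : R -> R[i]) (a t : R).

Let ccont f := continuous (@complex.Re R \o f : R -> R) /\
               continuous (@complex.Im R \o f : R -> R).

Let ccont_cst z : ccont (fun=> z).
Proof. by split => t; exact: cst_continuous. Qed.

Let ccontM f g : ccont f -> ccont g -> ccont (fun t => f t * g t).
Proof.
move=> [fr fi] [gr gi]; split => t.
  rewrite (_ : _ \o _ = fun t => (@complex.Re R \o f) t * (@complex.Re R \o g) t
    - (@complex.Im R \o f) t * (@complex.Im R \o g) t).
    by apply: cvgB; apply: cvgM;
      [exact: fr|exact: gr|exact: fi|exact: gi].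
  by apply/funext => u /=; case: (f u) (g u) => [? ?] [? ?].
rewrite (_ : _ \o _ = fun t => (@complex.Re R \o f) t * (@complex.Im R \o g) t
  + (@complex.Im R \o f) t * (@complex.Re R \o g) t).
  by apply: cvgD; apply: cvgM;
    [exact: fr|exact: gi|exact: fi|exact: gr].
by apply/funext => u /=; case: (f u) (g u) => [? ?] [? ?].
Qed.

Let ccontB f g : ccont f -> ccont g -> ccont (fun t => f t - g t).
Proof.
move=> [fr fi] [gr gi]; split => t.
  rewrite (_ : _ \o _ = fun t => (@complex.Re R \o f) t - (@complex.Re R \o g) t).
    by apply: cvgB; [exact: fr|exact: gr].
  by apply/funext => u /=; case: (f u) (g u) => [? ?] [? ?].
rewrite (_ : _ \o _ = fun t => (@complex.Im R \o f) t - (@complex.Im R \o g) t).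
  by apply: cvgB; [exact: fi|exact: gi].
by apply/funext => u /=; case: (f u) (g u) => [? ?] [? ?].
Qed.

Let ccontX f n : ccont f -> ccont (fun t => f t ^+ n).
Proof.
move=> cf; elim: n => [|n IH]; first exact: ccont_cst.
rewrite (_ : (fun t => _) = fun t => f t * f t ^+ n); first exact: ccontM.
by apply/funext => t; rewrite exprS.
Qed.

Let sqn_neq0 z : z != 0 -> complex.Re z ^+ 2 + complex.Im z ^+ 2 != 0.
Proof.
case: z => x y /=; apply: contraNN.
by rewrite paddr_eq0 ?sqr_ge0// !sqrf_eq0 eq_complex.
Qed.

Let sqn_cont f : ccont f -> continuous
  (fun t => (@complex.Re R \o f) t ^+ 2 + (@complex.Im R \o f) t ^+ 2).
Proof.
move=> [fr fi] t; rewrite (_ : (fun t => _) =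
  fun t => (@complex.Re R \o f) t * (@complex.Re R \o f) t
         + (@complex.Im R \o f) t * (@complex.Im R \o f) t).
  by apply: cvgD; apply: cvgM; try exact: fr; exact: fi.
by apply/funext => u; rewrite !expr2.
Qed.

Let ccontV f : (forall t, f t != 0) -> ccont f -> ccont (fun t => (f t)^-1).
Proof.
move=> f0 cf; have [fr fi] := cf.
have cV t : {for t, continuous (fun t =>
    ((@complex.Re R \o f) t ^+ 2 + (@complex.Im R \o f) t ^+ 2)^-1)}.
  by apply: continuousV; [exact: sqn_neq0|exact: sqn_cont].
split => t.
  rewrite (_ : _ \o _ = fun t => (@complex.Re R \o f) t *
    ((@complex.Re R \o f) t ^+ 2 + (@complex.Im R \o f) t ^+ 2)^-1).
    by apply: cvgM; [exact: fr|exact: cV].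
  by apply/funext => u /=; case: (f u).
rewrite (_ : _ \o _ = fun t => - ((@complex.Im R \o f) t *
  ((@complex.Re R \o f) t ^+ 2 + (@complex.Im R \o f) t ^+ 2)^-1)).
  by apply: cvgN; apply: cvgM; [exact: fi|exact: cV].
by apply/funext => u /=; case: (f u) => a b.
Qed.

Let ccont_cis (k : R -> R) : continuous k -> ccont (fun t => cis (k t)).
Proof.
move=> ck; split => t.
  by apply: (@continuous_comp _ _ _ k cos); [exact: ck|exact: continuous_cos].
by apply: (@continuous_comp _ _ _ k sin); [exact: ck|exact: continuous_sin].
Qed.

Let normcE' z :
  Normc.normc z = Num.sqrt (complex.Re z ^+ 2 + complex.Im z ^+ 2).
Proof. by case: z. Qed.

Let normc_cont f : ccont f -> continuous (fun t => Normc.normc (f t)).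
Proof.
move=> cf t; rewrite (_ : (fun t => _) = Num.sqrt \o
  (fun t => (@complex.Re R \o f) t ^+ 2 + (@complex.Im R \o f) t ^+ 2)).
  by apply: continuous_comp; [exact: sqn_cont|exact: sqrt_continuous].
by apply/funext => u /=; rewrite normcE'.
Qed.

Let normc_gt0 z : 0 < complex.Re z -> 0 < Normc.normc z.
Proof.
move=> z0; rewrite normcE' sqrtr_gt0 ltr_pwDl ?sqr_ge0//.
by rewrite exprn_gt0.
Qed.

Let carg_cont f : (forall t, 0 < complex.Re (f t)) -> ccont f ->
  continuous (fun t => carg (f t)).
Proof.
move=> f0 cf t; have [fr fi] := cf.
rewrite (_ : (fun t => _) = fun t => 2 * (atan \o (fun t =>
   (@complex.Im R \o f) t * ((@complex.Re R \o f) t + Normc.normc (f t))^-1)) t).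
  apply: cvgM; first exact: cst_continuous.
  apply: continuous_comp; last exact: continuous_atan.
  apply: cvgM; first exact: fi.
  apply: cvgV.
    by apply: lt0r_neq0; rewrite addr_gt0 ?normc_gt0//; exact: f0.
  by apply: cvgD; [exact: fr|exact: normc_cont].
by apply/funext => u /=; rewrite /carg ltNge (ltW (f0 u)) andbF.
Qed.

Let ccont_cpow f a : (forall t, 0 < complex.Re (f t)) -> ccont f ->
  ccont (fun t => cpow (f t) a).
Proof.
move=> f0 cf; rewrite /cpow; apply: ccontM; last first.
  apply: ccont_cis => t; apply: cvgM; first exact: cst_continuous.
  exact: carg_cont.
split => t; last first.
  by rewrite (_ : _ \o _ = cst 0)//; exact: cst_continuous.
rewrite (_ : _ \o _ = expR \o (fun t => a * (@ln R \o
  (fun t => Normc.normc (f t))) t)).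
  apply: continuous_comp; last exact: continuous_expR.
  apply: cvgM; first exact: cst_continuous.
  apply: continuous_comp; first exact: normc_cont.
  by apply: continuous_ln; exact: normc_gt0.
apply/funext => u /=; rewrite /powR gt_eqF//; exact: normc_gt0.
Qed.

Let cpow_neq0 z a : 0 < complex.Re z -> cpow z a != 0.
Proof.
move=> z0; rewrite mulf_neq0//.
  by rewrite eq_complex /= eqxx andbT gt_eqF//; apply/powR_gt0/normc_gt0.
rewrite eq_complex /=; apply/negP => /andP[/eqP c /eqP s].
have := cos2Dsin2 (a * carg z); rewrite c s expr0n addr0 => /eqP.
by rewrite eq_sym oner_eq0.
Qed.

Let cpowJ z a : 0 < complex.Re z -> cpow (conjc z) a = conjc (cpow z a).
Proof.
case: z => x y /= x0; rewrite /cpow /cis /carg /= sqrrN.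
rewrite ltNge (ltW x0) !andbF /= mulNr atanN.
by rewrite !mulrN cosN sinN; simpc.
Qed.

Variables (r h : R).
Hypotheses (r01 : 0 < r < 1) (h0 : 0 < h).

Let arc t : R[i] := r%:C * cis t.
Let base t : R[i] := (1 - arc t) / h%:C.

Let hC_inv : (h%:C)^-1 = (h^-1)%:C :> R[i].
Proof. by rewrite fmorphV. Qed.

Let base_Re t : 0 < complex.Re (base t).
Proof.
rewrite /base hC_inv /arc /cis; simpc => /=.
rewrite ?mul0r ?mulr0 ?subr0 ?addr0 mulr_gt0 ?invr_gt0// subr_gt0.
have [r0 r1] := andP r01.
apply: le_lt_trans r1; rewrite ger_pMr//; exact: cos_le1.
Qed.

Let ccont_arc : ccont arc.
Proof. by apply: ccontM => //; apply: ccont_cis => t; exact: cvg_id. Qed.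

Let ccont_base : ccont base.
Proof. by apply: ccontM => //; apply: ccontB. Qed.

Let arc_neq0 t : arc t != 0.
Proof.
have [r0 _] := andP r01.
rewrite mulf_neq0//; first by rewrite eq_complex /= eqxx andbT gt_eqF.
rewrite eq_complex /=; apply/negP => /andP[/eqP c /eqP s].
have := cos2Dsin2 t; rewrite c s expr0n addr0 => /eqP.
by rewrite eq_sym oner_eq0.
Qed.

Let arcJ t : arc (- t) = conjc (arc t).
Proof. by rewrite /arc /cis cosN sinN; simpc. Qed.

Let conjM (x y : R[i]) : conjc (x * y) = conjc x * conjc y.
Proof. exact: rmorphM. Qed.

Let conjB (x y : R[i]) : conjc (x - y) = conjc x - conjc y.
Proof. exact: rmorphB. Qed.

Let conjX (x : R[i]) n : conjc (x ^+ n) = conjc x ^+ n.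
Proof. exact: rmorphXn. Qed.

Let conj1 : conjc (1 : R[i]) = 1.
Proof. exact: rmorph1. Qed.

Let baseJ t : base (- t) = conjc (base t).
Proof.
rewrite /base arcJ; move: (arc t) => w.
by rewrite conjM conjB conj1 conjc_inv conjc_real.
Qed.

Let integrandJ alpha beta n j t :
  circle_integrand r (wright_fun h alpha beta n j) (- t) =
  - conjc (circle_integrand r (wright_fun h alpha beta n j) t).
Proof.
rewrite /circle_integrand /wright_fun -!/(arc _) -!/(base _) baseJ arcJ.
rewrite !cpowJ//; move: (cpow (base t) alpha) (cpow (base t) beta) (arc t).
move=> u v w; rewrite !(conjM, conjc_inv, conjX, conjB, conj1, conjc_real).
have -> : conjc 'i%C = - 'i%C :> R[i] by simpc.
by rewrite mulNr mulrN opprK.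
Qed.

Let ccont_integrand alpha beta n j :
  ccont (circle_integrand r (wright_fun h alpha beta n j)).
Proof.
apply: ccontM; last by apply: ccontM; [exact: ccont_cst|exact: ccont_arc].
apply: ccontM.
  apply: ccontV; last exact: ccontX ccont_arc.
  by move=> t; rewrite expf_neq0//; exact: arc_neq0.
have cb a : ccont (fun t => cpow (base t) a) by exact: ccont_cpow.
apply: ccontM; last first.
  by apply: ccontV; [move=> t; exact: cpow_neq0 (base_Re t)|exact: cb].
apply: ccontX; apply: ccontB; first exact: ccont_cst.
by apply: ccontM; [exact: ccont_cst|exact: cb].
Qed.

Lemma wright_real alpha beta n j : complex.Im (wright r h alpha beta n j) = 0.
Proof.
rewrite /wright /circle_integral.
set F := circle_integrand _ _.
have [cF _] := ccont_integrand alpha beta n j.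
have -> : \int[lebesgue_measure]_(t in `[- pi, pi]) complex.Re (F t) = 0.
  have pp : (- pi <= pi :> R)%R by have := pi_gt0 R; lra.
  have := @integration_by_substitution_oppr R (@complex.Re R \o F) (- pi) pi pp.
  rewrite opprK => /(_ (continuous_subspaceT cF)) /(congr1 fine) I.
  have : \int[lebesgue_measure]_(x in `[(- pi)%R, pi]) complex.Re (F x) =
     - 1 * \int[lebesgue_measure]_(x in `[(- pi)%R, pi]) complex.Re (F x).
    rewrite -RintegralZl//.
      rewrite [LHS]I; congr fine; apply: eq_integral => t _ /=.
      rewrite /F integrandJ.
      by case: (circle_integrand _ _ _) => a b /=; rewrite mulN1r.
    apply: continuous_compact_integrable; first exact: segment_compact.
    exact: continuous_subspaceT.
  lra.
move: (Rintegral _ _ _) => b.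
have -> : 2 * pi%:C * 'i%C = 0 +i* (2 * pi) :> R[i].
  rewrite -(rmorph_nat (real_complex R)) -rmorphM /=.
  by simpc.
by rewrite /= !mul0r mulr0 addr0.
Qed.

End WrightReal.

Section Lebesgue.
Context {R : realType}.

Definition tuple_of_pair (N : nat) (u : N.-tuple R * R) : N.+1.-tuple R :=
  [tuple of u.2 :: u.1].

Lemma measurable_tuple_of_pair N :
  measurable_fun [set: N.-tuple R * R] (@tuple_of_pair N).
Proof. exact: measurable_cons. Qed.

(* The measure structure on a pushforward needs the measurability proof, hence
   the explicit instance name; the underlying set function is
   [pushforward (lebesgue_tuple n \x lebesgue_measure) tuple_of_pair]. *)
Fixpoint lebesgue_tuple (N : nat) : {measure set (N.-tuple R) -> \bar R} :=
  match N with
  | 0 => dirac [tuple]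
  | n.+1 => measure_function_pushforward__canonical__measure_function_Measure
              (lebesgue_tuple n \x lebesgue_measure)%E
              (@measurable_tuple_of_pair n)
  end.

Lemma lebesgue_tuple_box N (A : 'I_N -> set R) :
  (forall i, measurable (A i)) ->
  lebesgue_tuple N [set x | forall i, A i (tnth x i)] =
  (\prod_(i < N) lebesgue_measure (A i))%E.
Proof.
elim: N A => [|N IH] A mA.
  rewrite big_ord0 /= diracE mem_set//= => -[].
  by [].
rewrite big_ord_recl /= /pushforward.
set B := [set x : N.-tuple R | forall i, A (lift ord0 i) (tnth x i)].
rewrite (_ : _ @^-1` _ = B `*` A ord0); last first.
  apply/seteqP; split=> -[x y] /=.
    move=> H; split=> [i|]; last exact: (H ord0).
    by have := H (lift ord0 i); rewrite tnthS.
  move=> [Bx Ay] i; case: (unliftP ord0 i) => [k|] ->; last exact: Ay.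
  by rewrite tnthS; exact: Bx.
have mB : measurable B.
  rewrite (_ : B = \bigcap_(i in [set: 'I_N])
      ((fun x : N.-tuple R => tnth x i) @^-1` A (lift ord0 i))).
    apply: fin_bigcap_measurable => // i _; rewrite -[X in measurable X]setTI.
    by apply: measurable_tnth => //; exact: mA.
  by apply/seteqP; split=> x /= H; [move=> i _|move=> i]; exact: H.
have mA0 : @measurable _ (measurableTypeR R) (A ord0) by exact (mA ord0).
by rewrite product_measure1E// (IH (fun i => A (lift ord0 i))) 1?muleC.
Qed.

End Lebesgue.

Section FundamentalSolution.
Context {R : realType}.
Implicit Types (h t alpha beta r : R) (n j : nat).

Definition Gamma (s : R) : R :=
  \int[lebesgue_measure]_(t in `]0, +oo[) (t `^ (s - 1) * expR (- t)).

Definition gauss_kernel N t (x : N.-tuple R) : R :=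
  (4 * pi * t) `^ (- (N%:R / 2)) *
  expR (- (\sum_(i < N) tnth x i ^+ 2) / (4 * t)).

(* Extended-real valued, since the integral diverges at [x = 0] when
   [n <= N / 2]. *)
Definition discrete_gauss N h n (x : N.-tuple R) : \bar R :=
  ((h ^+ n * Gamma n%:R)^-1%:E *
   \int[lebesgue_measure]_(t in `]0%R, +oo[)
     (expR (- t / h) * t ^+ n.-1 * gauss_kernel t x)%:E)%E.

(* The Wright function is real by [wright_real]. The sum is the limit in [\bar R]
   of the partial sums, which is 0 by convention where that limit does not exist
   (the series diverges when [h `^ (1 - alpha) > 2]). *)
Definition fundamental_solution N r h alpha n (x : N.-tuple R) : \bar R :=
  (\sum_(1 <= j <oo)
     (complex.Re (wright r h alpha (1 - alpha)%R n.-1 j.-1))%:E *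
     discrete_gauss h j x)%E.

Definition admissible_exponent (N : nat) (p : \bar R) : Prop :=
  (1%:E <= p)%E /\
  (N = 2%N -> (p < +oo)%E) /\
  ((2 < N)%N -> (p < (N%:R / (N%:R - 2))%:E)%E).

End FundamentalSolution.

(* Main.v *)
Require Import Defs.
From HB Require Import structures.
From mathcomp Require Import all_boot all_order all_algebra.
From mathcomp Require Import ring lra.
From mathcomp Require Import complex.
From mathcomp Require Import all_classical all_reals all_analysis.
From mathcomp Require Import measurable_realfun.

(** Write m = n - 1, q = h^(1 - alpha), kappa = h^(- alpha) and
    theta = (N/2)(1 - 1/p); the admissible exponents are those with theta < 1
    (when p is infinite, N = 1 and theta = 1/2).

    The Wright number phi(m, j) is the coefficient of z^m in
    h^(1 - alpha) (1 - q (1 - z)^alpha)^j (1 - z)^(alpha - 1), and the discrete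
    Gaussian of index j + 1 is the integral of
    (1/h) e^(-t/h) (t/h)^j / j! against the heat kernel G_t. A formal summation
    over j under the integral sign gives the subordination formula: the fundamental
    solution at x is the integral over t > 0 of w(t) G_t(x), where
      w(t) = kappa Psi(kappa t),
      Psi(s) = the coefficient of z^m in (1 - z)^(alpha - 1) e^(- s (1 - z)^alpha).
    Expanding in powers of u = 1 - (1 - z)^alpha, one finds
    Psi(s) = e^(-s) (b_0 + b_1 s + ... + b_m s^m / m!), where b_k is the
    coefficient of z^m in u^k (1 - z)^(alpha - 1). The b_k are nonnegative
    because those of u and of (1 - z)^(alpha - 1) are [wright_coef_ge0]. Hence
    w >= 0, and as the p-norm of G_t is at most (4 pi t)^(- theta)
    [gauss_joint_pnorm], Minkowski's inequality bounds the p-norm of the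
    fundamental solution by (4 pi)^(- theta) times the integral of
    w(t) t^(- theta). Term by term this is a Gamma integral, and the sum is
      kappa^theta Gamma(1 - theta) [z^m] (1 - z)^(alpha theta - 1)
    [wright_density_moment]; the last coefficient is at most
    n^(- alpha theta) [powcoef_le_powR]. Since kappa^theta = h^(- alpha theta),
    the bound is a constant times (n h)^(- alpha theta).

    Two points need care. The first is the sum over j: it is a limit of partial
    sums at each point x, whose terms have no constant sign when q > 1. For
    q <= 2 the series is Abel summable, with the above integral as Abel sum
    [abel_mean_cvg, abel_mean_lim]; Abel summation being totally regular
    [abel_regular], the integral is the only possible limit, finite or not. For
    q > 2 the terms eventually alternate in sign and grow geometrically, so
    that there is no limit [wright_series_dvg] and the sum is 0 by convention.
    In all cases the absolute value of the fundamental solution is at most the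
    integral [fundamental_solution_subordination], except at x = 0, a null set.

    The second is the evaluation of the contour integral [Re_wright]. By the
    binomial formula it suffices to integrate z^(-m-1) (1 - z)^b over a circle
    of radius r < 1. Differentiating e^(-imt) (1 - r e^(it))^(b+1) in t gives a
    recurrence in m [fourier_coefS]; for m = 0 the integral does not depend on
    the radius, because by the Cauchy-Riemann equations its derivative in r is
    the integral of a derivative in t [fourier_coef0E]. *)

Set Implicit Arguments.
Unset Strict Implicit.
Unset Printing Implicit Defensive.

Import Order.TTheory GRing.Theory Num.Theory.
Import numFieldNormedType.Exports.

Local Open Scope classical_set_scope.
Local Open Scope ring_scope.

(** * Sums and limits of real-valued integrals *)

Section RintegralLemmas.
Context d (T : measurableType d) (R : realType) (mu : {measure set T -> \bar R}).
Variables (D : set T) (mD : measurable D).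

Lemma integrable_sumr n (c : 'I_n -> R) (f : 'I_n -> T -> R) :
  (forall l, mu.-integrable D (EFin \o f l)) ->
  mu.-integrable D (EFin \o (fun t => \sum_l c l * f l t)).
Proof.
move=> fi; have := @integrable_sum _ _ _ mu D mD _ (index_enum 'I_n) xpredT
  (fun l t => (c l)%:E * (f l t)%:E)%E.
move=> /(_ (fun l _ => integrableZl mD (c l) (fi l))).
apply: eq_integrable => // t _; rewrite /= -sumEFin.
by apply: eq_bigr => l _; rewrite EFinM.
Qed.

Lemma Rintegral_sumr n (c : 'I_n -> R) (f : 'I_n -> T -> R) :
  (forall l, mu.-integrable D (EFin \o f l)) ->
  \int[mu]_(t in D) (\sum_l c l * f l t) = \sum_l c l * \int[mu]_(t in D) f l t.
Proof.
elim: n c f => [|n IH] c f fi.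
  under eq_Rintegral do rewrite big_ord0.
  by rewrite big_ord0 Rintegral_cst // mul0r.
under eq_Rintegral do rewrite big_ord_recl.
rewrite big_ord_recl RintegralD //; last 2 first.
- by apply: eq_integrable (integrableZl mD (c ord0) (fi ord0)) => // t _; rewrite /= EFinM.
- by apply: (@integrable_sumr _ (fun l => c (lift ord0 l)) (fun l => f (lift ord0 l))).
by rewrite RintegralZl // (IH (fun l => c (lift ord0 l)) (fun l => f (lift ord0 l))).
Qed.

Lemma le_integrable_Rfun (f g : T -> R) : measurable_fun D f ->
  (forall t, D t -> `|f t| <= g t) -> mu.-integrable D (EFin \o g) ->
  mu.-integrable D (EFin \o f).
Proof.
move=> mf fg ig; apply: (le_integrable mD _ _ ig); first exact/measurable_EFinP.
move=> t Dt /=; rewrite lee_fin (le_trans (fg t Dt)) // ler_norm //.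
Qed.

Lemma Rdominated_cvg (f_ : nat -> T -> R) (f g : T -> R) :
  (forall n, measurable_fun D (f_ n)) -> measurable_fun D f ->
  (forall t, D t -> f_ n t @[n --> \oo] --> f t) ->
  mu.-integrable D (EFin \o g) ->
  (forall n t, D t -> `|f_ n t| <= g t) ->
  \int[mu]_(t in D) f_ n t @[n --> \oo] --> \int[mu]_(t in D) f t.
Proof.
move=> mf_ mf ff ig fg.
have fi : mu.-integrable D (EFin \o f).
  apply: (le_integrable_Rfun mf _ ig) => t Dt.
  have c : `|f_ n t| @[n --> \oo] --> `|f t| by apply: cvg_norm; exact: ff.
  by apply: (ler_cvg_to c (cvg_cst (g t))); apply: nearW => n; exact: fg.
apply: fine_cvg; rewrite fineK; last exact: integrable_fin_num.
apply: (@dominated_cvg _ _ _ mu D mD (fun n t => (f_ n t)%:E) (EFin \o f) (EFin \o g)) => //.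
- by move=> n; exact/measurable_EFinP.
- by move=> t Dt; apply: cvg_EFin; [exact: nearW|exact: ff].
Qed.

End RintegralLemmas.

(** * Coefficients of the power series of (1 - z)^b *)

Section Binc.
Context {R : realFieldType}.
Implicit Types (a b x u v : R) (f g : nat -> R).

Lemma sum_eq_support p p' f :
  (forall k, (p <= k)%N -> f k = 0) -> (forall k, (p' <= k)%N -> f k = 0) ->
  \sum_(k < p) f k = \sum_(k < p') f k.
Proof.
wlog pp' : p p' / (p <= p')%N.
  by move=> H f0 f0'; have [pp'|/ltnW pp'] := leqP p p'; [|apply/esym]; exact: H.
move=> f0 _; rewrite -(big_mkord xpredT f) -[RHS](big_mkord xpredT f).
rewrite [RHS](@big_cat_nat _ _ _ p) //= [X in _ + X]big_nat_cond.
by rewrite [X in _ + X]big1 ?addr0 // => k /andP[/andP[/f0]].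
Qed.

(** The coefficient of z^m in (1 - z)^b. *)
Definition powcoef b m : R := \prod_(i < m) ((i%:R - b) / i.+1%:R).

Lemma powcoef0 b : powcoef b 0 = 1.
Proof. by rewrite /powcoef big_ord0. Qed.

Lemma powcoefS b m : m.+1%:R * powcoef b m.+1 = (m%:R - b) * powcoef b m.
Proof. by rewrite /powcoef big_ord_recr /= mulrC -mulrA divfK ?pnatr_eq0 // mulrC. Qed.

(** Vandermonde's convolution, that is (1 - z)^(a + b) =
    (1 - z)^a (1 - z)^b. Both sides satisfy the recurrence of [powcoefS]. *)
Lemma powcoefD a b m :
  powcoef (a + b) m = \sum_(l < m.+1) powcoef a l * powcoef b (m - l).
Proof.
elim: m => [|m IH]; first by rewrite big_ord1 !powcoef0 mulr1.
apply: (@mulfI _ m.+1%:R); first by rewrite pnatr_eq0.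
rewrite powcoefS IH !mulr_sumr.
transitivity (\sum_(l < m.+1) (l.+1%:R * powcoef a l.+1) * powcoef b (m - l) +
              \sum_(l < m.+1) powcoef a l * ((m - l).+1%:R * powcoef b (m - l).+1)).
  rewrite -big_split /=; apply: eq_bigr => l _; rewrite !powcoefS.
  by rewrite natrB; [ring|rewrite -ltnS].
have -> : \sum_(l < m.+2) m.+1%:R * (powcoef a l * powcoef b (m.+1 - l)) =
  \sum_(l < m.+2) (l%:R * powcoef a l) * powcoef b (m.+1 - l) +
  \sum_(l < m.+2) powcoef a l * ((m.+1 - l)%:R * powcoef b (m.+1 - l)).
  rewrite -big_split /=; apply: eq_bigr => l _.
  by rewrite natrB; [ring|rewrite -ltnS].
congr (_ + _).
  by rewrite [RHS]big_ord_recl /= !mul0r add0r; apply: eq_bigr.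
rewrite [RHS]big_ord_recr /= subnn mul0r mulr0 addr0.
by apply: eq_bigr => l _; rewrite subSn // -ltnS.
Qed.

Lemma powcoef_nat (j k : nat) : powcoef j%:R k = (-1) ^+ k * 'C(j, k)%:R.
Proof.
elim: k => [|k IH]; first by rewrite powcoef0 bin0 mulr1.
apply: (@mulfI _ k.+1%:R); first by rewrite pnatr_eq0.
rewrite powcoefS IH; have := mul_bin_left j k => /(congr1 (fun i => i%:R : R)).
rewrite !natrM => E.
rewrite [RHS]mulrCA E exprS; have [kj|jk] := leqP k j.
  by rewrite natrB //; ring.
by rewrite bin_small // !mulr0.
Qed.

Lemma powcoef_le0 a l : 0 < a < 1 -> powcoef a l.+1 <= 0.
Proof.
move=> /andP[a0 a1]; rewrite /powcoef big_ord_recl /= sub0r divr1 mulNr oppr_le0.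
rewrite mulr_ge0 ?(ltW a0) //; apply: prodr_ge0 => i _.
rewrite divr_ge0 ?ler0n // subr_ge0 (le_trans (ltW a1)) //.
by rewrite ler1n.
Qed.

Lemma powcoef_ge0 a l : a <= 0 -> 0 <= powcoef a l.
Proof.
move=> a0; apply: prodr_ge0 => i _.
by rewrite divr_ge0 ?ler0n // subr_ge0 (le_trans a0) // ler0n.
Qed.

Definition bdiff f := fun i => f i - f i.+1.

Lemma iter_bdiff_shift k f i :
  iter k bdiff (fun i => f i.+1) i = iter k bdiff f i.+1.
Proof. by elim: k i => //= k IH i; rewrite /bdiff !IH. Qed.

Lemma iter_bdiff_lin n (c : 'I_n -> R) (F : 'I_n -> nat -> R) k i :
  iter k bdiff (fun i => \sum_l c l * F l i) i = \sum_l c l * iter k bdiff (F l) i.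
Proof.
elim: k i => //= k IH i; rewrite /bdiff !IH -sumrB.
by apply: eq_bigr => l _; rewrite mulrBr.
Qed.

Lemma eq_iter_bdiff k f g : f =1 g -> iter k bdiff f =1 iter k bdiff g.
Proof. by move=> fg; elim: k => //= k IH i; rewrite /bdiff !IH. Qed.

Definition binsum j u v f :=
  \sum_(i < j.+1) 'C(j, i)%:R * (u ^+ (j - i) * v ^+ i * f i).

Lemma binsumS j u v f : binsum j.+1 u v f =
  u * binsum j u v f + v * binsum j u v (fun i => f i.+1).
Proof.
rewrite /binsum big_ord_recl /= !mulr_sumr bin0 mul1r subn0 expr0 mulr1.
under eq_bigr => i _ do rewrite binS natrD mulrDl /bump /= add1n subSS.
rewrite big_split /= addrA; congr (_ + _); last first.
  by apply: eq_bigr => i _; rewrite exprS; ring.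
rewrite [RHS]big_ord_recl bin0 subn0 expr0 /= mulr1 mul1r exprS mulrA.
congr (_ + _); rewrite big_ord_recr /= bin_small // mul0r addr0.
apply: eq_bigr => i _; rewrite /bump /= add1n.
by rewrite -[in LHS](subnSK (ltn_ord i)) exprS; ring.
Qed.

(** With S the shift and D = 1 - S, this is the expansion of
    (u + v S)^j = ((u + v) - v D)^j applied to f at 0. For u = 1, v = - q it
    turns the alternating expression of the Wright numbers into one in terms of
    backward differences; for u = 0, v = 1 it is Newton's interpolation
    formula. *)
Lemma binsum_bdiff j u v f :
  binsum j u v f = binsum j (u + v) (- v) (fun k => iter k bdiff f 0).
Proof.
elim: j f => [|j IH] f; first by rewrite /binsum !big_ord1 !expr0.
rewrite !binsumS !IH.
have -> : binsum j (u + v) (- v) (fun k => iter k bdiff (fun i => f i.+1) 0) =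
   binsum j (u + v) (- v) (fun k => iter k bdiff f 0) -
   binsum j (u + v) (- v) (fun k => iter k.+1 bdiff f 0).
  rewrite /binsum -sumrB; apply: eq_bigr => k _.
  by rewrite iter_bdiff_shift /= /bdiff; ring.
ring.
Qed.

Lemma newton_nat f j :
  f j = \sum_(k < j.+1) powcoef j%:R k * iter k bdiff f 0.
Proof.
have := binsum_bdiff j 0 1 f; rewrite add0r.
rewrite /binsum big_ord_recr /= binn subnn !expr0 expr1n !mul1r big1 ?add0r.
  move=> ->; apply: eq_bigr => k _; rewrite expr1n mul1r powcoef_nat; ring.
by move=> i _; rewrite expr0n subn_eq0 leqNgt ltn_ord /= !mul0r mulr0.
Qed.

(** The coefficient of z^m in (1 - (1 - z)^a)^k (1 - z)^(a - 1), obtained as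
    the k-th difference at 0 of the sequence of the coefficients of
    (1 - z)^(a i) (1 - z)^(a - 1). *)
Definition wright_coef a m k := iter k bdiff (fun i => powcoef (a * i.+1%:R - 1) m) 0%N.

Lemma iter_bdiff_powcoef a m k i :
  iter k bdiff (fun i => powcoef (a * i.+1%:R - 1) m) i.+1 =
  \sum_(l < m.+1)
    powcoef a l * iter k bdiff (fun i => powcoef (a * i.+1%:R - 1) (m - l)) i.
Proof.
rewrite -iter_bdiff_lin -iter_bdiff_shift; apply: eq_iter_bdiff => {}i.
rewrite -powcoefD; congr powcoef; rewrite -[i.+2]addn1 natrD; ring.
Qed.

(** Multiplication by 1 - (1 - z)^a, a series without constant term. *)
Lemma wright_coefS a m k : wright_coef a m k.+1 =
  \sum_(l < m) - powcoef a l.+1 * wright_coef a (m - l.+1) k.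
Proof.
rewrite /wright_coef /= {1}/bdiff iter_bdiff_powcoef big_ord_recl powcoef0 mul1r subn0.
rewrite opprD addrA subrr add0r -sumrN; apply: eq_bigr => l _.
by rewrite mulNr.
Qed.

(** The coefficients of 1 - (1 - z)^a and those of (1 - z)^(a - 1) are
    nonnegative. *)
Lemma wright_coef_ge0 a m k : 0 < a < 1 -> 0 <= wright_coef a m k.
Proof.
move=> a01; elim: k m => [|k IH] m.
  rewrite /wright_coef /= mulr1 powcoef_ge0 // subr_le0; apply/ltW.
  by case/andP: a01.
rewrite wright_coefS; apply: sumr_ge0 => l _.
by rewrite mulr_ge0 // oppr_ge0 powcoef_le0.
Qed.

Lemma wright_coef_eq0 a m k : (m < k)%N -> wright_coef a m k = 0.
Proof.
elim: k m => // k IH m mk; rewrite wright_coefS big1 // => l _.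
rewrite IH ?mulr0 //; apply: leq_trans (mk : (m <= k)%N).
by rewrite ltn_subrL /= (leq_trans _ (ltn_ord l)).
Qed.

Lemma wright_coef_diag a m : wright_coef a m m = a ^+ m.
Proof.
elim: m => [|m IH]; first by rewrite /wright_coef /= powcoef0.
rewrite wright_coefS big_ord_recl /= big1 ?addr0.
  rewrite subSS subn0 IH exprS; congr (_ * _).
  by rewrite /powcoef big_ord1 sub0r divr1 opprK.
move=> i _; rewrite wright_coef_eq0 ?mulr0 // /bump /= add1n subSS ltn_subrL /=.
exact: leq_trans (ltn_ord i).
Qed.

Definition powcoef_poly m : {poly R} :=
  \prod_(i < m) ((i%:R%:P - 'X) * (i.+1%:R^-1)%:P).

Lemma powcoef_polyE m x : (powcoef_poly m).[x] = powcoef x m.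
Proof.
rewrite /powcoef_poly horner_prod; apply: eq_bigr => i _.
by rewrite !hornerE.
Qed.

Lemma poly_eq_nat (p q : {poly R}) :
  (forall j : nat, p.[j%:R] = q.[j%:R]) -> p = q.
Proof.
move=> pq; apply/eqP; rewrite -subr_eq0; apply/eqP/eqP; apply: contraT => pq0.
pose s := [seq (i%:R : R) | i <- iota 0 (size (p - q))].
have /max_poly_roots : p - q != 0 by [].
move=> /(_ s); rewrite size_map size_iota ltnn; apply.
  by apply/allP => x /mapP[j _ ->]; rewrite /root !hornerE pq subrr.
by rewrite map_inj_uniq ?iota_uniq // => i j /eqP; rewrite eqr_nat => /eqP.
Qed.

(** This is (1 - z)^(a - 1) (1 - u)^x = (1 - z)^(a (x + 1) - 1) for
    u = 1 - (1 - z)^a. Both sides are polynomials in x, and they agree at the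
    natural numbers by Newton's formula. *)
Lemma sum_wright_coef_powcoef a m x :
  \sum_(k < m.+1) wright_coef a m k * powcoef x k = powcoef (a * (x + 1) - 1) m.
Proof.
pose p := \sum_(k < m.+1) wright_coef a m k *: powcoef_poly k.
pose q := powcoef_poly m \Po (a *: ('X + 1) - 1).
have -> : \sum_(k < m.+1) wright_coef a m k * powcoef x k = p.[x].
  by rewrite /p horner_sum; apply: eq_bigr => k _; rewrite hornerE powcoef_polyE.
have -> : powcoef (a * (x + 1) - 1) m = q.[x].
  by rewrite /q horner_comp powcoef_polyE !hornerE.
congr (_.[_]); apply: poly_eq_nat => j.
rewrite /q horner_comp powcoef_polyE !hornerE natr1.
rewrite (newton_nat (fun i => powcoef (a * i.+1%:R - 1) m) j).
rewrite horner_sum.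
under eq_bigr => k _ do rewrite hornerE powcoef_polyE mulrC.
apply: (@sum_eq_support _ _ (fun k => powcoef j%:R k * wright_coef a m k)) => k jk.
  by rewrite wright_coef_eq0 ?mulr0.
by rewrite powcoef_nat bin_small // mulr0 mul0r.
Qed.

End Binc.

(** The coefficient is the product of the 1 - a/i for 1 <= i <= m, and
    1 - a/i <= exp(- a/i) <= ((i + 1)/i)^(- a). *)
Lemma powcoef_le_powR (R : realType) (a : R) m :
  0 <= a < 1 -> powcoef (a - 1) m <= m.+1%:R `^ (- a).
Proof.
move=> /andP[a0 a1]; elim: m => [|m IH]; first by rewrite powcoef0 powR1.
have m0 : 0 < m.+1%:R :> R by rewrite ltr0n.
have m10 : 0 < m.+2%:R :> R by rewrite ltr0n.
have -> : powcoef (a - 1) m.+1 = (1 - a / m.+1%:R) * powcoef (a - 1) m.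
  apply: (@mulfI _ m.+1%:R); first by rewrite gt_eqF.
  rewrite powcoefS mulrA; congr (_ * _).
  by rewrite mulrBr mulr1 mulrCA divff ?gt_eqF // mulr1 -natr1; ring.
have am : a / m.+1%:R <= 1 by rewrite ler_pdivrMr // mul1r (le_trans (ltW a1)) // ler1n.
apply: (@le_trans _ _ ((1 - a / m.+1%:R) * m.+1%:R `^ (- a))).
  by rewrite ler_wpM2l // subr_ge0.
have -> : m.+2%:R `^ (- a) = (m.+2%:R / m.+1%:R) `^ (- a) * m.+1%:R `^ (- a) :> R.
  by rewrite -powRM ?divr_ge0 // divfK ?gt_eqF.
rewrite ler_wpM2r ?powR_ge0 //.
apply: (@le_trans _ _ (expR (- (a / m.+1%:R)))); first exact: expR_ge1Dx.
rewrite /powR gt_eqF ?divr_gt0 // ler_expR !mulNr lerN2 ler_wpM2l //.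
have -> : m.+2%:R / m.+1%:R = 1 + m.+1%:R^-1 :> R.
  by rewrite -(natr1 m.+1) mulrDl divff ?gt_eqF // mul1r.
rewrite -[leRHS]expRK ler_ln ?posrE ?expR_gt0 ?expR_ge1Dx //.
Qed.

(** * Principal powers in the right half-plane *)

Section RealDerivatives.
Context {R : realType}.
Implicit Types (f g : R -> R) (x a b c : R).

Lemma is_derive_mul f g x a b : is_derive x 1 f a -> is_derive x 1 g b ->
  is_derive x 1 (fun t => f t * g t) (f x * b + a * g x).
Proof.
move=> df dg; have := is_deriveM df dg.
rewrite (_ : f x *: b + g x *: a = f x * b + a * g x) //.
by rewrite (mulrC a).
Qed.

Lemma is_derive_add f g x a b : is_derive x 1 f a -> is_derive x 1 g b ->
  is_derive x 1 (fun t => f t + g t) (a + b).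
Proof. by move=> df dg; exact: is_deriveD df dg. Qed.

Lemma is_derive_sub f g x a b : is_derive x 1 f a -> is_derive x 1 g b ->
  is_derive x 1 (fun t => f t - g t) (a - b).
Proof. by move=> df dg; exact: is_deriveB df dg. Qed.

Lemma is_derive_opp f x a : is_derive x 1 f a -> is_derive x 1 (fun t => - f t) (- a).
Proof. by move=> df; exact: is_deriveN df. Qed.

Lemma is_derive_const c x : is_derive x (1 : R) (fun _ => c) (0 : R).
Proof. exact: is_derive_cst. Qed.

Lemma is_derive_var x : is_derive x (1 : R) (fun t => t) (1 : R).
Proof. exact: is_derive_id. Qed.

Lemma is_derive_inv f x a : f x != 0 -> is_derive x 1 f a ->
  is_derive x 1 (fun t => (f t)^-1) (- a / f x ^+ 2).
Proof.
move=> f0 df; have := is_deriveV f0 df.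
by rewrite (_ : - _ *: _ = - a / f x ^+ 2) //= -[_ *: _]/(_ * _) mulNr mulrC mulNr.
Qed.

Lemma is_derive_val f x a b : a = b -> is_derive x 1 f a -> is_derive x 1 f b.
Proof. by move=> ->. Qed.

Lemma is_derive_continuous f : (forall x, exists a, is_derive x 1 f a) -> continuous f.
Proof.
move=> H x; have [a [da _]] := H x.
by apply/differentiable_continuous/derivable1_diffP.
Qed.

End RealDerivatives.

(** Real and imaginary parts of the principal power (x + iy)^b, for x > 0.
    Working with two real functions makes the real derivatives available. *)
Section PlanePower.
Context {R : realType}.
Implicit Types (b x y : R).

Definition log_mod x y : R := ln (x ^+ 2 + y ^+ 2) / 2.
Definition plane_arg x y : R := atan (y / x).
Definition pow_re b x y := expR (b * log_mod x y) * cos (b * plane_arg x y).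
Definition pow_im b x y := expR (b * log_mod x y) * sin (b * plane_arg x y).

Lemma sqn_gt0 x y : 0 < x -> 0 < x ^+ 2 + y ^+ 2.
Proof. by move=> x0; rewrite ltr_pwDl ?exprn_gt0 ?sqr_ge0. Qed.

Lemma exp_log_mod x y : 0 < x -> expR (log_mod x y) = Num.sqrt (x ^+ 2 + y ^+ 2).
Proof.
move=> x0; apply/eqP; rewrite -(@eqrXn2 _ 2) ?expR_ge0 ?sqrtr_ge0 //.
rewrite sqr_sqrtr ?(ltW (sqn_gt0 _ _)) // -expRM_natl /log_mod.
by rewrite mulrC divfK ?pnatr_eq0 // lnK // posrE sqn_gt0.
Qed.

Lemma cos_plane_arg x y : 0 < x -> expR (log_mod x y) * cos (plane_arg x y) = x.
Proof.
move=> x0; rewrite exp_log_mod // cos_atan.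
have -> : 1 + (y / x) ^+ 2 = (x ^+ 2 + y ^+ 2) / x ^+ 2.
  by field; rewrite gt_eqF.
rewrite sqrtrM ?(ltW (sqn_gt0 _ _)) // sqrtrV ?sqr_ge0 // sqrtr_sqr gtr0_norm //.
have s0 : Num.sqrt (x ^+ 2 + y ^+ 2) != 0 by rewrite gt_eqF // sqrtr_gt0 sqn_gt0.
by field; rewrite s0 gt_eqF.
Qed.

Lemma sin_plane_arg x y : 0 < x -> expR (log_mod x y) * sin (plane_arg x y) = y.
Proof.
move=> x0; have c := cos_plane_arg y x0.
have c0 : cos (plane_arg x y) != 0.
  by apply/eqP => c0; move: c; rewrite c0 mulr0 => /eqP; rewrite lt_eqF.
have : tan (plane_arg x y) = y / x by rewrite /plane_arg atanK.
rewrite /tan => /(canRL (divfK c0)) ->.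
by rewrite mulrCA c divfK ?gt_eqF.
Qed.

Lemma pow_reS b x y : 0 < x -> pow_re (b + 1) x y = x * pow_re b x y - y * pow_im b x y.
Proof.
move=> x0; have := cos_plane_arg y x0; have := sin_plane_arg y x0.
rewrite /pow_re /pow_im !mulrDl !mul1r expRD cosD.
set E := expR (log_mod x y); set c := cos (plane_arg x y); set s := sin (plane_arg x y).
set A := expR _; set C := cos _; set D := sin _ => Es Ec.
by transitivity (A * (C * (E * c) - D * (E * s))); [|rewrite Es Ec]; ring.
Qed.

Lemma pow_imS b x y : 0 < x -> pow_im (b + 1) x y = x * pow_im b x y + y * pow_re b x y.
Proof.
move=> x0; have := cos_plane_arg y x0; have := sin_plane_arg y x0.
rewrite /pow_re /pow_im !mulrDl !mul1r expRD sinD.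
set E := expR (log_mod x y); set c := cos (plane_arg x y); set s := sin (plane_arg x y).
set A := expR _; set C := cos _; set D := sin _ => Es Ec.
by transitivity (A * (D * (E * c) + C * (E * s))); [|rewrite Es Ec]; ring.
Qed.

Section Curve.
Variables (X Y : R -> R) (t dx dy : R).
Hypotheses (X0 : 0 < X t) (dX : is_derive t 1 X dx) (dY : is_derive t 1 Y dy).

Let S := X t ^+ 2 + Y t ^+ 2.

Let dmod : is_derive t 1 (fun s => log_mod (X s) (Y s)) ((X t * dx + Y t * dy) / S).
Proof.
have S0 : 0 < S := sqn_gt0 (Y t) X0.
pose s u := X u * X u + Y u * Y u.
have ds : is_derive t 1 s (2 * (X t * dx + Y t * dy)).
  by apply: is_derive_val (is_derive_add (is_derive_mul dX dX) (is_derive_mul dY dY)); ring.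
have sE : s t = S by rewrite /s /S !expr2.
have dl : is_derive (s t) 1 (@ln R) (s t)^-1 by apply: is_derive1_ln; rewrite sE.
have := is_derive_mul (is_derive1_comp dl ds) (is_derive_const 2^-1 t).
rewrite (_ : (fun _ => _) = (fun s => log_mod (X s) (Y s))); last first.
  by apply/funext => u; rewrite /log_mod /= /s !expr2.
by apply: is_derive_val; rewrite sE; field; rewrite gt_eqF.
Qed.

Let darg : is_derive t 1 (fun s => plane_arg (X s) (Y s)) ((X t * dy - Y t * dx) / S).
Proof.
have S0 : 0 < S := sqn_gt0 (Y t) X0.
pose q u := Y u * (X u)^-1.
have X00 : X t != 0 by rewrite gt_eqF.
have dq : is_derive t 1 q _ := is_derive_mul dY (is_derive_inv X00 dX).
have := is_derive1_comp (is_derive1_atan (q t)) dq.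
apply: is_derive_val; rewrite /q /S; field.
by rewrite X00 /= !gt_eqF // ?sqn_gt0 // addrC sqn_gt0.
Qed.

(** The chain rule for the holomorphic function w^b, in real terms. *)
Lemma is_derive_pow_re b : is_derive t 1 (fun s => pow_re b (X s) (Y s))
  (b * (dx * pow_re (b - 1) (X t) (Y t) - dy * pow_im (b - 1) (X t) (Y t))).
Proof.
have S0 : 0 < S := sqn_gt0 (Y t) X0.
have d1 := is_derive1_comp (is_derive_expR _) (is_derive_mul (is_derive_const b t) dmod).
have d2 := is_derive1_comp (is_derive_cos _) (is_derive_mul (is_derive_const b t) darg).
have := is_derive_mul d1 d2; apply: is_derive_val => /=.
have := pow_reS (b - 1) (Y t) X0; have := pow_imS (b - 1) (Y t) X0.
rewrite subrK; set u := pow_re (b - 1) _ _; set v := pow_im (b - 1) _ _.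
rewrite /pow_re /pow_im; set e := expR _; set c := cos _; set s := sin _ => H1 H2.
rewrite !mul0r !addr0.
have -> : e * (- s * (b * ((X t * dy - Y t * dx) / S))) +
   e * (b * ((X t * dx + Y t * dy) / S)) * c =
   b * ((X t * dx + Y t * dy) * (e * c) - (X t * dy - Y t * dx) * (e * s)) / S.
  ring.
by rewrite H1 H2; move: S0; rewrite /S => S0; field; rewrite gt_eqF.
Qed.

Lemma is_derive_pow_im b : is_derive t 1 (fun s => pow_im b (X s) (Y s))
  (b * (dx * pow_im (b - 1) (X t) (Y t) + dy * pow_re (b - 1) (X t) (Y t))).
Proof.
have S0 : 0 < S := sqn_gt0 (Y t) X0.
have d1 := is_derive1_comp (is_derive_expR _) (is_derive_mul (is_derive_const b t) dmod).
have d2 := is_derive1_comp (is_derive_sin _) (is_derive_mul (is_derive_const b t) darg).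
have := is_derive_mul d1 d2; apply: is_derive_val => /=.
have := pow_reS (b - 1) (Y t) X0; have := pow_imS (b - 1) (Y t) X0.
rewrite subrK; set u := pow_re (b - 1) _ _; set v := pow_im (b - 1) _ _.
rewrite /pow_re /pow_im; set e := expR _; set c := cos _; set s := sin _ => H1 H2.
rewrite !mul0r !addr0.
have -> : e * (c * (b * ((X t * dy - Y t * dx) / S))) +
   e * (b * ((X t * dx + Y t * dy) / S)) * s =
   b * ((X t * dx + Y t * dy) * (e * s) + (X t * dy - Y t * dx) * (e * c)) / S.
  ring.
by rewrite H1 H2; move: S0; rewrite /S => S0; field; rewrite gt_eqF.
Qed.

End Curve.
End PlanePower.

(** * Cauchy's formula for the coefficients of (1 - z)^b *)

Section CircleMean.
Context {R : realType}.
Implicit Types (b r t : R) (m : nat).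
Notation mu := (@lebesgue_measure R).

Lemma continuous_integrable_pi (f : R -> R) : continuous f ->
  mu.-integrable `[- pi, pi] (EFin \o f).
Proof.
move=> cf; apply: continuous_compact_integrable; first exact: segment_compact.
exact: continuous_subspaceT.
Qed.

Lemma integral_pi_derive (F f : R -> R) : (forall t, is_derive t 1 F (f t)) ->
  continuous f -> \int[mu]_(t in `[- pi, pi]) f t = F pi - F (- pi).
Proof.
move=> dF cf; have pp : - pi < pi :> R by rewrite gtrN // pi_gt0.
have cF : continuous F by apply: is_derive_continuous => x; exists (f x).
rewrite /Rintegral (@continuous_FTC2 R f F) //.
- exact: continuous_subspaceT.
- split; first by move=> x _; have [] := dF x.
    by apply: cvg_at_right_filter; exact: cF.
  by apply: cvg_at_left_filter; exact: cF.
- by move=> x _; rewrite derive1E; have [_] := dF x.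
Qed.

Definition circ_re r t := 1 - r * cos t.
Definition circ_im r t := - (r * sin t).

Lemma circ_re_gt0 r t : -1 < r < 1 -> 0 < circ_re r t.
Proof.
move=> r1; rewrite /circ_re subr_gt0.
have : `|r * cos t| < 1.
  rewrite normrM; apply: (@le_lt_trans _ _ `|r|); last by rewrite ltr_norml.
  by rewrite ler_piMr // ler_norml cos_geN1 cos_le1.
by rewrite ltr_norml => /andP[].
Qed.

Lemma is_derive_circ_re r t : is_derive t 1 (circ_re r) (r * sin t).
Proof.
by apply: is_derive_val (is_derive_sub (is_derive_const 1 t) (is_derive_mul (is_derive_const r t) (is_derive_cos t))); ring.
Qed.

Lemma is_derive_circ_im r t : is_derive t 1 (circ_im r) (- (r * cos t)).
Proof.
by apply: is_derive_val (is_derive_opp (is_derive_mul (is_derive_const r t) (is_derive_sin t))); ring.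
Qed.

Lemma is_derive_circ_re_radius r t : is_derive r 1 (circ_re ^~ t) (- cos t).
Proof.
by apply: is_derive_val (is_derive_sub (is_derive_const 1 r) (is_derive_mul (is_derive_var r) (is_derive_const (cos t) r))); ring.
Qed.

Lemma is_derive_circ_im_radius r t : is_derive r 1 (circ_im ^~ t) (- sin t).
Proof.
by apply: is_derive_val (is_derive_opp (is_derive_mul (is_derive_var r) (is_derive_const (sin t) r))); ring.
Qed.

Definition circ_pow_re b r t := pow_re b (circ_re r t) (circ_im r t).
Definition circ_pow_im b r t := pow_im b (circ_re r t) (circ_im r t).

Section FixedRadius.
Variable r : R.
Hypothesis r1 : -1 < r < 1.

Let d_cu b t := is_derive_pow_re (circ_re_gt0 t r1) (is_derive_circ_re r t) (is_derive_circ_im r t) b.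
Let d_cv b t := is_derive_pow_im (circ_re_gt0 t r1) (is_derive_circ_re r t) (is_derive_circ_im r t) b.

Lemma continuous_circ_pow_re b : continuous (circ_pow_re b r).
Proof. by apply: is_derive_continuous => t; eexists; exact: d_cu. Qed.

Lemma continuous_circ_pow_im b : continuous (circ_pow_im b r).
Proof. by apply: is_derive_continuous => t; eexists; exact: d_cv. Qed.

(** 2 pi times the real part of the m-th Fourier coefficient of
    (1 - s e^(it))^b. *)
Definition fourier_coef m b s := \int[mu]_(t in `[- pi, pi])
  (cos (m%:R * t) * circ_pow_re b s t + sin (m%:R * t) * circ_pow_im b s t).

Let ccos m : continuous (fun t : R => cos (m%:R * t)).
Proof.
apply: is_derive_continuous => t; eexists.
exact: (is_derive1_comp (is_derive_cos _) (is_derive_mul (is_derive_const m%:R t) (is_derive_var t))).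
Qed.

Let csin m : continuous (fun t : R => sin (m%:R * t)).
Proof.
apply: is_derive_continuous => t; eexists.
exact: (is_derive1_comp (is_derive_sin _) (is_derive_mul (is_derive_const m%:R t) (is_derive_var t))).
Qed.

Lemma continuous_fourier_integrand m b :
  continuous (fun t => cos (m%:R * t) * circ_pow_re b r t + sin (m%:R * t) * circ_pow_im b r t).
Proof.
move=> t; apply: cvgD; apply: cvgM.
- exact: ccos.
- exact: continuous_circ_pow_re.
- exact: csin.
- exact: continuous_circ_pow_im.
Qed.

(** The imaginary part of e^(-i(m+1)t) (1 - r e^(it))^(b+1) vanishes at t = pi
    and t = - pi, and its derivative in t is a combination of the integrands of
    the coefficients m and m + 1. *)
Lemma fourier_coefS m b :
  m.+1%:R * fourier_coef m.+1 b r = (m%:R - b) * (r * fourier_coef m b r).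
Proof.
pose f k t := cos (k%:R * t) * circ_pow_re b r t + sin (k%:R * t) * circ_pow_im b r t.
pose F t := cos (m.+1%:R * t) * circ_pow_im (b + 1) r t - sin (m.+1%:R * t) * circ_pow_re (b + 1) r t.
pose g t := (m%:R - b) * r * f m t - m.+1%:R * f m.+1 t.
have cf k : continuous (f k) by exact: continuous_fourier_integrand.
have dF t : is_derive t 1 F (g t).
  have dc := is_derive1_comp (is_derive_cos _) (is_derive_mul (is_derive_const m.+1%:R t) (is_derive_var t)).
  have ds := is_derive1_comp (is_derive_sin _) (is_derive_mul (is_derive_const m.+1%:R t) (is_derive_var t)).
  have := is_derive_sub (is_derive_mul dc (d_cv (b + 1) t)) (is_derive_mul ds (d_cu (b + 1) t)).
  apply: is_derive_val; rewrite /g /f /= addrK mul0r addr0 mulr1.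
  rewrite /circ_pow_re /circ_pow_im (pow_reS _ _ (circ_re_gt0 t r1)) (pow_imS _ _ (circ_re_gt0 t r1)).
  set u := pow_re b _ _; set v := pow_im b _ _.
  have -> : m%:R * t = m.+1%:R * t - t by rewrite -(natr1 m); ring.
  rewrite cosB sinB /circ_re /circ_im -(natr1 m); set C := cos (_ * t); set S := sin (_ * t).
  have := cos2Dsin2 t.
  set c := cos t; set s := sin t => cs.
  ring.
have := integral_pi_derive dF.
rewrite /F /circ_pow_re /circ_pow_im /circ_re /circ_im !mulrN !sinN !cosN sinpi.
rewrite (_ : sin (m.+1%:R * pi) = 0) ?oppr0 ?mul0r ?subr0; last first.
  rewrite mulr_natl; elim: (m.+1) => [|k IH]; first by rewrite mulr0n sin0.
  by rewrite mulrS addrC sinD IH sinpi mul0r mulr0 addr0.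
rewrite !mulr0 oppr0 subrr => /(_ _)/eqP.
have cg : continuous g.
  move=> t; apply: cvgB; apply: cvgM; try exact: cvg_cst; exact: cf.
move=> /(_ cg); rewrite /g RintegralB //; last 2 first.
- apply: continuous_integrable_pi => t; apply: cvgM; first exact: cvg_cst.
  exact: cf.
- apply: continuous_integrable_pi => t; apply: cvgM; first exact: cvg_cst.
  exact: cf.
rewrite !RintegralZl //; try exact: continuous_integrable_pi.
by rewrite subr_eq0 => /eqP <-; rewrite mulrA.
Qed.

Lemma fourier_coefE m b : fourier_coef m b r = r ^+ m * powcoef b m * fourier_coef 0 b r.
Proof.
elim: m => [|m IH]; first by rewrite powcoef0 expr0 !mul1r.
apply: (@mulfI _ m.+1%:R); first by rewrite pnatr_eq0.
rewrite fourier_coefS IH exprS !mulrA (mulrAC _ _ (powcoef b m.+1)) mulrAC.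
have -> : m.+1%:R * r * r ^+ m * powcoef b m.+1 = r * r ^+ m * (m.+1%:R * powcoef b m.+1).
  ring.
rewrite powcoefS; ring.
Qed.

End FixedRadius.
End CircleMean.

Section CircleMean0.
Context {R : realType}.
Implicit Types (b r t : R) (m : nat).
Notation mu := (@lebesgue_measure R).

(** Uniform in the radius, this dominates the derivative under the integral
    sign. *)
Lemma norm_log_mod_circle rho r t : 0 < rho < 1 -> -rho < r < rho ->
  `|log_mod (circ_re r t) (circ_im r t)| <= - ln (1 - rho) + ln 2.
Proof.
move=> /andP[r0 r1] rr.
have nr : `|r| < rho by rewrite ltr_norml.
have sE : circ_re r t ^+ 2 + circ_im r t ^+ 2 = 1 - 2 * (r * cos t) + r ^+ 2.
  have := cos2Dsin2 t; rewrite /circ_re /circ_im; set c := cos t; set s := sin t => cs.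
  have -> : (1 - r * c) ^+ 2 + (- (r * s)) ^+ 2 =
    1 - 2 * (r * c) + r ^+ 2 * (c ^+ 2 + s ^+ 2) by ring.
  by rewrite cs mulr1.
have nc : `|r * cos t| <= `|r|.
  by rewrite normrM ler_piMr // ler_norml cos_geN1 cos_le1.
have r2 : r ^+ 2 = `|r| ^+ 2 by rewrite real_normK ?num_real.
have s_ge : (1 - rho) ^+ 2 <= circ_re r t ^+ 2 + circ_im r t ^+ 2.
  rewrite sE r2; apply: (@le_trans _ _ ((1 - `|r|) ^+ 2)).
    by rewrite lerXn2r ?nnegrE ?subr_ge0 ?lerB // ltW // (lt_trans nr).
  have := ler_norm (r * cos t); nra.
have s_le : circ_re r t ^+ 2 + circ_im r t ^+ 2 <= 2 ^+ 2.
  rewrite sE r2; have := ler_norm (- (r * cos t)); rewrite normrN.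
  have := normr_ge0 r; nra.
have l_ge : ln (1 - rho) <= log_mod (circ_re r t) (circ_im r t).
  rewrite /log_mod ler_pdivlMr // mulrC mulr_natl -lnXn ?subr_gt0 //.
  by rewrite ler_ln ?posrE ?exprn_gt0 ?subr_gt0 // (lt_le_trans _ s_ge) // exprn_gt0 // subr_gt0.
have l_le : log_mod (circ_re r t) (circ_im r t) <= ln 2.
  rewrite /log_mod ler_pdivrMr // mulrC mulr_natl -lnXn //.
  by rewrite ler_ln ?posrE ?exprn_gt0 // (lt_le_trans _ s_ge) // exprn_gt0 // subr_gt0.
have : 0 <= ln 2 :> R by rewrite ln_ge0 // ler1n.
have : ln (1 - rho) <= 0 by rewrite ln_le0 // lerBlDr lerDl ltW.
by rewrite ler_norml; lra.
Qed.

Lemma fourier_coef0 b r : fourier_coef 0 b r = \int[mu]_(t in `[- pi, pi]) circ_pow_re b r t.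
Proof.
by apply: eq_Rintegral => t _; rewrite mul0r cos0 sin0 mul0r mul1r addr0.
Qed.

Let dcu b r t : R := b * (- cos t * circ_pow_re (b - 1) r t - - sin t * circ_pow_im (b - 1) r t).

Let d_cu b r t : -1 < r < 1 -> is_derive r 1 (circ_pow_re b ^~ t) (dcu b r t).
Proof.
move=> r1.
exact: (@is_derive_pow_re _ (circ_re ^~ t) (circ_im ^~ t) r _ _ (circ_re_gt0 t r1) (is_derive_circ_re_radius r t) (is_derive_circ_im_radius r t) b).
Qed.

Let fourier_coef0_derive b r : -1 < r < 1 -> is_derive r 1 (fourier_coef 0 b) 0.
Proof.
move=> r1.
have [rho rhor rho1] : exists2 rho, `|r| < rho & rho < 1.
  have : `|r| < 1 by rewrite ltr_norml.
  by exists ((`|r| + 1) / 2); lra.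
have rho0 : 0 < rho by exact: le_lt_trans rhor.
have rho01 : 0 < rho < 1 by rewrite rho0.
have I1 s : `]- rho, rho[%classic s -> -1 < s < 1.
  by rewrite /= in_itv /= => /andP[s1 s2]; lra.
have Ir : `]- rho, rho[%classic r by rewrite /= in_itv /= -ltr_norml.
pose L := - ln (1 - rho) + ln 2 : R.
pose G t : R := `|b| * (2 * expR (`|b - 1| * L)).
have intf x : `]- rho, rho[%classic x ->
    mu.-integrable `[- pi, pi] (EFin \o circ_pow_re b x).
  by move=> /I1 x1; apply: continuous_integrable_pi; exact: continuous_circ_pow_re.
have derf x y : `]- rho, rho[%classic x -> `[- pi, pi]%classic y ->
    derivable (circ_pow_re b ^~ y) x 1.
  by move=> /I1 x1 _; have [] := d_cu b y x1.
have G0 y : 0 <= G y by rewrite mulr_ge0 // mulr_ge0 // expR_ge0.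
have iG : mu.-integrable `[- pi, pi] (EFin \o G).
  by apply: continuous_integrable_pi => t; exact: cvg_cst.
have Gub x y : `]- rho, rho[%classic x -> `[- pi, pi]%classic y ->
    `|partial1of2 (circ_pow_re b) x y| <= G y.
  move=> xI _; rewrite partial1of2E; have [_ ->] := d_cu b y (I1 _ xI).
  rewrite /dcu normrM ler_wpM2l // -mulNr opprK.
  have e : expR ((b - 1) * log_mod (circ_re x y) (circ_im x y)) <= expR (`|b - 1| * L).
    rewrite ler_expR (le_trans (ler_norm _)) // normrM ler_wpM2l //.
    by apply: norm_log_mod_circle => //; rewrite /= in_itv /= in xI.
  have N1 (p q : R) : `|p| <= 1 -> `|q| <= 1 ->
    `|p * (expR ((b - 1) * log_mod (circ_re x y) (circ_im x y)) * q)| <= expR (`|b - 1| * L).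
    move=> p1 q1; rewrite !normrM (ger0_norm (expR_ge0 _)).
    rewrite mulrCA; apply: le_trans e; rewrite ler_piMr ?expR_ge0 //.
    by rewrite -(mulr1 1) ler_pM.
  apply: (le_trans (ler_normD _ _)); rewrite mulr_natl mulr2n lerD //.
  - by apply: N1; rewrite ?normrN ler_norml ?cos_geN1 ?cos_le1.
  - by apply: N1; rewrite ler_norml ?sin_geN1 ?sin_le1.
have mI : measurable (`[- pi, pi] : set R) by exact: measurable_itv.
have E : fourier_coef 0 b = fun s => \int[mu]_(t in `[- pi, pi]) circ_pow_re b s t.
  by apply/funext => s; exact: fourier_coef0.
have D := @derivable_under_integral R _ _ mu (circ_pow_re b) _ mI r (- rho) rho Ir intf derf G G0 iG Gub.
have V := @differentiation_under_integral R _ _ mu (circ_pow_re b) _ mI r (- rho) rho Ir intf derf G G0 iG Gub.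
rewrite E; apply: DeriveDef => //.
rewrite -derive1E V.
rewrite (_ : (fun y => _) = dcu b r); last first.
  by apply/funext => y; rewrite partial1of2E; have [_ ->] := d_cu b y r1.
(* At r = 0 the derivative is - b cos t; elsewhere it is 1/r times the
   derivative in t of the imaginary part. *)
have [r0|r0] := eqVneq r 0.
  have e0 t : log_mod (circ_re 0 t) (circ_im 0 t) = 0.
    by rewrite /log_mod /circ_re /circ_im !mul0r oppr0 addr0 expr1n expr0n addr0 ln1 mul0r.
  have p0 t : plane_arg (circ_re 0 t) (circ_im 0 t) = 0.
    by rewrite /plane_arg /circ_re /circ_im !mul0r oppr0 mul0r atan0.
  have -> : dcu b r = fun t => (- b) * cos t.
    apply/funext => t; rewrite /dcu /circ_pow_re /circ_pow_im /pow_re /pow_im r0 e0 p0 !mulr0 expR0.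
    by rewrite cos0 sin0; ring.
  rewrite (@integral_pi_derive _ (fun t => - b * sin t)).
  - by rewrite sinN sinpi; ring.
  - move=> t; apply: cvgM; first exact: cvg_cst.
    exact: continuous_cos.
have dI t : is_derive t 1 (fun t => r^-1 * circ_pow_im b r t) (dcu b r t).
  have dv := is_derive_pow_im (circ_re_gt0 t r1) (is_derive_circ_re r t) (is_derive_circ_im r t) b.
  by apply: is_derive_val (is_derive_mul (is_derive_const r^-1 t) dv); rewrite /dcu /circ_pow_re /circ_pow_im; field.
rewrite (integral_pi_derive dI).
  by rewrite /circ_pow_im /circ_re /circ_im sinN cosN sinpi !mulr0 oppr0 mulr0 oppr0 subrr.
move=> t; apply: cvgM; first exact: cvg_cst.
apply: cvgB; apply: cvgM.
- by apply: cvgN; exact: continuous_cos.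
- exact: continuous_circ_pow_re.
- by apply: cvgN; exact: continuous_sin.
- exact: continuous_circ_pow_im.
Qed.

(** The mean value property at the centre, where (1 - z)^b = 1. *)
Lemma fourier_coef0E b r : 0 < r < 1 -> fourier_coef 0 b r = 2 * pi.
Proof.
move=> /andP[r0 r1].
have d s : s \in `]0, r[ -> is_derive s 1 (fourier_coef 0 b) 0.
  by rewrite in_itv /= => /andP[s0 sr]; apply: fourier_coef0_derive; lra.
have c : {within `[0, r], continuous (fourier_coef 0 b)}.
  apply: derivable_within_continuous => s; rewrite in_itv /= => /andP[s0 sr].
  have s1 : -1 < s < 1 by lra.
  by have [] := fourier_coef0_derive b s1.
have [s _] := MVT r0 d c; rewrite mul0r => /eqP; rewrite subr_eq0 => /eqP ->.
rewrite fourier_coef0 (_ : (fun t => _) = fun=> 1); last first.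
  apply/funext => t; rewrite /circ_pow_re /pow_re /log_mod /plane_arg /circ_re /circ_im !mul0r oppr0 addr0.
  by rewrite expr1n expr0n addr0 ln1 !mul0r atan0 !mulr0 expR0 cos0 mulr1.
rewrite (integral_pi_derive (@is_derive_var R)); last by move=> t; exact: cvg_cst.
by rewrite opprK mulr_natl mulr2n.
Qed.

End CircleMean0.

(** * The discrete Wright function as a finite sum *)

Section ComplexSide.
Local Open Scope complex_scope.
Context {R : realType}.
Implicit Types (a b r h t x y : R) (m n i j : nat).
Notation mu := (@lebesgue_measure R).

(** The tangent duplication formula: the half-angle formula that defines the
    principal argument gives y/x on the right half-plane. *)
Lemma carg_plane_arg x y : 0 < x -> carg (x +i* y) = plane_arg x y.
Proof.
move=> x0; rewrite /carg /= ltNge (ltW x0) andbF.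
set m := Num.sqrt _.
have m2 : m ^+ 2 = x ^+ 2 + y ^+ 2 by rewrite sqr_sqrtr // ltW // sqn_gt0.
have m0 : 0 < m by rewrite sqrtr_gt0 sqn_gt0.
set w := y / (x + m).
have ym : `|y| <= m by rewrite -ler_sqr ?nnegrE // ?(ltW m0) // m2 real_normK ?num_real // lerDr sqr_ge0.
have xm : 0 < x + m by rewrite addr_gt0.
have w1 : `|w| < 1.
  by rewrite /w normrM normfV (gtr0_norm xm) ltr_pdivrMr // mul1r (le_lt_trans ym) // ltrDr.
have : - (pi / 4) < atan w < pi / 4.
  by rewrite -atan1 -atanN !lt_atan //; move: w1; rewrite ltr_norml => /andP[].
move=> /andP[u1 u2].
have a0 := pi_gt0 R.
have I2 : 2 * atan w \in `](- (pi / 2)), (pi / 2)[ by rewrite in_itv /=; lra.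
rewrite -(tanK I2) /plane_arg; congr atan.
have c0 : 0 < cos (atan w) by rewrite cos_atan invr_gt0 sqrtr_gt0 ltr_pwDl ?sqr_ge0.
have tw : sin (atan w) = w * cos (atan w).
  by have := atanK w; rewrite {1}/tan => /(canRL (divfK (lt0r_neq0 c0))).
rewrite mulr_natl /tan sin_mulr2n cos_mulr2n tw.
have c2 := cos2Dsin2 (atan w); rewrite tw in c2.
set c := cos (atan w) in c0 tw c2 *.
have -> : c * (w * c) *+ 2 = 2 * w * c ^+ 2 by ring.
have c3 : c ^+ 2 * (1 + w ^+ 2) = 1 by rewrite -[RHS]c2; ring.
have -> : c ^+ 2 *+ 2 - 1 = c ^+ 2 * (1 - w ^+ 2) by rewrite -[X in _ - X]c3; ring.
have c20 : c ^+ 2 != 0 by rewrite gt_eqF // exprn_gt0.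
have -> : 1 - w ^+ 2 = 2 * x / (x + m).
  have -> : 1 - w ^+ 2 = ((x + m) ^+ 2 - y ^+ 2) / (x + m) ^+ 2.
    by rewrite /w; field; rewrite gt_eqF.
  have -> : (x + m) ^+ 2 - y ^+ 2 = 2 * x * (x + m).
    have -> : (x + m) ^+ 2 - y ^+ 2 = x ^+ 2 + 2 * x * m + (m ^+ 2 - y ^+ 2) by ring.
    by rewrite m2; ring.
  by field; rewrite gt_eqF.
by rewrite /w; field; rewrite !gt_eqF.
Qed.

Definition plane_pow b x y : R[i] := pow_re b x y +i* pow_im b x y.

Lemma cpow_plane_pow b x y : 0 < x -> cpow (x +i* y) b = plane_pow b x y.
Proof.
move=> x0; rewrite /cpow carg_plane_arg // /plane_pow /pow_re /pow_im /cis.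
have -> : Normc.normc (x +i* y) `^ b = expR (b * log_mod x y).
  rewrite /= /powR gt_eqF ?sqrtr_gt0 ?sqn_gt0 //; congr (expR (_ * _)).
  by rewrite -exp_log_mod // expRK.
by simpc.
Qed.

Lemma plane_powD a b x y : plane_pow (a + b) x y = plane_pow a x y * plane_pow b x y.
Proof.
rewrite /plane_pow /pow_re /pow_im !mulrDl expRD cosD sinD; simpc.
by congr (_ +i* _); ring.
Qed.

Lemma plane_pow0 x y : plane_pow 0 x y = 1.
Proof. by rewrite /plane_pow /pow_re /pow_im !mul0r expR0 cos0 sin0 mul1r mulr0. Qed.

Lemma plane_powB a b x y : plane_pow (a - b) x y = plane_pow a x y / plane_pow b x y.
Proof.
have E : plane_pow (- b) x y * plane_pow b x y = 1 by rewrite -plane_powD addNr plane_pow0.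
have b0 : plane_pow b x y != 0.
  by apply/eqP => b0; move: E => /eqP; rewrite b0 mulr0 eq_sym oner_eq0.
by apply: (mulIf b0); rewrite divfK // plane_powD -mulrA E mulr1.
Qed.

Lemma plane_powX a i x y : plane_pow (a * i%:R) x y = plane_pow a x y ^+ i.
Proof.
elim: i => [|i IH]; first by rewrite mulr0 plane_pow0.
by rewrite -natr1 mulrDr mulr1 plane_powD IH exprSr.
Qed.

Lemma plane_pow_scale b h x y : 0 < h -> 0 < x ->
  plane_pow b (x / h) (y / h) = (h `^ (- b))%:C * plane_pow b x y.
Proof.
move=> h0 x0; rewrite /plane_pow /pow_re /pow_im.
have -> : plane_arg (x / h) (y / h) = plane_arg x y.
  by rewrite /plane_arg; congr atan; field; rewrite !gt_eqF.
have -> : log_mod (x / h) (y / h) = log_mod x y - ln h.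
  rewrite /log_mod !expr_div_n -mulrDl.
  rewrite lnM ?posrE ?invr_gt0 ?exprn_gt0 ?sqn_gt0 // lnV ?posrE ?exprn_gt0 //.
  by rewrite lnXn // -mulr_natl; field.
rewrite /powR gt_eqF // mulrBr expRD -mulNr.
by simpc; congr (_ +i* _); ring.
Qed.

Lemma cisX t n : cis t ^+ n = cis (n%:R * t).
Proof.
elim: n => [|n IH]; first by rewrite mul0r /cis cos0 sin0.
rewrite exprS IH -natr1 mulrDl mul1r /cis cosD sinD; simpc.
by congr (_ +i* _); ring.
Qed.

Lemma cisV t : (cis t)^-1 = cis (- t) :> R[i].
Proof.
have E : cis (- t) * cis t = 1 :> R[i].
  rewrite /cis cosN sinN; simpc; congr (_ +i* _); last by ring.
  by rewrite -(cos2Dsin2 t); ring.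
have t0 : cis t != 0 :> R[i].
  by apply/eqP => t0; move: E => /eqP; rewrite t0 mulr0 eq_sym oner_eq0.
by apply: (mulIf t0); rewrite mulVf // E.
Qed.

Lemma ReZ (k : R) (z : R[i]) : complex.Re (k%:C * z) = k * complex.Re z.
Proof. by case: z => x y /=; rewrite mul0r subr0. Qed.

Lemma Re_sum (n : nat) (F : 'I_n -> R[i]) :
  complex.Re (\sum_i F i) = \sum_i complex.Re (F i).
Proof. by rewrite (raddf_sum (@complex.Re R)). Qed.

Variables (r h alpha : R) (n j : nat).
Hypotheses (r01 : 0 < r < 1) (h0 : 0 < h).

Let r1 : -1 < r < 1. Proof. by move: r01; lra. Qed.
Let q := h `^ (1 - alpha).
Let be i := alpha * i.+1%:R - 1.

Let circ_Im t :
  complex.Im (circle_integrand r (wright_fun h alpha (1 - alpha) n j) t) =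
  \sum_(i < j.+1) ('C(j, i)%:R * (- h) ^+ i * r ^- n * h `^ (- be i)) *
    (cos (n%:R * t) * circ_pow_re (be i) r t + sin (n%:R * t) * circ_pow_im (be i) r t).
Proof.
have [r0 _] := andP r01.
rewrite /circle_integrand /wright_fun.
set z := r%:C * cis t.
have z0 : z != 0.
  rewrite mulf_neq0 //; first by rewrite eq_complex /= eqxx andbT gt_eqF.
  rewrite eq_complex /=; apply/negP => /andP[/eqP c /eqP s].
  have := cos2Dsin2 t; rewrite c s expr0n addr0 => /eqP.
  by rewrite eq_sym oner_eq0.
have X0 := circ_re_gt0 t r1.
have wE : (1 - z) / h%:C = (circ_re r t / h) +i* (circ_im r t / h).
  rewrite -fmorphV /z /cis /circ_re /circ_im; simpc.
  by rewrite ?mul0r ?mulr0 ?subr0 ?addr0 ?add0r; congr (_ +i* _); ring.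
rewrite wE !cpow_plane_pow ?divr_gt0 //.
have -> : (z ^+ n.+1)^-1 *
  ((1 - h%:C * plane_pow alpha (circ_re r t / h) (circ_im r t / h)) ^+ j /
     plane_pow (1 - alpha) (circ_re r t / h) (circ_im r t / h)) * ('i%C * z) =
  'i%C * (z ^- n * ((1 - h%:C * plane_pow alpha (circ_re r t / h) (circ_im r t / h)) ^+ j /
     plane_pow (1 - alpha) (circ_re r t / h) (circ_im r t / h))).
  set B := _ ^+ j / _; rewrite exprS invfM; set A := (z ^+ n)^-1.
  have -> : z^-1 * A * B * ('i%C * z) = 'i%C * (A * B) * (z^-1 * z) by ring.
  by rewrite mulVf // mulr1.
have ImI (c : R[i]) : complex.Im ('i%C * c) = complex.Re c.
  by case: c => p s; simpc.
rewrite ImI [1 - _]addrC exprDn mulr_suml mulr_sumr Re_sum.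
rewrite (reindex_inj rev_ord_inj) /=; apply: eq_bigr => i _.
have ij : (i <= j)%N by rewrite -ltnS.
rewrite subSS subKn // expr1n mulr1 bin_sub // -(mulNr h%:C) !exprMn -plane_powX.
have bE : alpha * i%:R - (1 - alpha) = be i.
  by rewrite /be -natr1; ring.
rewrite -[X in X / plane_pow _ _ _]mulr_natl invfM cisX cisV.
have rX (k : R) p : k%:C ^+ p = (k ^+ p)%:C by rewrite -rmorphXn.
have rV (k : R) : (k%:C)^-1 = (k^-1)%:C by rewrite -fmorphV.
have rN (k : R) : - k%:C = (- k)%:C by rewrite -rmorphN.
have rM (k l : R) : k%:C * l%:C = (k * l)%:C by rewrite -rmorphM.
have rn p : p%:R = (p%:R : R)%:C by rewrite -(rmorph_nat (real_complex R)).
rewrite rN !rX rV [X in _ * (X * _ / _)]rn.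
set A := (r ^- n)%:C; set B := ('C(j, i)%:R)%:C; set C := ((- h) ^+ i)%:C.
set P := plane_pow _ _ _; set Q := plane_pow _ _ _; set S := cis _.
have -> : A * S * (B * (C * P) / Q) = (B * C * A) * (S * (P / Q)).
  by rewrite (mulrC A S); ring.
rewrite /P /Q -plane_powB bE plane_pow_scale //.
set D := (_ `^ _)%:C; set P' := plane_pow _ _ _.
have -> : B * C * A * (S * (D * P')) = (B * C * A * D) * (S * P').
  by rewrite (mulrCA S); ring.
rewrite /A /B /C /D !rM ReZ; congr (_ * _).
rewrite /P'.
by rewrite /S /cis /plane_pow cosN sinN; simpc => /=; rewrite /circ_pow_re /circ_pow_im; ring.
Qed.

(** Both powers of the integrand are powers of the same base (1 - z)/h, so that
    the binomial formula leaves integrals of single powers (1 - z)^b. *)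
Lemma Re_wright : complex.Re (wright r h alpha (1 - alpha) n j) =
  q * \sum_(i < j.+1) 'C(j, i)%:R *
     ((- q) ^+ i * powcoef (alpha * i.+1%:R - 1) n).
Proof.
have [r0 _] := andP r01.
rewrite /wright /circle_integral.
set A := Rintegral _ _ _; set B := Rintegral _ _ _.
have -> : (2 * pi%:C * 'i%C)^-1 = 0 +i* (- (2 * pi)^-1) :> R[i].
  have -> : 2 * pi%:C * 'i%C = 0 +i* (2 * pi) :> R[i].
    rewrite -(rmorph_nat (real_complex R)) -rmorphM /=.
    by simpc.
  have p0 : 2 * pi != 0 :> R by rewrite mulf_neq0 ?pnatr_eq0 // gt_eqF ?pi_gt0.
  have i0 : (0 +i* (2 * pi) : R[i]) != 0 by rewrite eq_complex /= eqxx.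
  apply: (mulIf i0); rewrite mulVf //; simpc.
  by rewrite mulVf // ?mul0r ?mulr0 ?oppr0 ?subr0 ?add0r.
rewrite /= mul0r sub0r mulNr opprK {A}.
have -> : B = \sum_(i < j.+1) ('C(j, i)%:R * (- h) ^+ i * r ^- n * h `^ (- be i)) *
    fourier_coef n (be i) r.
  rewrite -Rintegral_sumr // => [|i]; last first.
    exact/continuous_integrable_pi/continuous_fourier_integrand.
  by apply: eq_Rintegral => t _; exact: circ_Im.
rewrite !mulr_sumr; apply: eq_bigr => i _.
rewrite fourier_coefE // fourier_coef0E //.
have -> : h `^ (- be i) = h `^ (1 - alpha) * h `^ (- alpha * i%:R).
  rewrite -powRD; last by rewrite (gt_eqF h0) implybT.
  by rewrite /be -natr1; congr (_ `^ _); ring.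
have -> : (- q) ^+ i = (- h) ^+ i * h `^ (- alpha * i%:R).
  rewrite exprNn (exprNn h) -mulrA; congr (_ * _); rewrite /q.
  rewrite -powR_mulrn ?powR_ge0 // -powRrM -(powR_mulrn i (ltW h0)) -powRD.
    by congr (_ `^ _); ring.
  by rewrite (gt_eqF h0) implybT.
have p0 : pi != 0 :> R by rewrite gt_eqF // pi_gt0.
by move: p0; rewrite /q /be; move: pi => P p0; field; rewrite p0 expf_neq0 // gt_eqF.
Qed.

End ComplexSide.

(** * Calculus on the half-line and Gamma integrals *)

Section HalfLine.
Context {R : realType}.
Implicit Types (f F : R -> R) (a b k s t : R).
Notation mu := (@lebesgue_measure R).
Notation D := (`]0, +oo[%classic : set R).

Lemma measurable_halfline f : (forall t, 0 < t -> {for t, continuous f}) ->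
  measurable_fun D f.
Proof.
move=> cf; apply: open_continuous_measurable_fun; first exact: interval_open.
by move=> t; rewrite inE /= in_itv /= andbT => /cf.
Qed.

Let S n : set R := `[n.+1%:R^-1, n.+2%:R].

Let ab n : n.+1%:R^-1 < n.+2%:R :> R.
Proof.
by rewrite (@le_lt_trans _ _ 1) ?invf_le1 ?ltr0n ?ler1n ?ltr1n.
Qed.

Let S_pos n t : S n t -> 0 < t.
Proof.
by rewrite /S /= in_itv /= => /andP[+ _]; apply: lt_le_trans; rewrite invr_gt0 ltr0n.
Qed.

Let S_nd : nondecreasing_seq S.
Proof.
apply/nondecreasing_seqP => n; rewrite subsetEset => t.
rewrite /S /= !in_itv /= => /andP[h1 h2]; apply/andP; split.
  by apply: le_trans h1; rewrite lef_pV2 ?posrE ?ltr0n // ler_nat.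
by apply: (le_trans h2); rewrite ler_nat.
Qed.

Let S_cup : \bigcup_n S n = D.
Proof.
apply/seteqP; split=> t.
  by move=> [n _ /S_pos t0]; rewrite /= in_itv /= andbT.
rewrite /= in_itv /= andbT => t0.
pose m := maxn (Num.truncn t^-1) (Num.truncn t).
exists m => //; rewrite /S /= in_itv /=; apply/andP; split.
  rewrite -[leRHS]invrK lef_pV2 ?posrE ?ltr0n ?invr_gt0 //.
  by rewrite (le_trans (ltW (truncnS_gt _))) // ler_nat ltnS leq_maxl.
by rewrite (le_trans (ltW (truncnS_gt _))) // ler_nat ltnS ltnW // ltnS leq_maxr.
Qed.

(** Fundamental theorem of calculus on the half-line, for a derivative given
    as a difference of two nonnegative functions whose integrals may both be
    infinite. *)
Lemma FTC_halfline F f1 f2 a b :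
  (forall t, 0 < t -> is_derive t 1 F (f1 t - f2 t)) ->
  (forall t, 0 < t -> {for t, continuous f1}) ->
  (forall t, 0 < t -> {for t, continuous f2}) ->
  (forall t, 0 < t -> 0 <= f1 t) -> (forall t, 0 < t -> 0 <= f2 t) ->
  F n.+1%:R^-1 @[n --> \oo] --> a -> F n.+2%:R @[n --> \oo] --> b ->
  (\int[mu]_(t in D) (f1 t)%:E = \int[mu]_(t in D) (f2 t)%:E + (b - a)%:E)%E.
Proof.
move=> dF c1 c2 f10 f20 Fa Fb.
have cS f n : (forall t, 0 < t -> {for t, continuous f}) ->
    {within S n, continuous f}.
  by move=> cf; apply: continuous_in_subspaceT => t; rewrite inE => /S_pos; exact: cf.
have iS f n : (forall t, 0 < t -> {for t, continuous f}) ->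
    mu.-integrable (S n) (EFin \o f).
  move=> cf; apply: continuous_compact_integrable; first exact: segment_compact.
  exact: cS.
have H f : (forall t, 0 < t -> {for t, continuous f}) ->
    (forall t, 0 < t -> 0 <= f t) ->
    (\int[mu]_(t in S n) (f t)%:E @[n --> \oo] --> \int[mu]_(t in D) (f t)%:E)%E.
  move=> cf f0; rewrite -S_cup; apply: ge0_nondecreasing_set_cvg_integral => //.
  - by move=> n; exact: measurable_itv.
  - by move=> n; apply: measurable_int (iS _ n cf).
  - by move=> n t /S_pos t0; rewrite lee_fin f0.
have E n : (\int[mu]_(t in S n) (f1 t)%:E =
    \int[mu]_(t in S n) (f2 t)%:E + (F n.+2%:R - F n.+1%:R^-1)%:E)%E.
  have cF t : 0 < t -> {for t, continuous F}.
    move=> t0; have [dt _] := dF t t0.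
    by apply/differentiable_continuous/derivable1_diffP.
  have := @continuous_FTC2 R (fun t => f1 t - f2 t) F _ _ (ab n).
  have -> : `[n.+1%:R^-1, n.+2%:R]%classic = S n by [].
  have fin f : (forall t, 0 < t -> {for t, continuous f}) ->
     (\int[mu]_(t in S n) (f t)%:E)%E \is a fin_num.
    by move=> cf; apply: integrable_fin_num (iS f n cf); exact: measurable_itv.
  have cB : {within S n, continuous (fun t => f1 t - f2 t)}.
    by apply: cS => t t0; apply: cvgB; [exact: c1|exact: c2].
  move=> /(_ cB) I.
  have -> : (F n.+2%:R - F n.+1%:R^-1)%:E =
      (\int[mu]_(t in S n) (f1 t)%:E - \int[mu]_(t in S n) (f2 t)%:E)%E.
    rewrite -integralB_EFin //; try exact: iS; last exact: measurable_itv.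
    have n0 : 0 < n.+1%:R^-1 :> R by rewrite invr_gt0.
    rewrite EFinB; apply/esym/I.
    - split.
      + move=> t; rewrite in_itv /= => /andP[h _].
        by have [] := dF t (lt_trans n0 h).
      + by apply: cvg_at_right_filter; apply: cF; rewrite invr_gt0.
      + by apply: cvg_at_left_filter; exact: cF.
    - move=> t; rewrite in_itv /= => /andP[h _].
      by rewrite derive1E; have [_ ->] := dF t (lt_trans n0 h).
  by rewrite addeC subeK // fin.
have C1 := H _ c1 f10.
have C2 : (\int[mu]_(t in S n) (f1 t)%:E @[n --> \oo] -->
    \int[mu]_(t in D) (f2 t)%:E + (b - a)%:E)%E.
  under eq_fun do rewrite E.
  apply: cvgeD; [exact: fin_num_adde_defl|exact: H|].
  by apply: cvg_EFin; [exact: nearW|exact: cvgB].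
exact: (cvg_unique _ C1 C2).
Qed.

End HalfLine.

Section GammaIntegral.
Context {R : realType}.
Implicit Types (k s t : R).
Notation mu := (@lebesgue_measure R).
Notation D := (`]0, +oo[%classic : set R).

Lemma is_derive_powR a t : 0 < t ->
  is_derive t 1 (fun t => t `^ a) (a * t `^ (a - 1)).
Proof. exact: is_derive1_powR. Qed.

Lemma is_derive_expRM k t :
  is_derive t 1 (fun t => expR (- (k * t))) (- k * expR (- (k * t))).
Proof.
have := is_derive1_comp (is_derive_expR _) (is_derive_opp (is_derive_mul (is_derive_const k t) (is_derive_var t))).
by apply: is_derive_val; ring.
Qed.

Lemma continuous_powR_expR k a t : 0 < t ->
  {for t, continuous (fun t => t `^ a * expR (- (k * t)))}.
Proof.
move=> t0; have [d _] := is_derive_mul (is_derive_powR a t0) (is_derive_expRM k t).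
by apply/differentiable_continuous/derivable1_diffP.
Qed.

Lemma powR_expR_ge0 k a t : 0 <= t `^ a * expR (- (k * t)).
Proof. by rewrite mulr_ge0 ?powR_ge0 ?expR_ge0. Qed.

Lemma measurable_powR_expR k a :
  measurable_fun D (fun t => t `^ a * expR (- (k * t))).
Proof. by apply: measurable_halfline => t t0; exact: continuous_powR_expR. Qed.

Definition gamma_int k s : \bar R :=
  (\int[mu]_(t in D) (t `^ (s - 1) * expR (- (k * t)))%:E)%E.

Lemma cvg_invn : (n.+1%:R^-1 : R) @[n --> \oo] --> 0.
Proof. exact: cvg_harmonic. Qed.

Let cvg_powR_expR_seq k s (u : nat -> R) : 0 < k -> 0 < s ->
  (forall n, 0 < u n) ->
  (u n * expR (- (k / s * u n))) @[n --> \oo] --> 0 ->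
  ((u n `^ s) * expR (- (k * u n))) @[n --> \oo] --> 0.
Proof.
move=> k0 s0 u0 ug.
(* Reduces the limit to that of t exp(- c t), by taking the s-th power. *)
have E n : u n `^ s * expR (- (k * u n)) =
    (u n * expR (- (k / s * u n))) `^ s.
  rewrite powRM ?(ltW (u0 n)) ?expR_ge0 //; congr (_ * _).
  rewrite /powR gt_eqF ?expR_gt0 // expRK; congr expR.
  by field; rewrite gt_eqF.
under eq_fun do rewrite E.
have := powR_cvg0 s0 => /cvg_at_rightP; apply; split => //.
by move=> n; rewrite mulr_gt0 ?expR_gt0.
Qed.

Lemma cvg_powR_expR0 k s : 0 < k -> 0 < s ->
  ((n.+1%:R^-1 : R) `^ s * expR (- (k * n.+1%:R^-1))) @[n --> \oo] --> 0.
Proof.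
move=> k0 s0; apply: cvg_powR_expR_seq => //.
apply: (@squeeze_cvgr _ _ _ _ (cst 0) (fun n => n.+1%:R^-1)).
- apply: nearW => n /=; rewrite mulr_ge0 ?expR_ge0 //=.
  rewrite ler_piMr // -expR0 ler_expR oppr_le0.
  by rewrite mulr_ge0 // divr_ge0 ?(ltW k0) ?(ltW s0).
- exact: cvg_cst.
- exact: cvg_invn.
Qed.

Lemma cvg_powR_expRy k s : 0 < k -> 0 < s ->
  ((n.+2%:R : R) `^ s * expR (- (k * n.+2%:R))) @[n --> \oo] --> 0.
Proof.
move=> k0 s0; apply: cvg_powR_expR_seq => //.
set c := k / s; have c0 : 0 < c by rewrite divr_gt0.
apply: (@squeeze_cvgr _ _ _ _ (cst 0) (fun n => 4 / c ^+ 2 * n.+1%:R^-1)).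
- apply: nearW => n /=; rewrite mulr_ge0 ?expR_ge0 //=.
  rewrite expRN ler_pdivrMr ?expR_gt0 //.
  set t : R := n.+2%:R.
  have t0 : 0 < t by rewrite ltr0n.
  set y := c * t / 2; have y0 : 0 < y by rewrite divr_gt0 // mulr_gt0.
  have e : y ^+ 2 <= expR (c * t).
    have -> : c * t = y + y by rewrite /y; field.
    rewrite expRD -expr2 lerXn2r ?nnegrE ?expR_ge0 ?(ltW y0) //.
    by apply: le_trans (expR_ge1Dx y); rewrite lerDr.
  apply: (@le_trans _ _ (4 / c ^+ 2 * n.+1%:R^-1 * y ^+ 2)); last first.
    by rewrite ler_wpM2l // mulr_ge0 ?invr_ge0 // divr_ge0 // sqr_ge0.
  have -> : 4 / c ^+ 2 * n.+1%:R^-1 * y ^+ 2 = t * (t / n.+1%:R).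
    by rewrite /y; field; rewrite nat1r pnatr_eq0 /= gt_eqF.
  by rewrite ler_peMr ?(ltW t0) // ler_pdivlMr // mul1r ler_nat.
- exact: cvg_cst.
- rewrite -[X in _ --> X](mulr0 (4 / c ^+ 2)).
  by apply: cvgM; [exact: cvg_cst|exact: cvg_invn].
Qed.

(** The functional equation of Gamma, valid without knowing that the integrals
    are finite; finiteness for small s will be deduced from it. *)
Lemma gamma_intS k s : 0 < k -> 0 < s -> (k%:E * gamma_int k (s + 1) = s%:E * gamma_int k s)%E.
Proof.
move=> k0 s0; rewrite /gamma_int addrK.
rewrite -!ge0_integralZl_EFin ?(ltW k0) ?(ltW s0) //; last 4 first.
- by move=> t _; rewrite lee_fin powR_expR_ge0.
- by apply/measurable_EFinP; exact: measurable_powR_expR.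
- by move=> t _; rewrite lee_fin powR_expR_ge0.
- by apply/measurable_EFinP; exact: measurable_powR_expR.
under eq_integral do rewrite -EFinM.
under [RHS]eq_integral do rewrite -EFinM.
have c c0 a t : 0 < t ->
    {for t, continuous (fun t => c0 * (t `^ a * expR (- (k * t))))}.
  move=> t0; apply: cvgM; first exact: cvg_cst.
  exact: continuous_powR_expR.
have dF t : 0 < t -> is_derive t 1 (fun t => - (t `^ s * expR (- (k * t))))
    (k * (t `^ s * expR (- (k * t))) - s * (t `^ (s - 1) * expR (- (k * t)))).
  move=> t0.
  by apply: is_derive_val (is_derive_opp (is_derive_mul (is_derive_powR s t0) (is_derive_expRM k t))); ring.
rewrite (FTC_halfline (a := 0) (b := 0) dF); first by rewrite subr0 adde0.
- by move=> t; exact: c.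
- by move=> t; exact: c.
- by move=> t t0; rewrite mulr_ge0 ?powR_expR_ge0 // ltW.
- by move=> t t0; rewrite mulr_ge0 ?powR_expR_ge0 // ltW.
- by rewrite -[X in _ --> X]oppr0; apply: cvgN; exact: cvg_powR_expR0.
- by rewrite -[X in _ --> X]oppr0; apply: cvgN; exact: cvg_powR_expRy.
Qed.

Lemma gamma_int1 k : 0 < k -> gamma_int k 1 = (k^-1)%:E.
Proof.
move=> k0; rewrite /gamma_int subrr.
have dF t : 0 < t -> is_derive t 1 (fun t => - k^-1 * expR (- (k * t)))
    (t `^ 0 * expR (- (k * t)) - 0).
  move=> t0; rewrite powRr0 mul1r subr0.
  apply: is_derive_val (is_derive_mul (is_derive_const _ t) (is_derive_expRM k t)); field.
  by rewrite gt_eqF.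
rewrite (@FTC_halfline _ _ _ (fun=> 0) (- k^-1) 0 dF).
- by rewrite integral0 add0e sub0r opprK.
- by move=> t; exact: continuous_powR_expR.
- by move=> t _; exact: cvg_cst.
- by move=> t _; exact: powR_expR_ge0.
- by [].
- rewrite -[X in _ --> X]mulr1; apply: cvgM; first exact: cvg_cst.
  rewrite -[X in _ --> X]expR0; apply: continuous_cvg; first exact: continuous_expR.
  rewrite -[X in _ --> X]oppr0; apply: cvgN.
  rewrite -[X in _ --> X](mulr0 k); apply: cvgM; first exact: cvg_cst.
  exact: cvg_invn.
- rewrite -[X in _ --> X](mulr0 (- k^-1)); apply: cvgM; first exact: cvg_cst.
  apply: (@squeeze_cvgr _ _ _ _ (cst 0) (fun n => n.+2%:R `^ 1 * expR (- (k * n.+2%:R)))).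
  + apply: nearW => n /=; rewrite expR_ge0 /= powRr1 // ler_peMl ?expR_ge0 //.
    by rewrite ler1n.
  + exact: cvg_cst.
  + exact: cvg_powR_expRy.
Qed.

(** Iterated, the functional equation produces the coefficients of
    (1 - z)^(- s). *)
Lemma gamma_int_natD k s n : 0 < k -> 0 < s -> 
  ((k ^+ n)%:E * gamma_int k (s + n%:R) = (n`!%:R * powcoef (- s) n)%:E * gamma_int k s)%E.
Proof.
move=> k0 s0; elim: n => [|n IH].
  by rewrite addr0 powcoef0 fact0 mulr1 expr0.
rewrite exprSr EFinM -muleA -natr1 addrA gamma_intS ?ltr_wpDr //.
rewrite muleCA IH muleA -EFinM; congr (_%:E * _)%E.
have := powcoefS (- s) n; rewrite factS natrM opprK [s + _]addrC => E.
by rewrite mulrCA -E; ring.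
Qed.

(** By the functional equation it is enough to bound the integral of
    t^(1 - th) e^(- k t), where (k t)^(1 - th) <= 1 + k t. The power of k is
    the one that scaling predicts. *)
Lemma gamma_int_ub k th : 0 < k -> 0 <= th < 1 ->
  (gamma_int k (1 - th) <= (2 * k `^ (th - 1) / (1 - th))%:E)%E.
Proof.
move=> k0 /andP[th0 th1].
have h0 : 0 < 1 - th by rewrite subr_gt0.
have g2 : gamma_int k 2 = (k^-1 * k^-1)%:E.
  have := @gamma_intS k 1 k0 ltr01; rewrite mul1e gamma_int1 // => /(congr1 (fun x => (k^-1)%:E * x)%E).
  by rewrite muleA -EFinM mulVf ?gt_eqF // mul1e -EFinM.
suff : (gamma_int k (1 - th + 1) <= (k `^ (th - 1) * 2 / k)%:E)%E.
  move=> H; have := gamma_intS k0 h0 => E.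
  have : (gamma_int k (1 - th) = ((1 - th)^-1 * k)%:E * gamma_int k (1 - th + 1))%E.
    by rewrite EFinM -muleA E muleA -EFinM mulVf ?gt_eqF // mul1e.
  move=> ->; apply: (le_trans (lee_wpmul2l _ H)).
    by rewrite lee_fin mulr_ge0 ?invr_ge0 // ltW.
  rewrite -EFinM lee_fin le_eqVlt; apply/orP; left; apply/eqP.
  by field; rewrite !gt_eqF.
rewrite /gamma_int addrK.
pose e a t := t `^ (a - 1) * expR (- (k * t)).
have me a c : measurable_fun D (fun t => (c * e a t)%:E).
  by apply/measurable_EFinP; apply: measurable_funM => //; exact: measurable_powR_expR.
have e0 a t : 0 <= e a t by exact: powR_expR_ge0.
have K0 : 0 <= k `^ (th - 1) by exact: powR_ge0.
have Kk0 : 0 <= k `^ (th - 1) * k by rewrite mulr_ge0 // ltW.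
have Z a c : 0 <= c -> (\int[mu]_(t in D) (c * e a t)%:E = c%:E * gamma_int k a)%E.
  move=> c0; rewrite -ge0_integralZl_EFin //.
  - by move=> t _; rewrite lee_fin e0.
  - by apply/measurable_EFinP; exact: measurable_powR_expR.
apply: (@le_trans _ _ (\int[mu]_(t in D)
   ((k `^ (th - 1) * e 1 t)%:E + (k `^ (th - 1) * k * e 2 t)%:E))%E).
  apply: ge0_le_integral => //.
  - by move=> t _; rewrite lee_fin powR_expR_ge0.
  - by apply/measurable_EFinP; exact: measurable_powR_expR.
  - by apply: emeasurable_funD; exact: me.
  - move=> t; rewrite /= in_itv /= andbT => t0.
    rewrite -EFinD lee_fin /e subrr powRr0 mul1r.
    have -> : 2 - 1 = 1 :> R by ring.
    rewrite powRr1 ?(ltW t0) //.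
    have -> : k `^ (th - 1) * expR (- (k * t)) +
        k `^ (th - 1) * k * (t * expR (- (k * t))) =
      k `^ (th - 1) * (1 + k * t) * expR (- (k * t)) by ring.
    rewrite ler_wpM2r ?expR_ge0 //.
    have kt : 0 < k * t by rewrite mulr_gt0.
    have -> : t `^ (1 - th) = k `^ (th - 1) * (k * t) `^ (1 - th).
      rewrite powRM ?(ltW k0) ?(ltW t0) // mulrA -powRD ?(gt_eqF k0) ?implybT //.
      by rewrite addrA subrK subrr powRr0 mul1r.
    rewrite ler_wpM2l //.
    have [kt1|kt1] := leP (k * t) 1.
      apply: (@le_trans _ _ 1); last by rewrite lerDl ltW.
      have : (k * t) `^ (1 - th) <= 1 `^ (1 - th).
        by rewrite ge0_ler_powR ?nnegrE // ltW.
      by rewrite powR1.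
    apply: (@le_trans _ _ (k * t)); last by rewrite lerDr.
    by apply: ler1_powR; [exact: ltW|rewrite gerBl].
rewrite ge0_integralD //; last 4 first.
- by move=> t _; rewrite lee_fin mulr_ge0.
- exact: me.
- by move=> t _; rewrite lee_fin mulr_ge0.
- exact: me.
rewrite !Z // gamma_int1 // g2 -!EFinM -EFinD lee_fin.
by rewrite le_eqVlt; apply/orP; left; apply/eqP; field; rewrite gt_eqF.
Qed.

Lemma Gamma_nat n : Gamma n.+1%:R = n`!%:R :> R.
Proof.
have := @gamma_int_natD 1 1 n ltr01 ltr01; rewrite gamma_int1 // expr1n mul1e nat1r => E.
rewrite /Gamma /Rintegral (_ : integral _ _ _ = gamma_int 1 n.+1%:R).
  rewrite E -EFinM /= invr1 mulr1 (_ : powcoef (- 1) n = 1) ?mulr1 //.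
  by rewrite /powcoef big1 // => i _; rewrite opprK natr1 divff ?pnatr_eq0.
by apply: eq_integral => t _; rewrite mul1r.
Qed.

End GammaIntegral.

(** * Abel summation and divergent alternating series *)

Section Sequences.
Context {R : realType}.
Implicit Types (u : nat -> R) (c rho : R).

Lemma abel_summation u rho n :
  \sum_(i < n) rho ^+ i * u i =
  rho ^+ n * (\sum_(i < n) u i) +
  (1 - rho) * \sum_(i < n) rho ^+ i * \sum_(j < i.+1) u j.
Proof.
elim: n => [|n IH]; first by rewrite !big_ord0 !mulr0 addr0.
rewrite [LHS]big_ord_recr /= IH [X in _ = _ + _ * X]big_ord_recr /=.
rewrite [X in _ = X + _]mulrC (big_ord_recr n u) /= exprS; ring.
Qed.

Lemma geometric_sum rho n : (1 - rho) * \sum_(i < n) rho ^+ i = 1 - rho ^+ n.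
Proof.
elim: n => [|n IH]; first by rewrite big_ord0 mulr0 expr0 subrr.
by rewrite big_ord_recr /= mulrDr IH exprS; ring.
Qed.

Section Abel.
Variable rho_ : nat -> R.
Hypotheses (rho01 : forall l, 0 < rho_ l < 1) (rho1 : rho_ l @[l --> \oo] --> (1 : R)).

(** Writing s_i for the partial sums, the Abel sum is the average of the s_i
    with weights (1 - rho) rho^i; the finitely many s_i below c lose their
    weight as rho tends to 1. *)
Lemma abel_ge u c J (A : nat -> R) (B : R) : A l @[l --> \oo] --> B ->
  (forall l, (\sum_(i < n) rho_ l ^+ i * u i) @[n --> \oo] --> A l) ->
  (forall n, (J <= n)%N -> c <= \sum_(i < n) u i) -> c <= B.
Proof.
move=> AB uA SJ.
pose S n := \sum_(i < n) u i.
pose M := \sum_(i < J) `|S i - c|.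
have M0 : 0 <= M by apply: sumr_ge0.
have SM i : c - M <= S i.
  have [Ji|iJ] := leqP J i.
    by apply: (le_trans _ (SJ i Ji)); rewrite gerBl.
  rewrite lerBlDr -lerBlDl; apply: (@le_trans _ _ `|S i - c|).
    by rewrite -opprB -normrN ler_norm.
  rewrite /M (bigD1 (Ordinal iJ)) //= lerDl.
  by apply: sumr_ge0.
have key l n : (J <= n)%N ->
    c - (1 - rho_ l) * (J%:R * M) <= \sum_(i < n) rho_ l ^+ i * u i.
  move=> Jn; have /andP[r0 r1] := rho01 l.
  rewrite abel_summation -/(S n).
  have rn i : 0 <= rho_ l ^+ i by rewrite exprn_ge0 // ltW.
  have rn1 i : rho_ l ^+ i <= 1 by rewrite exprn_ile1 // ltW.
  have -> : c - (1 - rho_ l) * (J%:R * M) = rho_ l ^+ n * c +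
      (1 - rho_ l) * (\sum_(i < n) rho_ l ^+ i * c - J%:R * M).
    have := geometric_sum (rho_ l) n; rewrite -mulr_suml.
    set s := \sum_(_ < _) _ => G.
    transitivity (rho_ l ^+ n * c + (1 - rho_ l) * s * c - (1 - rho_ l) * (J%:R * M)).
      by rewrite G; ring.
    ring.
  apply: lerD; first by rewrite ler_wpM2l ?SJ.
  rewrite ler_wpM2l ?subr_ge0 ?(ltW r1) //.
  have -> : J%:R * M = \sum_(i < n) (if (i < J)%N then M else 0).
    rewrite -big_mkcond /= -(big_ord_widen n (fun=> M)) //.
    by rewrite sumr_const card_ord mulr_natl.
  rewrite -sumrB; apply: ler_sum => i _.
  case: ltnP => iJ.
    apply: (@le_trans _ _ (rho_ l ^+ i * (c - M))).
      by rewrite mulrBr lerB // ler_piMl.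
    by rewrite ler_wpM2l // -/(S i.+1) SM.
  by rewrite subr0 ler_wpM2l // SJ // ltnW.
have lowA l : c - (1 - rho_ l) * (J%:R * M) <= A l.
  have cA := uA l; rewrite -(cvg_lim (@Rhausdorff R) cA).
  apply: limr_ge; first by apply/cvg_ex; exists (A l).
  by exists J => // n /= Jn; exact: key.
have lim1 : (c - (1 - rho_ l) * (J%:R * M)) @[l --> \oo] --> c.
  rewrite -[X in _ --> X]subr0; apply: cvgB; first exact: cvg_cst.
  rewrite -[X in _ --> X](mul0r (J%:R * M)); apply: cvgM; last exact: cvg_cst.
  by rewrite -[X in _ --> X](subrr 1); apply: cvgB; first exact: cvg_cst.
by apply: (ler_cvg_to lim1 AB); apply: nearW => l; exact: lowA.
Qed.

(** Abel summation is totally regular: a series with an Abel sum cannot have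
    another limit, finite or infinite. *)
Lemma abel_regular u (A : nat -> R) (B : R) (L : \bar R) :
  A l @[l --> \oo] --> B ->
  (forall l, (\sum_(i < n) rho_ l ^+ i * u i) @[n --> \oo] --> A l) ->
  (\sum_(i < n) u i)%:E @[n --> \oo] --> L -> L = B%:E.
Proof.
move=> AB uA SL; apply/eqP; rewrite eq_le; apply/andP; split.
  rewrite leNgt; apply/negP => BL.
  have [c Bc cL] : exists2 c, B < c & (c%:E < L)%E.
    move: L BL {SL} => [r| |]; rewrite ?lte_fin //.
    - by move=> Br; exists ((B + r) / 2); rewrite ?lte_fin; lra.
    - by move=> _; exists (B + 1); rewrite ?ltry //; lra.
  have [J _ HJ] := SL _ (open_ereal_gt' cL).
  have : c <= B.
    apply: (abel_ge AB uA (J := J)) => n Jn; apply: ltW.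
    by have := HJ n Jn; rewrite /= lte_fin.
  by rewrite leNgt Bc.
rewrite leNgt; apply/negP => LB.
have [c Bc cL] : exists2 c, c < B & (L < c%:E)%E.
  move: L LB {SL} => [r| |]; rewrite ?lte_fin //.
  - by move=> Br; exists ((B + r) / 2); rewrite ?lte_fin; lra.
  - by move=> _; exists (B - 1); rewrite ?ltNyr //; lra.
have [J _ HJ] := SL _ (open_ereal_lt' cL).
have : - c <= - B.
  apply: (@abel_ge (fun i => - u i) (- c) J (fun l => - A l) (- B)).
  - exact: cvgN.
  - move=> l; under eq_fun do (under eq_bigr do rewrite mulrN).
    under eq_fun do rewrite sumrN.
    by apply: cvgN; exact: uA.
  - move=> n Jn; rewrite sumrN lerN2; apply: ltW.
    by have := HJ n Jn; rewrite /= lte_fin.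
by rewrite lerN2 leNgt Bc.
Qed.
End Abel.

(** Between two negative terms the partial sums drop by a fixed amount at
    least, as the positive term in between is smaller than the next one. *)
Lemma alternating_unbounded u J k c : 1 < k ->
  (forall j, (J <= j)%N -> u j * u j.+1 < 0 /\ k * `|u j| <= `|u j.+1|) ->
  ~ (forall n, (J <= n)%N -> c <= \sum_(i < n) u i).
Proof.
move=> k1 H Sc.
(* j0 is the index of a negative term; the argument follows the partial sums
   that end at j0, j0 + 2, j0 + 4, ... *)
have nz j : (J <= j)%N -> u j != 0.
  by move=> /H[+ _]; apply: contraTneq => ->; rewrite mul0r ltxx.
have [j0 Jj0 u0] : exists2 j0, (J <= j0)%N & u j0 < 0.
  have [uJ|uJ|uJ] := ltgtP (u J) 0; first by exists J.
    by exists J.+1 => //; have [+ _] := H J (leqnn J); rewrite pmulr_rlt0.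
  by have := nz J (leqnn J); rewrite uJ eqxx.
pose d := (1 - k^-1) * `|u j0|.
have k0 : 0 < k by lra.
have d0 : 0 < d by rewrite mulr_gt0 ?normr_gt0 ?nz // subr_gt0 invf_lt1.
pose S n := \sum_(i < n) u i.
have claim i : [/\ u (j0 + i.*2)%N < 0, `|u j0| <= `|u (j0 + i.*2)%N| &
    S (j0 + i.*2).+1 <= S j0.+1 - i%:R * d].
  elim: i => [|i [IH1 IH2 IH3]]; first by rewrite addn0 mul0r subr0.
  rewrite doubleS !addnS; set j := (j0 + i.*2)%N in IH1 IH2 IH3 *.
  have Jj : (J <= j)%N by rewrite (leq_trans Jj0) // leq_addr.
  have [s1 g1] := H j Jj; have [s2 g2] := H j.+1 (leqW Jj).
  have p1 : 0 < u j.+1 by move: s1; rewrite nmulr_rlt0.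
  have n2 : u j.+2 < 0 by move: s2; rewrite pmulr_rlt0.
  have m1 : `|u j| <= `|u j.+1| by apply: le_trans g1; rewrite ler_peMl // ltW.
  have m2 : `|u j.+1| <= `|u j.+2| by apply: le_trans g2; rewrite ler_peMl // ltW.
  have m3 : `|u j0| <= `|u j.+2| by rewrite (le_trans IH2) // (le_trans m1).
  split => //.
  have -> : S j.+3 = S j.+1 + (u j.+1 + u j.+2) by rewrite /S !big_ord_recr /= addrA.
  have -> : S j0.+1 - i.+1%:R * d = (S j0.+1 - i%:R * d) + - d.
    by rewrite -natr1; ring.
  apply: lerD => //.
  have g3 : `|u j.+1| <= k^-1 * `|u j.+2| by rewrite mulrC ler_pdivlMr // mulrC.
  have dl : d <= (1 - k^-1) * `|u j.+2|.
    by rewrite ler_wpM2l // subr_ge0 ltW // invf_lt1.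
  have aux (x y v w : R) : v <= x * - w -> y <= (1 - x) * - w -> v + w <= - y.
    by lra.
  by apply: (aux k^-1); [move: g3|move: dl]; rewrite ?(gtr0_norm p1) (ltr0_norm n2).
have [i Hi] : exists i : nat, S j0.+1 - c < i%:R * d.
  exists (Num.truncn ((S j0.+1 - c) / d)).+1; rewrite -ltr_pdivrMr //.
  exact: truncnS_gt.
have [_ _ h] := claim i.
have := Sc (j0 + i.*2).+1 (leqW (leq_trans Jj0 (leq_addr _ _))).
by move: h Hi; rewrite /S; lra.
Qed.

Lemma alternating_growth_dvg u J k (L : \bar R) : 1 < k ->
  (forall j, (J <= j)%N -> u j * u j.+1 < 0 /\ k * `|u j| <= `|u j.+1|) ->
  ~ ((\sum_(i < n) u i)%:E @[n --> \oo] --> L).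
Proof.
move=> k1 H SL.
have HS J' (v : nat -> R) : (J <= J')%N -> (forall j, `|v j| = `|u j|) ->
    (forall j, v j * v j.+1 = u j * u j.+1) ->
  forall j, (J' <= j)%N -> v j * v j.+1 < 0 /\ k * `|v j| <= `|v j.+1|.
  by move=> JJ' v1 v2 j J'j; rewrite !v1 v2; apply: H; exact: leq_trans J'j.
have [LNy|LNy] := eqVneq L -oo%E.
  have L0 : (L < 0%:E)%E by rewrite LNy ltNyr.
  have [J' _ HJ'] := SL _ (open_ereal_lt' L0).
  have HJ : forall j, (maxn J J' <= j)%N ->
      - u j * - u j.+1 < 0 /\ k * `|- u j| <= `|- u j.+1|.
    apply: (@HS _ (fun i => - u i)); first exact: leq_maxl.
      by move=> j; rewrite normrN.
    by move=> j; rewrite mulrNN.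
  apply: (@alternating_unbounded (fun i => - u i) _ _ 0 k1 HJ) => n.
  rewrite geq_max => /andP[_ /HJ' /=]; rewrite lte_fin => S0.
  by rewrite sumrN oppr_ge0 ltW.
have [c cL] : exists c : R, (c%:E < L)%E.
  move: L LNy {SL} => [r| |] // _; last by exists 0; rewrite ltry.
  by exists (r - 1); rewrite lte_fin; lra.
have [J' _ HJ'] := SL _ (open_ereal_gt' cL).
have HJ := @HS (maxn J J') u (leq_maxl _ _) (fun=> erefl) (fun=> erefl).
apply: (@alternating_unbounded u _ _ c k1 HJ).
move=> n; rewrite geq_max => /andP[_ /HJ' /=]; rewrite lte_fin => S0.
exact: ltW.
Qed.

(** By induction on m: the difference Q(j + 1) - Q(j) is a sum of the same kind
    with leading coefficient d(m) and one term less, hence is eventually at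
    least some e > 0. *)
Lemma binomial_sum_eventually m (d : nat -> R) : 0 < d m ->
  exists2 e : R, 0 < e & exists J, forall j, (J <= j)%N ->
    let Q j := \sum_(k < m.+1) 'C(j, k)%:R * d k in
    e <= Q j /\ Q j <= Q j.+1.
Proof.
elim: m d => [|m IH] d dm.
  exists (d 0) => //; exists 0%N => j _ /=.
  by rewrite !big_ord1 !bin0 mul1r.
have [e e0 [J HJ]] := IH (fun k => d k.+1) dm.
pose Q j := \sum_(k < m.+2) 'C(j, k)%:R * d k.
have dQ j : Q j.+1 = Q j + \sum_(k < m.+1) 'C(j, k)%:R * d k.+1.
  rewrite /Q big_ord_recl bin0 [in RHS]big_ord_recl bin0 -addrA; congr (_ + _).
  rewrite -big_split /=; apply: eq_bigr => k _.
  by rewrite /bump /= add1n binS natrD mulrDl.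
have QJ i : Q J + i%:R * e <= Q (J + i)%N.
  elim: i => [|i IHi]; first by rewrite mul0r addr0 addn0.
  rewrite addnS dQ -natr1 mulrDl mul1r addrA lerD //.
  by have [] := HJ (J + i)%N (leq_addr _ _).
have [i Hi] : exists i : nat, e - Q J <= i%:R * e.
  exists (Num.truncn ((e - Q J) / e)).+1; rewrite -ler_pdivrMr //.
  exact: ltW (truncnS_gt _).
exists e => //; exists (J + i)%N => j Jij /=.
have Jj : (J <= j)%N := leq_trans (leq_addr _ _) Jij.
split.
  rewrite -/(Q j) -(subnKC Jj) (le_trans _ (QJ _)) // -lerBlDl (le_trans Hi) //.
  by rewrite ler_wpM2r ?(ltW e0) // ler_nat leq_subRL.
rewrite -/(Q j) -/(Q j.+1) dQ lerDl.
by have [H _] := HJ j Jj; rewrite (le_trans _ H) // ltW.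
Qed.

End Sequences.

(** * Abel means of the Wright series *)

Section ExpPartialSums.
Context {R : realType}.
Implicit Types x y z : R.

Lemma cvg_exp_sum x : \sum_(i < n) x ^+ i / i`!%:R @[n --> \oo] --> expR x.
Proof.
have : series (exp_coeff x) @ \oo --> expR x := is_cvg_series_exp_coeff x.
rewrite (_ : series _ = fun n => \sum_(i < n) x ^+ i / i`!%:R) //.
by apply/funext => n; rewrite /series /= big_mkord.
Qed.

Lemma norm_exp_sum x n : `|\sum_(i < n) x ^+ i / i`!%:R| <= expR `|x|.
Proof.
apply: (@le_trans _ _ (\sum_(i < n) `|x| ^+ i / i`!%:R)).
  apply: (le_trans (ler_norm_sum _ _ _)); apply: ler_sum => i _.
  by rewrite normrM normrX normfV normr_nat.
rewrite -(cvg_lim (@Rhausdorff R) (@cvg_exp_sum `|x|)).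
apply: limr_ge; first by apply/cvg_ex; exists (expR `|x|); exact: cvg_exp_sum.
exists n => // p /= np.
rewrite (big_ord_widen _ (fun i => `|x| ^+ i / i`!%:R) np) big_mkcond /=.
apply: ler_sum => i _; by case: ifP => // _; rewrite divr_ge0 ?exprn_ge0.
Qed.

(** Since 'C(i, k) / i! = 1 / (k! (i - k)!), the generating function of the
    binomials splits off y^k / k! from a truncated exponential; the truncated
    subtraction n - k makes both sides vanish for n <= k. *)
Lemma sum_bin_exp k z y n :
  \sum_(i < n) 'C(i, k)%:R * z ^+ (i - k) * (y ^+ i / i`!%:R) =
  y ^+ k / k`!%:R * \sum_(i < n - k) (z * y) ^+ i / i`!%:R.
Proof.
elim: n => [|n IH]; first by rewrite sub0n !big_ord0 mulr0.
rewrite big_ord_recr /= IH; have [kn|nk] := leqP k n; last first.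
  rewrite bin_small // !mul0r addr0.
  have -> : (n - k = 0)%N by apply/eqP; rewrite subn_eq0 ltnW.
  by have -> : (n.+1 - k = 0)%N by apply/eqP; rewrite subn_eq0.
rewrite subSn // big_ord_recr /= mulrDr; congr (_ + _).
rewrite exprMn; have f0 p : p`!%:R != 0 :> R by rewrite pnatr_eq0 -lt0n fact_gt0.
have -> : y ^+ n = y ^+ k * y ^+ (n - k) by rewrite -exprD subnKC.
have := bin_fact kn => /(congr1 (fun p => p%:R : R)); rewrite !natrM => <-.
by field; rewrite !f0 pnatr_eq0 -lt0n bin_gt0 kn.
Qed.

End ExpPartialSums.

Section PolyExp.
Context {R : realType}.
Implicit Types (c t : R) (e : nat -> R).
Notation mu := (@lebesgue_measure R).
Notation D := (`]0, +oo[%classic : set R).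

Lemma gamma_int_lty c s : 0 < c -> 0 < s -> (gamma_int c s < +oo)%E.
Proof.
move=> c0 s0; have [n Hn] : exists n : nat, s <= n%:R.
  by exists (Num.truncn s).+1; exact: ltW (truncnS_gt _).
elim: n s s0 Hn => [|n IH] s s0 sn; first by move: s0; rewrite ltNge sn.
have [s1|s1] := leP s 1.
  have h : 0 <= 1 - s < 1 by apply/andP; split; lra.
  have := gamma_int_ub c0 h; rewrite subKr => H.
  exact: le_lt_trans H (ltry _).
have s10 : 0 < s - 1 by lra.
have E := gamma_intS c0 s10; rewrite subrK in E.
have -> : (gamma_int c s = (c^-1 * (s - 1))%:E * gamma_int c (s - 1))%E.
  by rewrite EFinM -muleA -E muleA -EFinM mulVf ?gt_eqF // mul1e.
rewrite lte_mul_pinfty ?lee_fin ?mulr_ge0 ?invr_ge0 ?(ltW c0) ?(ltW s10) //.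
by apply: IH => //; move: sn; rewrite -natr1; lra.
Qed.

Lemma integrable_powR_expR c s : 0 < c -> 0 < s ->
  mu.-integrable D (EFin \o (fun t => t `^ (s - 1) * expR (- (c * t)))).
Proof.
move=> c0 s0; apply/integrableP; split.
  by apply/measurable_EFinP; exact: measurable_powR_expR.
apply: le_lt_trans (gamma_int_lty c0 s0); rewrite /gamma_int le_eqVlt; apply/orP; left.
apply/eqP; apply: eq_integral => t _ /=.
by rewrite ger0_norm ?powR_expR_ge0.
Qed.

Lemma integrable_exprn_expR c n : 0 < c ->
  mu.-integrable D (EFin \o (fun t => t ^+ n * expR (- (c * t)))).
Proof.
move=> c0; have := integrable_powR_expR c0 (ltr0Sn R n).
apply: eq_integrable => [|t]; first exact: measurable_itv.
rewrite inE /= in_itv /= andbT => t0.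
by rewrite -natr1 addrK powR_mulrn // ltW.
Qed.

Lemma integrable_polyexp c m e : 0 < c ->
  mu.-integrable D (EFin \o (fun t => (\sum_(k < m) e k * t ^+ k) * expR (- (c * t)))).
Proof.
move=> c0; have := @integrable_sumr _ _ _ mu D (measurable_itv _) m (fun k => e k)
  (fun k t => t ^+ k * expR (- (c * t))) (fun k => integrable_exprn_expR _ c0).
apply: eq_integrable => [|t _]; first exact: measurable_itv.
by congr EFin; rewrite /= mulr_suml; apply: eq_bigr => k _; rewrite mulrA.
Qed.

End PolyExp.

Lemma cvg_exprn {R : realType} {T : Type} (G : set_system T) (u : T -> R) (l : R) k :
  Filter G -> u x @[x --> G] --> l -> u x ^+ k @[x --> G] --> l ^+ k.
Proof.
move=> FG ul; elim: k => [|k IH]; first exact: cvg_cst.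
under eq_fun do rewrite exprS.
by rewrite exprS; exact: cvgM.
Qed.

Section AbelMeans.
Context {R : realType}.
Implicit Types (t y rho : R).
Notation mu := (@lebesgue_measure R).
Notation D := (`]0, +oo[%classic : set R).

Variables (lam q : R) (m : nat) (b : nat -> R).
Hypotheses (lam0 : 0 < lam) (q0 : 0 < q) (b0 : forall k, 0 <= b k).

(** For lam = 1/h, the density in t that defines the discrete Gaussian of index
    i + 1 from the heat kernel. *)
Definition moment_density i t := lam * ((lam * t) ^+ i / i`!%:R) * expR (- (lam * t)).
Definition moment (F : R -> R) i := \int[mu]_(t in D) (moment_density i t * F t).
(** The Wright number phi(m, i), for q = h^(1 - alpha) and b k = [wright_coef].
    For k > i the truncated exponent i - k is harmless as 'C(i, k) = 0. *)
Definition wright_value i := q * \sum_(k < m.+1) 'C(i, k)%:R * ((1 - q) ^+ (i - k) * q ^+ k * b k).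
Definition wright_poly y := \sum_(k < m.+1) b k * ((q * y) ^+ k / k`!%:R).
(** The sum over i of rho^i times the i-th Wright number times the i-th moment
    density. At rho = 1 it is the subordination density, and its exponential
    then decays like e^(- q lam t), whatever the sign of 1 - q. *)
Definition abel_density rho t :=
  q * lam * wright_poly (rho * lam * t) * expR (- ((1 - (1 - q) * rho) * lam * t)).
Definition abel_mean (F : R -> R) rho := \int[mu]_(t in D) (abel_density rho t * F t).

Lemma wright_poly_ge0 y : 0 <= y -> 0 <= wright_poly y.
Proof.
move=> y0; apply: sumr_ge0 => k _; rewrite mulr_ge0 // divr_ge0 //.
by rewrite exprn_ge0 // mulr_ge0 // ltW.
Qed.

Lemma le_wright_poly x y : 0 <= x <= y -> wright_poly x <= wright_poly y.
Proof.
move=> /andP[x0 xy]; have y0 := le_trans x0 xy.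
apply: ler_sum => k _; rewrite ler_wpM2l // ler_wpM2r ?invr_ge0 //.
by rewrite lerXn2r ?nnegrE ?mulr_ge0 ?(ltW q0) // ler_wpM2l // ltW.
Qed.

Lemma wright_value_sum n y : \sum_(i < n) wright_value i * (y ^+ i / i`!%:R) =
  q * \sum_(k < m.+1) b k * ((q * y) ^+ k / k`!%:R) *
    \sum_(i < n - k) ((1 - q) * y) ^+ i / i`!%:R.
Proof.
rewrite /wright_value; under eq_bigr => i _ do rewrite -mulrA mulr_suml.
rewrite -mulr_sumr exchange_big /=; congr (_ * _); apply: eq_bigr => k _.
rewrite exprMn; transitivity (b k * q ^+ k *
    (y ^+ k / k`!%:R * \sum_(i < n - k) ((1 - q) * y) ^+ i / i`!%:R)); last by ring.
rewrite -sum_bin_exp mulr_sumr; apply: eq_bigr => i _; ring.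
Qed.

Lemma cvg_wright_value_sum y : \sum_(i < n) wright_value i * (y ^+ i / i`!%:R) @[n --> \oo] -->
  q * wright_poly y * expR ((1 - q) * y).
Proof.
under eq_fun do rewrite wright_value_sum.
rewrite -mulrA /wright_poly mulr_suml; apply: cvgM; first exact: cvg_cst.
apply: cvg_big => [|k _]; first exact: add_continuous.
apply: cvgM; first exact: cvg_cst.
rewrite -(cvg_shiftn k).
by under eq_fun do rewrite addnK; exact: cvg_exp_sum.
Qed.

Lemma norm_wright_value_sum n y : 0 <= y -> `|1 - q| <= 1 ->
  `|\sum_(i < n) wright_value i * (y ^+ i / i`!%:R)| <= q * wright_poly y * expR y.
Proof.
move=> y0 q1; rewrite wright_value_sum normrM (gtr0_norm q0) -mulrA ler_wpM2l ?(ltW q0) //.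
rewrite /wright_poly mulr_suml (le_trans (ler_norm_sum _ _ _)) //.
apply: ler_sum => k _; rewrite normrM ger0_norm; last first.
  by rewrite mulr_ge0 // divr_ge0 // exprn_ge0 // mulr_ge0 // ltW.
rewrite ler_wpM2l //.
  by rewrite mulr_ge0 // divr_ge0 // exprn_ge0 // mulr_ge0 // ltW.
rewrite (le_trans (norm_exp_sum _ _)) // ler_expR normrM (ger0_norm y0).
by rewrite ler_piMl.
Qed.

Lemma wright_polyE rho t :
  wright_poly (rho * lam * t) = \sum_(k < m.+1) (b k * ((q * (rho * lam)) ^+ k / k`!%:R)) * t ^+ k.
Proof.
by apply: eq_bigr => k _; rewrite !mulrA !exprMn; ring.
Qed.

Lemma integrable_wright_poly rho c : 0 < c ->
  mu.-integrable D (EFin \o (fun t => wright_poly (rho * lam * t) * expR (- (c * t)))).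
Proof.
move=> c0; have := integrable_polyexp m.+1
  (fun k => b k * ((q * (rho * lam)) ^+ k / k`!%:R)) c0.
apply: eq_integrable => [|t _]; first exact: measurable_itv.
by rewrite /= wright_polyE.
Qed.

Lemma measurable_wright_poly rho c :
  measurable_fun D (fun t => wright_poly (rho * lam * t) * expR (- (c * t))).
Proof.
apply: measurable_funTS; apply: continuous_measurable_fun => t.
apply: cvgM; last first.
  apply: continuous_cvg; first exact: continuous_expR.
  by apply: cvgN; apply: cvgM; [exact: cvg_cst|exact: cvg_id].
apply: cvg_big => [|k _]; first exact: add_continuous.
apply: cvgM; first exact: cvg_cst.
apply: cvgM; last exact: cvg_cst.
apply: cvg_exprn.
apply: cvgM; first exact: cvg_cst.
by apply: cvgM; [exact: cvg_cst|exact: cvg_id].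
Qed.

Section Bounded.
Variables (F : R -> R) (K : R).
Hypotheses (mF : measurable_fun D F) (F0 : forall t, 0 < t -> 0 <= F t)
  (FK : forall t, 0 < t -> F t <= K).

Let K0 : 0 <= K. Proof. exact: le_trans (F0 ltr01) (FK ltr01). Qed.

Let mD : @measurable _ (measurableTypeR R) D. Proof. exact: measurable_itv. Qed.

Lemma measurable_moment_density i : measurable_fun D (moment_density i).
Proof.
apply: measurable_halfline => t t0; apply: cvgM; last first.
  apply: continuous_cvg; first exact: continuous_expR.
  by apply: cvgN; apply: cvgM; [exact: cvg_cst|exact: cvg_id].
apply: cvgM; first exact: cvg_cst.
apply: cvgM; last exact: cvg_cst.
apply: cvg_exprn.
by apply: cvgM; [exact: cvg_cst|exact: cvg_id].
Qed.

Lemma measurable_abel_density rho : measurable_fun D (abel_density rho).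
Proof.
rewrite (_ : abel_density rho = fun t =>
    q * lam * (wright_poly (rho * lam * t) * expR (- ((1 - (1 - q) * rho) * lam * t)))).
  by apply: measurable_funM => //; exact: measurable_wright_poly.
by apply/funext => t; rewrite mulrA.
Qed.

Lemma integrable_moment i :
  mu.-integrable D (EFin \o (fun t => moment_density i t * F t)).
Proof.
apply: (@le_integrable_Rfun _ _ _ mu D mD _
   (fun t => K * (lam * lam ^+ i / i`!%:R) * (t ^+ i * expR (- (lam * t))))).
- by apply: measurable_funM => //; exact: measurable_moment_density.
- move=> t; rewrite /= in_itv /= andbT => t0.
  rewrite normrM (ger0_norm (F0 t0)) ger0_norm; last first.
    rewrite mulr_ge0 ?expR_ge0 // mulr_ge0 ?(ltW lam0) // divr_ge0 //.
    by rewrite exprn_ge0 // mulr_ge0 // ltW.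
  rewrite mulrC (_ : K * _ * _ = K * moment_density i t).
    rewrite ler_wpM2r ?FK //.
    rewrite mulr_ge0 ?expR_ge0 // mulr_ge0 ?(ltW lam0) // divr_ge0 //.
    by rewrite exprn_ge0 // mulr_ge0 // ltW.
  by rewrite /moment_density exprMn; ring.
- have := integrableZl mD (K * (lam * lam ^+ i / i`!%:R)) (integrable_exprn_expR i lam0).
  by apply: eq_integrable => // t _; rewrite /= EFinM.
Qed.

(** Dominated convergence, where |1 - q| <= 1 makes e^(- lam t) win over the
    bound e^(rho lam t) of the partial sums. *)
Lemma abel_mean_cvg rho : 0 < rho < 1 -> `|1 - q| <= 1 ->
  \sum_(i < n) rho ^+ i * (wright_value i * moment F i) @[n --> \oo] --> abel_mean F rho.
Proof.
move=> /andP[r0 r1] q1.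
pose f n t := \sum_(i < n) (rho ^+ i * wright_value i) * (moment_density i t * F t).
have fE n t : f n t = lam * expR (- (lam * t)) * F t *
    \sum_(i < n) wright_value i * ((rho * lam * t) ^+ i / i`!%:R).
  rewrite mulr_sumr; apply: eq_bigr => i _; rewrite /moment_density.
  by rewrite -(mulrA rho) (exprMn _ rho); ring.
have -> : (fun n => \sum_(i < n) rho ^+ i * (wright_value i * moment F i)) =
   (fun n => \int[mu]_(t in D) f n t).
  apply/funext => n; rewrite Rintegral_sumr //; last by move=> l; exact: integrable_moment.
  by apply: eq_bigr => i _; rewrite mulrA.
pose g t := K * (q * lam) * (wright_poly (rho * lam * t) * expR (- ((1 - rho) * lam * t))).
apply: (Rdominated_cvg mD (g := g)).
- move=> n; apply: measurable_sum => i; apply: measurable_funM => //.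
  by apply: measurable_funM => //; exact: measurable_moment_density.
- by apply: measurable_funM => //; exact: measurable_abel_density.
- move=> t _; under eq_fun do rewrite fE.
  rewrite (_ : abel_density _ _ * _ = lam * expR (- (lam * t)) * F t *
     (q * wright_poly (rho * lam * t) * expR ((1 - q) * (rho * lam * t)))).
    by apply: cvgM; [exact: cvg_cst|exact: cvg_wright_value_sum].
  rewrite /abel_density.
  have -> : - ((1 - (1 - q) * rho) * lam * t) =
    - (lam * t) + (1 - q) * (rho * lam * t) by ring.
  by rewrite expRD; ring.
- have c0 : 0 < (1 - rho) * lam by rewrite mulr_gt0 // subr_gt0.
  have := integrableZl mD (K * (q * lam)) (integrable_wright_poly rho c0).
  by apply: eq_integrable => // t _; rewrite /= EFinM.
- move=> n t; rewrite /= in_itv /= andbT => t0.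
  have y0 : 0 <= rho * lam * t by rewrite !mulr_ge0 // ltW.
  rewrite fE normrM ger0_norm; last by rewrite !mulr_ge0 ?expR_ge0 ?F0 // ltW.
  apply: (@le_trans _ _ (lam * expR (- (lam * t)) * K *
     (q * wright_poly (rho * lam * t) * expR (rho * lam * t)))).
    apply: ler_pM => //; last exact: norm_wright_value_sum.
      by rewrite !mulr_ge0 ?expR_ge0 ?F0 // ltW.
    by rewrite ler_wpM2l ?FK // mulr_ge0 ?expR_ge0 // ltW.
  rewrite /g.
  have -> : - ((1 - rho) * lam * t) = - (lam * t) + rho * lam * t by ring.
  by rewrite expRD le_eqVlt; apply/orP; left; apply/eqP; ring.
Qed.

(** Dominated convergence again: 1 - (1 - q) rho is at least the minimum of 1
    and q. *)
Lemma abel_mean_lim (r : nat -> R) : (forall l, 0 < r l < 1) ->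
  r l @[l --> \oo] --> (1 : R) ->
  abel_mean F (r l) @[l --> \oo] --> abel_mean F 1.
Proof.
move=> r01 r1.
have [c c0 [c1 cq]] : exists2 c : R, 0 < c & c <= 1 /\ c <= q.
  by exists (Num.min 1 q); [rewrite lt_min ltr01|split; rewrite ge_min lexx ?orbT].
pose g t := K * (q * lam) * (wright_poly (1 * lam * t) * expR (- (c * lam * t))).
have md rho : measurable_fun D (fun t => abel_density rho t * F t).
  by apply: measurable_funM => //; exact: measurable_abel_density.
have cd t : abel_density (r l) t @[l --> \oo] --> abel_density 1 t.
  apply: cvgM.
    apply: cvgM; first exact: cvg_cst.
    apply: cvg_big => [|k _]; first exact: add_continuous.
    apply: cvgM; first exact: cvg_cst.
    apply: cvgM; last exact: cvg_cst.
    apply: cvg_exprn.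
    apply: cvgM; first exact: cvg_cst.
    apply: cvgM; last exact: cvg_cst.
    by apply: cvgM; last exact: cvg_cst.
  apply: continuous_cvg; first exact: continuous_expR.
  apply: cvgN; apply: cvgM; last exact: cvg_cst.
  apply: cvgM; last exact: cvg_cst.
  apply: cvgB; first exact: cvg_cst.
  by apply: cvgM; first exact: cvg_cst.
apply: (Rdominated_cvg mD (g := g)) => //.
- by move=> n; exact: md.
- exact: md.
- by move=> t _; exact: cvgM (cd t) (cvg_cst _).
- have cl0 : 0 < c * lam by rewrite mulr_gt0.
  have := integrableZl mD (K * (q * lam)) (integrable_wright_poly 1 cl0).
  by apply: eq_integrable => // t _; rewrite /= EFinM.
- move=> n t; rewrite /= in_itv /= andbT => t0.
  have /andP[h0 h1] := r01 n.
  have y0 : 0 <= r n * lam * t by rewrite !mulr_ge0 // ltW.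
  have w0 := wright_poly_ge0 y0.
  rewrite normrM (ger0_norm (F0 t0)) ger0_norm; last first.
    by rewrite !mulr_ge0 ?expR_ge0 // ltW.
  rewrite /g mulrC -mulrA ler_pM ?FK ?F0 //.
    by rewrite !mulr_ge0 ?expR_ge0 // ltW.
  rewrite /abel_density -mulrA ler_wpM2l //.
    by rewrite mulr_ge0 // ltW.
  apply: ler_pM; rewrite ?expR_ge0 //.
    apply: le_wright_poly; rewrite y0 /= ler_wpM2r ?(ltW t0) //.
    by rewrite ler_wpM2r ?(ltW lam0) // ltW.
  rewrite ler_expR lerN2 ler_wpM2r ?(ltW t0) // ler_wpM2r ?(ltW lam0) //.
  nra.
Qed.

End Bounded.
End AbelMeans.

(** * Ratios of consecutive Gaussian moments *)

Section MomentGrowth.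
Context {R : realType}.
Implicit Types (t y : R).
Notation mu := (@lebesgue_measure R).
Notation D := (`]0, +oo[%classic : set R).

Variables (lam be a C : R).
Hypotheses (lam0 : 0 < lam) (be0 : 0 <= be) (a0 : 0 < a) (C0 : 0 < C).

(** The heat kernel at a fixed point x <> 0 as a function of time, with
    be = N/2 and a = |x|^2 / 4. *)
Definition gauss_time t := C * t `^ (- be) * expR (- (a / t)).

Lemma gauss_time_gt0 t : 0 < t -> 0 < gauss_time t.
Proof. by move=> t0; rewrite !mulr_gt0 ?powR_gt0 ?expR_gt0. Qed.

Let phi t := expR (- (a / t)).

Let phi_incr s t : 0 < s -> s <= t -> phi s <= phi t.
Proof.
move=> s0 st; have t0 := lt_le_trans s0 st.
by rewrite ler_expR lerN2 ler_pM2l // lef_pV2.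
Qed.

Let measurable_phi : measurable_fun D phi.
Proof.
apply: measurable_halfline => t t0.
apply: continuous_cvg; first exact: continuous_expR.
apply: cvgN; apply: cvgM; first exact: cvg_cst.
by apply: cvgV; [rewrite gt_eqF|exact: cvg_id].
Qed.

Lemma measurable_gauss_time : measurable_fun D gauss_time.
Proof.
apply: measurable_funM => //; apply: measurable_funM => //.
apply: measurable_halfline => t t0.
have [d _] := is_derive_powR (- be) t0.
by apply/differentiable_continuous/derivable1_diffP.
Qed.

Let mD : @measurable _ (measurableTypeR R) D. Proof. exact: measurable_itv. Qed.

(** For t < 1 the factor e^(- a/t) absorbs any power of 1/t, which is why x = 0
    must be excluded. *)
Lemma gauss_time_bounded : exists K, forall t, 0 < t -> gauss_time t <= K.
Proof.
have [n Hn] : exists n : nat, be <= n%:R.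
  by exists (Num.truncn be).+1; exact: ltW (truncnS_gt _).
exists (C * (1 + n`!%:R / a ^+ n)) => t t0.
rewrite /gauss_time -mulrA ler_pM2l //.
have at0 : 0 < a / t by rewrite divr_gt0.
have [t1|t1] := leP 1 t.
  apply: (@le_trans _ _ 1); last by rewrite lerDl divr_ge0 // exprn_ge0 // ltW.
  rewrite -(mulr1 1) ler_pM ?powR_ge0 ?expR_ge0 //; last first.
    by rewrite -expR0 ler_expR oppr_le0 ltW.
  by rewrite powRN invf_le1 ?powR_gt0 // -(powRr0 t) ler_powR.
apply: (@le_trans _ _ (n`!%:R / a ^+ n)); last by rewrite lerDr.
have H : (a / t) ^+ n / n`!%:R <= expR (a / t).
  have : `|(a / t) ^+ n / n`!%:R| <= expR (a / t).
    rewrite ger0_norm ?divr_ge0 ?exprn_ge0 ?(ltW at0) //.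
    case: (n) => [|p]; first by rewrite expr0 fact0 divr1 -expR0 ler_expR ltW.
    by apply: le_trans (expR_ge1Dxn p (ltW at0)); rewrite lerDr.
  by apply: le_trans; exact: ler_norm.
rewrite expRN ler_pdivrMr ?expR_gt0 //.
apply: (@le_trans _ _ (n`!%:R / a ^+ n * ((a / t) ^+ n / n`!%:R))); last first.
  by rewrite ler_wpM2l // divr_ge0 // exprn_ge0 // ltW.
have -> : n`!%:R / a ^+ n * ((a / t) ^+ n / n`!%:R) = t ^- n.
  rewrite exprMn exprVn; field.
  by rewrite pnatr_eq0 -lt0n fact_gt0 !expf_neq0 ?gt_eqF.
rewrite powRN lef_pV2 ?posrE ?exprn_gt0 ?powR_gt0 //.
by rewrite -powR_mulrn ?(ltW t0) // ger_powR // t0 ltW.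
Qed.

Let gauss_time_ge0 t : 0 < t -> 0 <= gauss_time t.
Proof. by move/gauss_time_gt0/ltW. Qed.

Lemma integrable_moment_gauss i :
  mu.-integrable D (EFin \o (fun t => moment_density lam i t * gauss_time t)).
Proof.
have [K HK] := gauss_time_bounded.
exact: (integrable_moment lam0 measurable_gauss_time gauss_time_ge0 HK).
Qed.

Lemma moment_gauss_gt0 i : 0 < moment lam gauss_time i.
Proof.
have pos t : 0 < t -> 0 < moment_density lam i t * gauss_time t.
  move=> t0; rewrite mulr_gt0 ?gauss_time_gt0 // mulr_gt0 ?expR_gt0 //.
  by rewrite mulr_gt0 // divr_gt0 ?exprn_gt0 ?mulr_gt0 // ltr0n fact_gt0.
have ii := integrable_moment_gauss i.
rewrite lt_neqAle; apply/andP; split; last first.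
  apply: Rintegral_ge0 => t; rewrite /= in_itv /= andbT => t0.
  exact/ltW/pos.
apply/eqP => E.
have mf := measurable_int mu ii.
have Z : (\int[mu]_(t in D) `|(moment_density lam i t * gauss_time t)%:E| = 0)%E.
  transitivity (\int[mu]_(t in D) (moment_density lam i t * gauss_time t)%:E)%E.
    apply: eq_integral => t; rewrite inE /= in_itv /= andbT => t0.
    by rewrite ger0_norm // ltW // pos.
  rewrite -(fineK (integrable_fin_num mD ii)); congr EFin; exact: esym E.
have [+ _] := ae_eq_integral_abs mu mD mf.
move=> /(_ Z) [A [mA A0 HA]].
have : (mu (`]0%R, 1%R[%classic : set R) <= 0)%E.
  rewrite -A0; apply: le_measure; [rewrite inE; exact: measurable_itv|by rewrite inE|].
  move=> t; rewrite /= in_itv /= => /andP[t0 t1]; apply: HA => /= H.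
  have Dt : D t by rewrite /= in_itv /= t0.
  by move: (H Dt) => [] /eqP; rewrite gt_eqF // pos.
have -> : mu (`]0%R, 1%R[%classic : set R) = 1%:E.
  by rewrite [LHS](@lebesgue_measure_itv R `]0, 1[) /= lte_fin ltr01 -EFinD subr0.
by rewrite lee_fin ler10.
Qed.

(** Chebyshev's association inequality for t and exp(- a/t), which are both
    increasing, under the Gamma law of index i + 1 - be: the mean of the product
    is at least the product of the means. *)
Lemma moment_gauss_growth i : be < i.+1%:R ->
  (1 - be / i.+1%:R) * moment lam gauss_time i <= moment lam gauss_time i.+1.
Proof.
move=> bei; pose nu := i.+1%:R - be; have nu0 : 0 < nu by rewrite subr_gt0.
(* p is the Gamma density of index nu up to a constant, and p' t = t p t. *)
pose p t := t `^ (nu - 1) * expR (- (lam * t)).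
pose p' t := t `^ (nu + 1 - 1) * expR (- (lam * t)).
have ip : mu.-integrable D (EFin \o p) by exact: integrable_powR_expR.
have ip' : mu.-integrable D (EFin \o p') by apply: integrable_powR_expR => //; rewrite addr_gt0.
have phi01 t : 0 < t -> 0 <= phi t <= 1.
  by move=> t0; rewrite expR_ge0 /= -expR0 ler_expR oppr_le0 divr_ge0 // ltW.
have iphi (f : R -> R) : (forall t, 0 <= f t) -> mu.-integrable D (EFin \o f) ->
    mu.-integrable D (EFin \o (fun t => f t * phi t)).
  move=> f0 fi; apply: (le_integrable_Rfun mD _ _ fi).
    apply: measurable_funM => //.
    by have /measurable_EFinP := measurable_int mu fi.
  move=> t; rewrite /= in_itv /= andbT => /phi01/andP[h0 h1].
  by rewrite ger0_norm ?mulr_ge0 // ler_piMr.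
have p0 t : 0 <= p t by exact: powR_expR_ge0.
have p'0 t : 0 <= p' t by exact: powR_expR_ge0.
have p'E t : 0 < t -> p' t = t * p t.
  move=> t0; rewrite /p' /p addrK mulrA; congr (_ * _).
  by rewrite mulr_powRB1 // ltW.
have E : \int[mu]_(t in D) p' t = nu / lam * \int[mu]_(t in D) p t.
  have := gamma_intS lam0 nu0 => /(congr1 fine); rewrite /gamma_int.
  have f1 := integrable_fin_num mD ip; have f2 := integrable_fin_num mD ip'.
  rewrite !fineM // /= => H.
  apply: (@mulfI _ lam); first by rewrite gt_eqF.
  rewrite mulrA mulrCA divff ?gt_eqF // mulr1; exact: H.
(* s0 is the mean of the Gamma law. *)
pose s0 := nu / lam; have s00 : 0 < s0 by rewrite divr_gt0.
have key : s0 * \int[mu]_(t in D) (p t * phi t) <= \int[mu]_(t in D) (p' t * phi t).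
  rewrite -(lerD2r (phi s0 * \int[mu]_(t in D) p' t)) [in leRHS]E -/s0 [in leRHS]mulrA (mulrC (phi s0) s0).
  have Zi (c : R) (f : R -> R) : mu.-integrable D (EFin \o f) ->
      mu.-integrable D (EFin \o (fun t => c * f t)).
    by move=> /(integrableZl mD c); apply: eq_integrable => // t _; rewrite /= EFinM.
  have Di (f g : R -> R) : mu.-integrable D (EFin \o f) ->
      mu.-integrable D (EFin \o g) -> mu.-integrable D (EFin \o (fun t => f t + g t)).
    by move=> hf hg; have := integrableD mD hf hg; apply: eq_integrable => // t _; rewrite /= EFinD.
  have i1 := iphi p p0 ip; have i2 := iphi p' p'0 ip'.
  rewrite -(@RintegralZl _ _ _ mu D _ s0 mD i1).
  rewrite -(@RintegralZl _ _ _ mu D _ (phi s0) mD ip').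
  rewrite -(@RintegralZl _ _ _ mu D _ (s0 * phi s0) mD ip).
  rewrite -(@RintegralD _ _ _ mu D _ _ mD (Zi _ _ i1) (Zi _ _ ip')).
  rewrite -(@RintegralD _ _ _ mu D _ _ mD i2 (Zi _ _ ip)).
  apply: le_Rintegral => //.
  - by apply: Di; apply: Zi.
  - by apply: Di => //; exact: Zi.
  move=> t; rewrite /= in_itv /= andbT => t0.
  rewrite p'E //; have : 0 <= (t - s0) * (phi t - phi s0).
    have [st|ts] := leP s0 t.
      by rewrite mulr_ge0 // subr_ge0 // phi_incr.
    by rewrite mulr_le0 // subr_le0 ?(ltW ts) // phi_incr // ltW.
  move=> /(mulr_ge0 (p0 t)); lra.
have momE j f : (forall t, 0 < t -> f t = t ^+ j * t `^ (- be) * expR (- (lam * t))) ->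
   mu.-integrable D (EFin \o (fun t => f t * phi t)) ->
   moment lam gauss_time j = lam ^+ j.+1 / j`!%:R * C * \int[mu]_(t in D) (f t * phi t).
  move=> fE fi; rewrite /moment -RintegralZl //; apply: eq_Rintegral => t.
  rewrite inE /= in_itv /= andbT => t0.
  by rewrite fE // /moment_density /gauss_time exprMn exprS /phi; ring.
rewrite (momE i p) //; [|move=> t t0|exact: iphi]; last first.
  rewrite /p -powR_mulrn ?(ltW t0) // -powRD ?(gt_eqF t0) ?implybT //.
  by congr (_ `^ _ * _); rewrite /nu -natr1; ring.
rewrite (momE i.+1 p') //; [|move=> t t0|exact: iphi]; last first.
  rewrite /p' -powR_mulrn ?(ltW t0) // -powRD ?(gt_eqF t0) ?implybT //.
  by congr (_ `^ _ * _); rewrite /nu; ring.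
have -> : lam ^+ i.+2 / i.+1`!%:R * C = lam ^+ i.+1 / i`!%:R * C * (lam / i.+1%:R).
  have f0 : i`!%:R != 0 :> R by rewrite pnatr_eq0 -lt0n fact_gt0.
  rewrite factS natrM exprS; field.
  by rewrite f0 nat1r pnatr_eq0.
have c0 : 0 <= lam ^+ i.+1 / i`!%:R * C.
  by rewrite mulr_ge0 ?(ltW C0) // divr_ge0 // exprn_ge0 // ltW.
rewrite mulrCA -[leRHS]mulrA ler_wpM2l //.
have -> : 1 - be / i.+1%:R = lam / i.+1%:R * s0.
  by rewrite /s0 /nu; field; rewrite nat1r pnatr_eq0 gt_eqF.
by rewrite -(mulrA _ s0) ler_wpM2l // divr_ge0 // ltW.
Qed.

End MomentGrowth.

Section NoLimit.
Context {R : realType}.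
Variables (lam be a C q : R) (m : nat) (b : nat -> R).
Hypotheses (lam0 : 0 < lam) (be0 : 0 <= be) (a0 : 0 < a) (C0 : 0 < C).
Hypotheses (q2 : 2 < q) (bm : 0 < b m).

(** For q > 2 the Wright numbers are (1 - q)^i times a polynomial in i of degree
    m, while the ratio of two consecutive moments is at least 1 - be / (i + 1) by
    [moment_gauss_growth]. So the terms alternate in sign and grow geometrically
    from some index on, and the partial sums are unbounded in both directions. *)
Lemma wright_series_dvg (L : \bar R) :
  ~ ((\sum_(i < n) wright_value q m b i * moment lam (gauss_time be a C) i)%:E @[n --> \oo] --> L).
Proof.
have q0 : 1 - q < 0 by move: q2; lra.
have q1 : 1 - q != 0 by rewrite lt_eqF.
have qp : 0 < q by move: q2; lra.
have [r rE] : exists r, r = q - 1 by exists (q - 1).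
have r1 : 1 < r by move: q2; lra.
have r00 : 0 < r by lra.
have r0 : 0 < r - 1 by lra.
have qr : `|1 - q| = r by rewrite distrC -rE gtr0_norm.
pose kap := (1 + r) / 2.
have kap1 : 1 < kap by rewrite /kap; lra.
have kap0 : 0 < kap by rewrite /kap; lra.
have [J' HJ'] : exists J' : nat, 2 * r * be / (r - 1) < J'%:R.
  by exists (Num.truncn (2 * r * be / (r - 1))).+1; exact: truncnS_gt.
have kapP j : (J' <= j)%N -> kap <= r * (1 - be / j.+1%:R).
  move=> J'j; have : 2 * r * be / (r - 1) <= j.+1%:R.
    by rewrite (le_trans (ltW HJ')) // ler_nat leqW.
  rewrite ler_pdivrMr // => H.
  rewrite /kap -(ler_pM2r (ltr0Sn R j)).
  have -> : r * (1 - be / j.+1%:R) * j.+1%:R = r * (j.+1%:R - be).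
    by field; rewrite nat1r pnatr_eq0.
  nra.
pose g i := moment lam (gauss_time be a C) i.
have g0 i : 0 < g i by exact: moment_gauss_gt0.
(* The sign makes the leading coefficient d m positive. *)
pose d k := (-1) ^+ m * ((q / (1 - q)) ^+ k * b k).
have dm : 0 < d m.
  rewrite /d mulrA -exprMn mulr_gt0 // exprn_gt0 // mulN1r -mulrN -invrN opprB.
  by rewrite -rE divr_gt0.
have [e e0 [J HJ]] := binomial_sum_eventually dm.
pose Q j := \sum_(k < m.+1) 'C(j, k)%:R * d k.
have wE j : wright_value q m b j = q * (1 - q) ^+ j * (-1) ^+ m * Q j.
  rewrite /wright_value -!mulrA; congr (_ * _); rewrite /Q !mulr_sumr.
  apply: eq_bigr => k _; rewrite /d.
  have [kj|jk] := leqP k j; last by rewrite bin_small // !(mul0r, mulr0).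
  have -> : (1 - q) ^+ j = (1 - q) ^+ k * (1 - q) ^+ (j - k) by rewrite -exprD subnKC.
  have s2 : (-1) ^+ m * (-1) ^+ m = 1 :> R by rewrite -expr2 sqrr_sign.
  have -> : (1 - q) ^+ k * (1 - q) ^+ (j - k) * ((-1) ^+ m *
     ('C(j, k)%:R * ((-1) ^+ m * ((q / (1 - q)) ^+ k * b k)))) =
     ((-1) ^+ m * (-1) ^+ m) * ('C(j, k)%:R * ((1 - q) ^+ (j - k) *
       ((1 - q) ^+ k * (q / (1 - q)) ^+ k) * b k)) by ring.
  have -> : (1 - q) ^+ k * (q / (1 - q)) ^+ k = q ^+ k.
    by rewrite -exprMn mulrCA divff // mulr1.
  by rewrite s2 mul1r; ring.
apply: (@alternating_growth_dvg R (fun i => wright_value q m b i * moment lam (gauss_time be a C) i) (maxn J J') kap L kap1) => j.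
rewrite geq_max => /andP[Jj J'j]; have [Qe QS] := HJ j Jj.
rewrite -/(Q j) -/(Q j.+1) in Qe QS.
have Q0 : 0 < Q j by exact: lt_le_trans Qe.
have QS0 : 0 < Q j.+1 by exact: lt_le_trans QS.
rewrite -!/(g _) !wE; split.
  have -> : q * (1 - q) ^+ j * (-1) ^+ m * Q j * g j *
     (q * (1 - q) ^+ j.+1 * (-1) ^+ m * Q j.+1 * g j.+1) =
     ((-1) ^+ m) ^+ 2 * (q * (1 - q) ^+ j) ^+ 2 * (Q j * g j * (Q j.+1 * g j.+1)) * (1 - q).
    by rewrite exprS; ring.
  rewrite sqrr_sign mul1r pmulr_rlt0 //.
  apply: mulr_gt0; last by rewrite !mulr_gt0.
  have h : q * (1 - q) ^+ j != 0 by rewrite mulf_neq0 ?expf_neq0 // gt_eqF.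
  by rewrite exprn_even_gt0.
rewrite !normrM !normrX normrN1 !expr1n !mulr1.
rewrite qr.
rewrite !(gtr0_norm Q0) !(gtr0_norm QS0) !(gtr0_norm (g0 _)).
rewrite exprS.
have be_j := kapP j J'j.
have bej : be < j.+1%:R.
  have : 0 < r * (1 - be / j.+1%:R) by exact: lt_le_trans be_j.
  by rewrite pmulr_rgt0 // subr_gt0 ltr_pdivrMr // mul1r.
have G : (1 - be / j.+1%:R) * g j <= g j.+1 by exact: moment_gauss_growth.
set A := `|q|; have A0 : 0 <= A by exact: normr_ge0.
have rj0 : 0 <= r ^+ j by rewrite exprn_ge0 // ltW.
apply: (@le_trans _ _ (r * (1 - be / j.+1%:R) * (A * r ^+ j * Q j * g j))).
  by rewrite ler_wpM2r // !mulr_ge0 // ltW.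
have -> : r * (1 - be / j.+1%:R) * (A * r ^+ j * Q j * g j) =
   (A * (r * r ^+ j) * Q j) * ((1 - be / j.+1%:R) * g j) by ring.
have Ar0 : 0 <= A * (r * r ^+ j) by rewrite mulr_ge0 // mulr_ge0 // ltW.
apply: ler_pM => //.
- by rewrite mulr_ge0 // ltW.
- rewrite mulr_ge0 ?(ltW (g0 _)) // subr_ge0 ler_pdivrMr // mul1r ltW //.
- by rewrite ler_wpM2l.
Qed.

End NoLimit.

(** * The fundamental solution at a point *)

Section Pointwise.
Context {R : realType}.
Notation mu := (@lebesgue_measure R).
Notation D := (`]0, +oo[%classic : set R).

Variables (N : nat) (r h alpha : R) (n : nat) (x : N.-tuple R).
Hypotheses (r01 : 0 < r < 1) (h0 : 0 < h) (al01 : 0 < alpha < 1).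

Let S := \sum_(i < N) tnth x i ^+ 2.
Hypothesis S0 : 0 < S.

Let q := h `^ (1 - alpha).
Let b := wright_coef alpha n.-1.
Let F := gauss_time (N%:R / 2) (S / 4) ((4 * pi) `^ (- (N%:R / 2))).

Lemma gauss_kernel_time t : 0 < t -> gauss_kernel t x = F t.
Proof.
move=> t0; rewrite /gauss_kernel /F /gauss_time.
rewrite powRM ?(ltW t0) // ?mulr_ge0 ?pi_ge0 //; congr (_ * expR _).
by rewrite -/S; field; rewrite gt_eqF.
Qed.

Lemma Re_wright_value i :
  complex.Re (wright r h alpha (1 - alpha) n.-1 i) = wright_value q n.-1 b i.
Proof.
rewrite Re_wright // -/q /wright_value; congr (_ * _).
have := binsum_bdiff i 1 (- q) (fun i => powcoef (alpha * i.+1%:R - 1) n.-1).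
rewrite /binsum opprK => E.
transitivity (\sum_(k < i.+1) 'C(i, k)%:R *
    ((1 - q) ^+ (i - k) * q ^+ k * b k)).
  by rewrite -[RHS]E; apply: eq_bigr => k _; rewrite expr1n mul1r.
apply: (@sum_eq_support _ _ _ (fun k => 'C(i, k)%:R *
    ((1 - q) ^+ (i - k) * q ^+ k * b k))) => k ik.
  by rewrite bin_small // mul0r.
by rewrite /b wright_coef_eq0 // !mulr0.
Qed.

Let F_bounded : exists K, forall t, 0 < t -> F t <= K.
Proof.
by apply: gauss_time_bounded; rewrite ?divr_gt0 ?powR_gt0 ?mulr_gt0 ?pi_gt0.
Qed.

Let C0 : 0 < (4 * pi) `^ (- (N%:R / 2)) :> R.
Proof. by rewrite powR_gt0 // mulr_gt0 // pi_gt0. Qed.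

Let a0 : 0 < S / 4. Proof. by rewrite divr_gt0. Qed.

Let be0 : 0 <= N%:R / 2 :> R. Proof. by rewrite divr_ge0. Qed.

Let F0 t : 0 < t -> 0 <= F t.
Proof. by move=> t0; rewrite ltW // gauss_time_gt0. Qed.

Let hV0 : 0 < h^-1. Proof. by rewrite invr_gt0. Qed.

Let mF : measurable_fun D F. Proof. exact: measurable_gauss_time. Qed.

Lemma discrete_gauss_moment i :
  discrete_gauss h i.+1 x = (moment h^-1 F i)%:E.
Proof.
have [K FK] := F_bounded.
have ii := integrable_moment hV0 mF F0 FK i.
rewrite /moment /Rintegral fineK; last first.
  by apply: integrable_fin_num ii; exact: measurable_itv.
set c := h ^+ i.+1 * i`!%:R.
have c0 : 0 < c by rewrite mulr_gt0 ?exprn_gt0 // ltr0n fact_gt0.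
have md0 t : 0 < t -> 0 <= moment_density h^-1 i t * F t.
  move=> t0; rewrite mulr_ge0 ?F0 // mulr_ge0 ?expR_ge0 // mulr_ge0 ?(ltW hV0) //.
  by rewrite divr_ge0 // exprn_ge0 // mulr_ge0 // ltW.
rewrite /discrete_gauss Gamma_nat -/c.
transitivity ((c^-1)%:E * \int[mu]_(t in D)
    (c%:E * (moment_density h^-1 i t * F t)%:E))%E.
  congr (_ * _)%E; apply: eq_integral => t; rewrite inE /= in_itv /= andbT => t0.
  rewrite -EFinM gauss_kernel_time // /moment_density; congr (_%:E).
  have f0 : i`!%:R != 0 :> R by rewrite pnatr_eq0 -lt0n fact_gt0.
  have -> : - t / h = - (h^-1 * t) by rewrite mulNr mulrC.
  rewrite /c exprMn exprVn exprS; field.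
  by rewrite f0 expf_neq0 // gt_eqF.
rewrite ge0_integralZl_EFin ?(ltW c0) //; last 2 first.
- by move=> t; rewrite /= in_itv /= andbT => t0; rewrite lee_fin md0.
- exact: (measurable_int mu ii).
by rewrite muleA -EFinM mulVf ?mul1e // gt_eqF.
Qed.

Let u i := wright_value q n.-1 b i * moment h^-1 F i.

Lemma fundamental_solution_lim :
  fundamental_solution r h alpha n x = limn (fun k => (\sum_(i < k) u i)%:E).
Proof.
have E k : (\sum_(1 <= j < k.+1)
    ((complex.Re (wright r h alpha (1 - alpha)%R n.-1 j.-1))%:E *
     discrete_gauss h j x) = (\sum_(i < k) u i)%R%:E)%E.
  rewrite big_add1 big_mkord -sumEFin; apply: eq_bigr => i _.
  by rewrite Re_wright_value discrete_gauss_moment -EFinM.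
rewrite /fundamental_solution.
set v := fun k => (\sum_(1 <= j < k) _)%E.
have vE : [sequence v k.+1]_k = fun k => (\sum_(i < k) u i)%:E.
  by apply/funext => k; exact: E.
have [circ_pow_im|dv] := pselect (cvgn v).
  have /cvg_ex[L vL] := circ_pow_im.
  rewrite (cvg_lim _ vL) //; apply/esym/cvg_lim => //.
  by rewrite -vE; move: vL; rewrite -cvg_shiftS.
rewrite (dvgP dv); apply/esym/dvgP => cw; apply: dv.
have /cvg_ex[L wL] := cw.
by apply/cvg_ex; exists L; rewrite -cvg_shiftS; rewrite -vE in wL.
Qed.

(** The series, if it has a limit, has its Abel sum as limit when q <= 2, and
    cannot have one when q > 2. *)
Lemma fundamental_solution_le :
  (`|fundamental_solution r h alpha n x| <= (abel_mean h^-1 q n.-1 b F 1)%:E)%E.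
Proof.
have [K FK] := F_bounded.
have q0 : 0 < q by rewrite powR_gt0.
have b0 k : 0 <= b k by exact: wright_coef_ge0.
have B0 : 0 <= abel_mean h^-1 q n.-1 b F 1.
  apply: Rintegral_ge0 => t; rewrite /= in_itv /= andbT => t0.
  rewrite mulr_ge0 ?F0 // mulr_ge0 ?expR_ge0 // mulr_ge0 //.
    by rewrite mulr_ge0 // ltW.
  by rewrite wright_poly_ge0 // mul1r mulr_ge0 // ltW.
rewrite fundamental_solution_lim.
set w := fun k => _.
have [/cvg_ex[L wL]|dw] := pselect (cvgn w); last first.
  by rewrite (dvgP dw) /= normr0 lee_fin.
have [q2|q2] := leP q 2; last first.
  have bm : 0 < b n.-1 by rewrite /b wright_coef_diag exprn_gt0 //; case/andP: al01.
  by case: (wright_series_dvg hV0 be0 a0 C0 q2 bm wL).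
pose rho k : R := 1 - k.+2%:R^-1.
have rho01 k : 0 < rho k < 1.
  have k1 : 1 < k.+2%:R :> R by rewrite ltr1n.
  have k0 : 0 < k.+2%:R :> R by rewrite ltr0n.
  by rewrite /rho subr_gt0 invf_lt1 // k1 /= gtrBl invr_gt0.
have rho1 : rho k @[k --> \oo] --> (1 : R).
  rewrite -[X in _ --> X](subr0 1); apply: cvgB; first exact: cvg_cst.
  by have := @cvg_harmonic R; rewrite -cvg_shiftS.
have q1 : `|1 - q| <= 1 by rewrite ler_norml; apply/andP; split; lra.
rewrite (cvg_lim _ wL) //.
have -> : L = (abel_mean h^-1 q n.-1 b F 1)%:E.
  have lim1 := abel_mean_lim (m := n.-1) hV0 q0 b0 mF F0 FK rho01 rho1.
  have circ_pow_im l := abel_mean_cvg (m := n.-1) hV0 q0 b0 mF F0 FK (rho01 l) q1.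
  exact: (abel_regular rho01 rho1 lim1 circ_pow_im wL).
by rewrite /= ger0_norm.
Qed.

End Pointwise.

(** * Two integral inequalities *)

Section LowerIntegral.
Local Open Scope ereal_scope.
Context d (T : measurableType d) (R : realType) (mu : {measure set T -> \bar R}).

Import HBNNSimple.

(** The integral of a nonnegative function is the supremum of the integrals of
    the simple functions below it, which are at most g almost everywhere. This
    suits the fundamental solution, a pointwise limit that may fail to exist. *)
Lemma ge0_le_integral_outside (Z : set T) (f g : T -> \bar R) :
  measurable Z -> mu Z = 0 -> (forall x, 0 <= f x) -> (forall x, 0 <= g x) ->
  measurable_fun setT g -> (forall x, ~ Z x -> f x <= g x) ->
  \int[mu]_x f x <= \int[mu]_x g x.
Proof.
move=> mZ Z0 f0 g0 mg fg; rewrite ge0_integralTE //.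
apply: ge_ereal_sup => _ [s /= sf <-]; rewrite -integralT_nnsfun.
apply: ae_ge0_le_integral => //.
- by move=> x _; rewrite lee_fin.
- exact/measurable_EFinP.
exists Z; split => // x /= H; apply: contrapT => nZ; apply: H => _.
exact: le_trans (sf x) (fg x nZ).
Qed.

End LowerIntegral.

Section Jensen.
Local Open Scope ereal_scope.
Context d (T : measurableType d) (R : realType) (mu : {measure set T -> \bar R}).
Variables (D : set T) (mD : measurable D).

(** The graph of y^p lies above its tangent at a, solved for y. *)
Lemma young_tangent (p a y : R) : (1 <= p)%R -> (0 < a)%R -> (0 <= y)%R ->
  (y <= a `^ (1 - p) / p * y `^ p + (1 - p^-1) * a)%R.
Proof.
move=> p1 a0 y0; have p0 : (0 < p)%R by exact: lt_le_trans p1.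
have [->|pn1] := eqVneq p 1%R.
  by rewrite subrr powRr0 divr1 mul1r powRr1 // invr1 subrr mul0r addr0.
have p1' : (1 < p)%R by rewrite lt_neqAle eq_sym pn1.
pose q := (p / (p - 1))%R.
have pm0 : (0 < p - 1)%R by rewrite subr_gt0.
have q0 : (0 < q)%R by rewrite divr_gt0.
have qE : (q^-1 = 1 - p^-1)%R by rewrite /q; field; rewrite !gt_eqF.
have := @conjugate_powR R (y * a `^ ((1 - p) / p))%R (a `^ ((p - 1) / p))%R p q.
rewrite mulr_ge0 ?powR_ge0 // => /(_ isT isT p0 q0); rewrite qE addrC subrK => /(_ erefl).
rewrite -mulrA -powRD; last by rewrite (gt_eqF a0) implybT.
have -> : ((1 - p) / p + (p - 1) / p = 0)%R by field; rewrite gt_eqF.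
rewrite powRr0 mulr1 => /le_trans; apply.
rewrite powRM ?powR_ge0 // -!powRrM divfK ?gt_eqF //.
have -> : ((p - 1) / p * q = 1)%R by rewrite /q; field; rewrite !gt_eqF.
by rewrite powRr1 ?(ltW a0) // le_eqVlt; apply/orP; left; apply/eqP; ring.
Qed.

(** Jensen's inequality for y |-> y^p and a weight of total mass at most V:
    integrate the tangent inequality, then choose the point a of tangency. *)
Lemma weighted_jensen (w f : T -> R) (p V : R) : (1 <= p)%R -> (0 < V)%R ->
  measurable_fun D w -> measurable_fun D f ->
  (forall t, D t -> 0 <= w t)%R -> (forall t, D t -> 0 <= f t)%R ->
  \int[mu]_(t in D) (w t)%:E <= V%:E ->
  (\int[mu]_(t in D) (w t * f t)%:E) `^ p <=
  (V `^ (p - 1))%:E * \int[mu]_(t in D) (w t * f t `^ p)%:E.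
Proof.
move=> p1 V0 mw mf w0 f0 wV.
have p0 : (0 < p)%R by exact: lt_le_trans p1.
set Z := \int[mu]_(t in D) (w t * f t `^ p)%:E.
have mfp : measurable_fun D (fun t => f t `^ p)%R.
  exact: (measurableT_comp (measurable_powR p) mf).
have Z0 : 0 <= Z.
  by apply: integral_ge0 => t Dt; rewrite lee_fin mulr_ge0 ?powR_ge0 ?w0.
have VV0 : (0 < V `^ (p - 1))%R by rewrite powR_gt0.
have [Zy|Zy] := eqVneq Z +oo.
  by rewrite Zy gt0_muley ?lte_fin // leey.
have Zfin : Z \is a fin_num by rewrite ge0_fin_numE // ltey.
rewrite -(fineK Zfin); set z := fine Z.
have z0 : (0 <= z)%R by exact: fine_ge0.
apply/lee_addgt0Pr => e e0.
(* The point of tangency that makes the two terms of the bound add up to a V;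
   e' > 0 keeps it positive when z = 0. *)
pose e' := (e / V `^ (p - 1))%R.
have e'0 : (0 < e')%R by rewrite divr_gt0.
pose a := (((z + e') / V) `^ p^-1)%R.
have ze0 : (0 < z + e')%R by rewrite ltr_wpDl.
have zV : (0 < (z + e') / V)%R by rewrite divr_gt0.
have a0 : (0 < a)%R by rewrite powR_gt0.
have aV : (a `^ p * V = z + e')%R.
  by rewrite /a -powRrM mulVf ?gt_eqF // powRr1 ?(ltW zV) // divfK ?gt_eqF.
have c1 : (0 <= a `^ (1 - p) / p)%R by rewrite divr_ge0 ?powR_ge0 // ltW.
have c2 : (0 <= (1 - p^-1) * a)%R.
  by rewrite mulr_ge0 ?(ltW a0) // subr_ge0 invf_le1.
have le1 : \int[mu]_(t in D) (w t * f t)%:E <= (a * V)%:E.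
  apply: (@le_trans _ _ ((a `^ (1 - p) / p)%:E * Z +
      ((1 - p^-1) * a)%:E * \int[mu]_(t in D) (w t)%:E)).
    have mwf : measurable_fun D (fun t => (w t * f t `^ p)%:E).
      by apply/measurable_EFinP; exact: measurable_funM.
    have mwE : measurable_fun D (fun t => (w t)%:E) by exact/measurable_EFinP.
    have wf0 t : D t -> 0 <= (w t * f t `^ p)%:E.
      by move=> Dt; rewrite lee_fin mulr_ge0 ?powR_ge0 ?w0.
    have wE0 t : D t -> 0 <= (w t)%:E by move=> Dt; rewrite lee_fin w0.
    rewrite /Z -(ge0_integralZl_EFin mu mD wf0 mwf c1).
    rewrite -(ge0_integralZl_EFin mu mD wE0 mwE c2) -ge0_integralD //; last 4 first.
    - by move=> t Dt; apply: mule_ge0; [rewrite lee_fin|exact: wf0].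
    - exact: measurable_funeM.
    - by move=> t Dt; apply: mule_ge0; [rewrite lee_fin|exact: wE0].
    - exact: measurable_funeM.
    apply: ge0_le_integral => //.
    - by move=> t Dt; rewrite lee_fin mulr_ge0 ?w0 ?f0.
    - by apply/measurable_EFinP; exact: measurable_funM.
    - by apply: emeasurable_funD; exact: measurable_funeM.
    move=> t Dt; rewrite -!EFinM -EFinD lee_fin.
    have := young_tangent p1 a0 (f0 t Dt) => /(ler_wpM2l (w0 t Dt)) /le_trans; apply.
    by rewrite le_eqVlt; apply/orP; left; apply/eqP; ring.
  apply: (@le_trans _ _ ((a `^ (1 - p) / p)%:E * (z + e')%:E + ((1 - p^-1) * a)%:E * V%:E)).
    apply: leeD; apply: lee_wpmul2l; rewrite ?lee_fin // -(fineK Zfin) lee_fin.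
    by rewrite lerDl ltW.
  rewrite -!EFinM -EFinD lee_fin le_eqVlt; apply/orP; left; apply/eqP.
  rewrite -aV.
  have -> : (a `^ (1 - p) / p * (a `^ p * V) = (a `^ (1 - p) * a `^ p) * V / p)%R by ring.
  rewrite -powRD; last by rewrite (gt_eqF a0) implybT.
  by rewrite subrK powRr1 ?(ltW a0) //; ring.
apply: (@le_trans _ _ ((a * V)%:E `^ p)).
  apply: gt0_ler_poweR => //; rewrite ?(ltW p0) // in_itv /= leey andbT //.
    apply: integral_ge0 => t Dt; by rewrite lee_fin mulr_ge0 ?w0 ?f0.
  by rewrite lee_fin mulr_ge0 // ltW.
rewrite poweR_EFin -EFinM -EFinD lee_fin powRM ?(ltW a0) ?(ltW V0) //.
have -> : (V `^ p = V * V `^ (p - 1))%R by rewrite mulr_powRB1 // ltW.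
rewrite mulrA aV mulrDl /e' divfK ?gt_eqF //.
by rewrite mulrC.
Qed.

End Jensen.

(** * Gaussian integrals over R^N *)

Section LebesgueTuple.
Context {R : realType}.
Notation mu := (@lebesgue_measure R).

Lemma lebesgue_tuple_sigma_finite N :
  sigma_finite [set: N.-tuple R] (@lebesgue_tuple R N).
Proof.
pose I (k : nat) : set R := `[- k%:R, k%:R]%classic.
exists (fun k => [set x : N.-tuple R | forall i, I k (tnth x i)]).
  apply/seteqP; split => // x _.
  have [k Hk] : exists k : nat, forall i : 'I_N, `|tnth x i| <= k%:R.
    exists (\max_(i < N) (Num.truncn `|tnth x i|).+1)%N => i.
    rewrite (le_trans (ltW (truncnS_gt _))) // ler_nat.
    exact: (@leq_bigmax _ (fun i : 'I_N => (Num.truncn `|tnth x i|).+1) i).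
  by exists k => // i; rewrite /I /= in_itv /= -ler_norml.
move=> k; split.
  rewrite (_ : mkset _ = \bigcap_(i in [set: 'I_N])
      ((fun x : N.-tuple R => tnth x i) @^-1` I k)).
    apply: fin_bigcap_measurable => // i _; rewrite -[X in measurable X]setTI.
    by apply: measurable_tnth => //; exact: measurable_itv.
  by apply/seteqP; split=> x /= H; [move=> i _|move=> i]; exact: H.
rewrite (lebesgue_tuple_box (fun=> measurable_itv _)).
rewrite (eq_bigr (fun=> (k%:R - - k%:R)%:E)) => [|i _].
  by rewrite prodEFin ltry.
rewrite [LHS]lebesgue_measure_itv /=; case: ifPn => //.
rewrite lte_fin -leNgt => h; congr (_%:E); have : (0 : R) <= k%:R by []; lra.
Qed.

(** A copy of the measure to which its sigma-finiteness can be attached, as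
    Tonelli's theorem requires. *)
Definition lebesgue_sfinite N : set (N.-tuple R) -> \bar R := @lebesgue_tuple R N.
HB.instance Definition _ N := Measure.on (@lebesgue_sfinite N).
HB.instance Definition _ N := @Measure_isSigmaFinite.Build _ _ _
  (@lebesgue_sfinite N) (@lebesgue_tuple_sigma_finite N).

Lemma lebesgue_tuple_zero N : (0 < N)%N ->
  lebesgue_tuple N [set x : N.-tuple R | \sum_(i < N) tnth x i ^+ 2 = 0] = 0%E.
Proof.
move=> N0; rewrite (_ : mkset _ = [set x : N.-tuple R | forall i, [set 0] (tnth x i)]).
  rewrite (lebesgue_tuple_box (fun=> measurable_set1 _)).
  rewrite (bigD1 (Ordinal N0)) //= (_ : lebesgue_measure [set 0] = 0%E) ?mul0e //.
  exact: lebesgue_measure_set1.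
apply/seteqP; split => x /= => [H i|H].
  apply/eqP; rewrite -sqrf_eq0; apply/eqP.
  by apply/eqP; move/eqP: H; rewrite psumr_eq0 => [/allP/(_ i (mem_index_enum i))|j _]; rewrite ?sqr_ge0.
by rewrite big1 // => i _; rewrite H expr0n.
Qed.

Lemma measurable_sqnorm N :
  measurable_fun setT (fun x : N.-tuple R => \sum_(i < N) tnth x i ^+ 2).
Proof.
apply: measurable_sum => i; apply: measurable_funX.
exact: measurable_tnth.
Qed.

(** The total mass of the normal law of variance 1/(2 c). *)
Lemma gauss_integral1 c : 0 < c ->
  (\int[mu]_y (expR (- (c * y ^+ 2)))%:E = (Num.sqrt (pi / c))%:E)%E.
Proof.
move=> c0; pose s := (Num.sqrt (2 * c))^-1.
have s20 : 0 < Num.sqrt (2 * c) by rewrite sqrtr_gt0 mulr_gt0.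
have s0 : s != 0 by rewrite invr_eq0 gt_eqF.
have s2 : s ^+ 2 = (2 * c)^-1 by rewrite /s exprVn sqr_sqrtr // mulr_ge0 // ltW.
have := integral_normal_pdf 0 s.
have pk : 0 < normal_peak s by exact: normal_peak_gt0.
have -> : (\int[mu]_x (normal_pdf 0 s x)%:E =
    (normal_peak s)%:E * \int[mu]_y (expR (- (c * y ^+ 2)))%:E)%E.
  have e0 y : [set: R] y -> (0 <= (expR (- (c * y ^+ 2)))%:E)%E.
    by rewrite lee_fin expR_ge0.
  have me : measurable_fun setT (fun y : R => (expR (- (c * y ^+ 2)))%:E).
    apply/measurable_EFinP; apply: measurableT_comp => //.
    by apply: measurableT_comp => //; exact: measurable_funM.
  rewrite -(ge0_integralZl_EFin mu measurableT e0 me (ltW pk)).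
  apply: eq_integral => y _; rewrite normal_pdfE // -EFinM; congr (_%:E).
  rewrite /normal_fun subr0 s2; congr (_ * expR _).
  by field; rewrite gt_eqF.
move=> /(congr1 (fun z => ((normal_peak s)^-1)%:E * z)%E).
rewrite muleA -EFinM mulVf ?gt_eqF // mul1e mule1 => ->.
rewrite /normal_peak invrK s2; congr (Num.sqrt _)%:E.
by rewrite -mulr_natr; field; rewrite gt_eqF.
Qed.

Lemma gauss_integral_tuple N c : 0 < c ->
  (\int[@lebesgue_tuple R N]_x (expR (- (c * \sum_(i < N) tnth x i ^+ 2)))%:E =
   ((Num.sqrt (pi / c)) ^+ N)%:E)%E.
Proof.
move=> c0; elim: N => [|N IH].
  rewrite integral_dirac //=.
    by rewrite diracT mul1e big_ord0 mulr0 oppr0 expR0.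
  apply/measurable_EFinP; apply: measurableT_comp => //.
  apply: measurableT_comp => //; apply: measurable_funM => //.
  exact: measurable_sqnorm.
have mg n : measurable_fun setT (fun x : n.-tuple R =>
    (expR (- (c * \sum_(i < n) tnth x i ^+ 2)))%:E).
  apply/measurable_EFinP; apply: measurableT_comp => //.
  apply: measurableT_comp => //; apply: measurable_funM => //.
  exact: measurable_sqnorm.
pose g n (x : n.-tuple R) := expR (- (c * \sum_(i < n) tnth x i ^+ 2)).
have mD : measurable_fun [set: N.+1.-tuple R] (EFin \o g N.+1) by exact: mg.
transitivity (\int[@lebesgue_sfinite N \x mu]_u (g N.+1 (tuple_of_pair u))%:E)%E.
  have g0 : {in [set: N.+1.-tuple R], forall y, (0 <= (EFin \o g N.+1) y)%E}.
    by move=> y _; rewrite /= lee_fin expR_ge0.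
  have mphi : measurable_fun [set: (N.-tuple R * measurableTypeR R)%type] (@tuple_of_pair R N).
    exact: measurable_tuple_of_pair.
  have H := ge0_integral_pushforward mphi
    (@lebesgue_sfinite N \x mu)%E measurableT mD g0.
  exact: H.
have gE u : g N.+1 (tuple_of_pair u) = g N u.1 * expR (- (c * u.2 ^+ 2)).
  rewrite /g big_ord_recl /= mulrDr opprD addrC expRD; congr (expR (- (c * _)) * _).
  by apply: eq_bigr => i _; rewrite (tnth_nth 0) (tnth_nth 0).
pose G (u : N.-tuple R * measurableTypeR R) := (g N u.1 * expR (- (c * u.2 ^+ 2)))%:E.
have m1 : measurable_fun setT (fun y : measurableTypeR R => (expR (- (c * y ^+ 2)))%:E).
  apply/measurable_EFinP; apply: measurableT_comp => //.
  by apply: measurableT_comp => //; exact: measurable_funM.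
have mG : measurable_fun setT G.
  apply/measurable_EFinP; apply: measurable_funM.
    apply: (measurableT_comp (f := g N)); first by apply/measurable_EFinP; exact: mg.
    exact: measurable_fst.
  apply: (measurableT_comp (f := fun y : measurableTypeR R => expR (- (c * y ^+ 2)))).
    by apply/measurable_EFinP; exact: m1.
  exact: measurable_snd.
have G0 u : (0 <= G u)%E by rewrite lee_fin mulr_ge0 ?expR_ge0.
transitivity (\int[@lebesgue_sfinite N \x mu]_u G u)%E.
  by apply: eq_integral => u _; rewrite gE.
rewrite (fubini_tonelli1 G mG G0) /fubini_F.
transitivity (\int[@lebesgue_sfinite N]_x ((Num.sqrt (pi / c))%:E * (g N x)%:E))%E.
  apply: eq_integral => x _; rewrite -gauss_integral1 // muleC.
  have e0 y : [set: measurableTypeR R] y -> (0 <= (expR (- (c * y ^+ 2)))%:E)%E.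
    by rewrite lee_fin expR_ge0.
  have gx0 : 0 <= g N x by exact: expR_ge0.
  rewrite -(ge0_integralZl_EFin mu measurableT e0 m1 gx0).
  by apply: eq_integral => y _; rewrite /G /= EFinM.
rewrite ge0_integralZl_EFin //.
+ by rewrite [X in (_ * X)%E]IH -EFinM exprS.
+ by move=> x _; rewrite lee_fin expR_ge0.
+ exact: mg.
Qed.

End LebesgueTuple.

(** * Moments of the subordination density *)

Section WrightDensity.
Context {R : realType}.
Implicit Types (t k th : R).
Notation mu := (@lebesgue_measure R).
Notation D := (`]0, +oo[%classic : set R).

Let mD : @measurable _ (measurableTypeR R) D. Proof. exact: measurable_itv. Qed.

Variables (alpha : R) (m : nat).
Hypothesis al01 : 0 < alpha < 1.

(** The subordination density w of parameter k = h^(- alpha). *)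
Definition wright_density k t :=
  k * (\sum_(i < m.+1) wright_coef alpha m i * ((k * t) ^+ i / i`!%:R)) * expR (- (k * t)).

Lemma wright_density_ge0 k t : 0 < k -> 0 <= t -> 0 <= wright_density k t.
Proof.
move=> k0 t0; rewrite mulr_ge0 ?expR_ge0 // mulr_ge0 ?(ltW k0) //.
apply: sumr_ge0 => i _; rewrite mulr_ge0 ?wright_coef_ge0 // divr_ge0 //.
by rewrite exprn_ge0 // mulr_ge0 // ltW.
Qed.

Lemma measurable_wright_density k : measurable_fun setT (wright_density k).
Proof.
apply: measurable_funM; last first.
  apply: measurableT_comp => //.
  by apply: measurableT_comp => //; exact: measurable_funM.
apply: measurable_funM => //; apply: measurable_sum => i.
apply: measurable_funM => //; apply: measurable_funM => //.
by apply: measurable_funX; exact: measurable_funM.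
Qed.

Lemma abel_density_wright lam q t :
  abel_density lam q m (wright_coef alpha m) 1 t = wright_density (q * lam) t.
Proof.
rewrite /abel_density /wright_density mulr1 subKr !mul1r; congr (_ * _ * _).
by apply: eq_bigr => i _; rewrite (mulrA q).
Qed.

(** Each term is a Gamma integral, and the resulting sum is
    [sum_wright_coef_powcoef] at x = th - 1. *)
Lemma wright_density_moment k th : 0 < k -> 0 <= th < 1 ->
  (\int[mu]_(t in D) (wright_density k t * t `^ (- th))%:E =
   (k * powcoef (alpha * th - 1) m)%:E * gamma_int k (1 - th))%E.
Proof.
move=> k0 /andP[th0 th1]; have s0 : 0 < 1 - th by rewrite subr_gt0.
pose c i := k * (wright_coef alpha m i * (k ^+ i / i`!%:R)).
have c0 i : 0 <= c i.
  rewrite mulr_ge0 ?(ltW k0) // mulr_ge0 ?wright_coef_ge0 // divr_ge0 //.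
  by rewrite exprn_ge0 // ltW.
pose e i t := t `^ (1 - th + i%:R - 1) * expR (- (k * t)).
transitivity (\int[mu]_(t in D) (\sum_(i < m.+1) (c i)%:E * (e i t)%:E))%E.
  apply: eq_integral => t; rewrite inE /= in_itv /= andbT => t0.
  under eq_bigr do rewrite -EFinM.
  rewrite sumEFin; congr EFin; rewrite /wright_density mulr_sumr !mulr_suml.
  apply: eq_bigr => i _; rewrite /c /e.
  have -> : 1 - th + i%:R - 1 = i%:R - th by ring.
  rewrite powRD ?(gt_eqF t0) ?implybT // powR_mulrn ?(ltW t0) // exprMn.
  ring.
have e0 i t : D t -> (0 <= (e i t)%:E)%E by move=> _; rewrite lee_fin powR_expR_ge0.
have me i : measurable_fun D (fun t => (e i t)%:E).
  by apply/measurable_EFinP; exact: measurable_powR_expR.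
rewrite ge0_integral_sum //; last 2 first.
- by move=> i; apply: measurable_funeM; exact: me.
- by move=> i t Dt; apply: mule_ge0; [rewrite lee_fin|exact: e0].
transitivity (\sum_(i < m.+1) (c i)%:E * gamma_int k (1 - th + i%:R))%E.
  by apply: eq_bigr => i _; rewrite (ge0_integralZl_EFin mu mD (@e0 i) (me i) (c0 i)).
have -> : powcoef (alpha * th - 1) m = \sum_(i < m.+1) wright_coef alpha m i * powcoef (th - 1) i.
  by rewrite sum_wright_coef_powcoef subrK.
rewrite mulr_sumr -sumEFin ge0_sume_distrl; last first.
  move=> i _; rewrite lee_fin mulr_ge0 ?(ltW k0) // mulr_ge0 ?wright_coef_ge0 //.
  by rewrite powcoef_ge0 // subr_le0 ltW.
apply: eq_bigr => i _.
have := gamma_int_natD i k0 s0; rewrite opprB => E.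
have f0 : i`!%:R != 0 :> R by rewrite pnatr_eq0 -lt0n fact_gt0.
have -> : c i = k * wright_coef alpha m i / i`!%:R * k ^+ i by rewrite /c; ring.
rewrite EFinM -muleA E muleA -EFinM; congr (_%:E * _)%E.
by field.
Qed.

Lemma wright_density_moment_le k th : 0 < k -> 0 <= th < 1 ->
  (\int[mu]_(t in D) (wright_density k t * t `^ (- th))%:E <=
   (2 / (1 - th) * k `^ th * m.+1%:R `^ (- (alpha * th)))%:E)%E.
Proof.
move=> k0 th01; have /andP[th0 th1] := th01; have /andP[a0 a1] := al01.
rewrite wright_density_moment //.
have ath : 0 <= alpha * th < 1.
  by rewrite mulr_ge0 ?(ltW a0) //= -(mulr1 1) ltr_pM // ltW.
have b0 : 0 <= powcoef (alpha * th - 1) m by rewrite powcoef_ge0 // subr_le0 ltW //; case/andP: ath.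
apply: (le_trans (lee_wpmul2l _ (gamma_int_ub k0 th01))).
  by rewrite lee_fin mulr_ge0 // ltW.
rewrite -EFinM lee_fin.
have -> : k * powcoef (alpha * th - 1) m * (2 * k `^ (th - 1) / (1 - th)) =
   2 / (1 - th) * (k * k `^ (th - 1)) * powcoef (alpha * th - 1) m by ring.
have -> : k * k `^ (th - 1) = k `^ th.
  rewrite -{1}[k]powRr1 ?(ltW k0) // -powRD ?(gt_eqF k0) ?implybT //.
  by congr (_ `^ _); ring.
rewrite ler_wpM2l ?powcoef_le_powR //.
by rewrite mulr_ge0 ?powR_ge0 // divr_ge0 // subr_ge0 ltW.
Qed.

End WrightDensity.

(** * The norm estimate *)

Section Kernel.
Context {R : realType}.
Notation mu := (@lebesgue_measure R).
Notation D := (`]0, +oo[%classic : set R).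
Variable N : nat.
Implicit Types (t : R) (x : N.-tuple R).

Let mD : @measurable _ (measurableTypeR R) D. Proof. exact: measurable_itv. Qed.

Definition sqnorm x := \sum_(i < N) tnth x i ^+ 2.

Lemma sqnorm_ge0 x : 0 <= sqnorm x.
Proof. by apply: sumr_ge0 => i _; exact: sqr_ge0. Qed.

Lemma measurable_sqnorm0 : measurable [set x | sqnorm x = 0].
Proof.
rewrite -[X in measurable X]setTI.
have m0 : measurable_fun setT sqnorm by exact: measurable_sqnorm.
exact: (m0 measurableT [set 0] (measurable_set1 _)).
Qed.

(** The Gaussian kernel with 1/t written as a real power, whose measurability
    on the whole line makes that of the kernel in (x, t) immediate. *)
Definition gauss_joint t x : R :=
  (4 * pi * t) `^ (- (N%:R / 2)) * expR (- (sqnorm x / 4 * t `^ (- 1))).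

Lemma gauss_jointE t x : 0 < t -> gauss_kernel t x = gauss_joint t x.
Proof.
move=> t0; rewrite /gauss_kernel /gauss_joint powR_inv1 ?(ltW t0) //.
congr (_ * expR _); rewrite -/(sqnorm x); field.
by rewrite gt_eqF.
Qed.

Lemma gauss_joint_ge0 t x : 0 <= gauss_joint t x.
Proof. by rewrite mulr_ge0 ?powR_ge0 ?expR_ge0. Qed.

Lemma gauss_joint_le t x : gauss_joint t x <= (4 * pi * t) `^ (- (N%:R / 2)).
Proof.
rewrite /gauss_joint ler_piMr ?powR_ge0 // -expR0 ler_expR oppr_le0.
by rewrite mulr_ge0 ?powR_ge0 // divr_ge0 ?sqnorm_ge0.
Qed.

Lemma measurable_gauss_joint :
  measurable_fun setT (fun u : N.-tuple R * measurableTypeR R => gauss_joint u.2 u.1).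
Proof.
have m2 : measurable_fun setT (fun u : N.-tuple R * measurableTypeR R => u.2 : R).
  exact: measurable_snd.
apply: measurable_funM.
  apply: (measurableT_comp (measurable_powR _)).
  by apply: measurable_funM.
apply: measurableT_comp => //; apply: measurableT_comp => //.
apply: measurable_funM; last exact: (measurableT_comp (measurable_powR _) m2).
apply: measurable_funM => //.
apply: (measurableT_comp (f := sqnorm)); first exact: measurable_sqnorm.
exact: measurable_fst.
Qed.

(** The exact value has the further factor p^(- N/2) <= 1, dropped so that the
    bound holds with the constant 1 for all p. *)
Lemma gauss_joint_pnorm t p : 0 < t -> 1 <= p ->
  (\int[@lebesgue_tuple R N]_x (gauss_joint t x `^ p)%:E <=
   ((4 * pi * t) `^ (- (N%:R / 2 * (p - 1))))%:E)%E.
Proof.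
move=> t0 p1; have p0 : 0 < p by exact: lt_le_trans p1.
have pi0 := pi_gt0 R.
set v := 4 * pi * t; have v0 : 0 < v by rewrite !mulr_gt0.
pose c := p / (4 * t); have c0 : 0 < c by rewrite divr_gt0 // mulr_gt0.
have K0 : 0 <= v `^ (- (N%:R / 2) * p) by exact: powR_ge0.
apply: (@le_trans _ _ (\int[@lebesgue_tuple R N]_x
   ((v `^ (- (N%:R / 2) * p))%:E * (expR (- (c * sqnorm x)))%:E))%E).
  rewrite le_eqVlt; apply/orP; left; apply/eqP.
  apply: eq_integral => x _; rewrite -EFinM; congr (_%:E).
  rewrite /gauss_joint powRM ?powR_ge0 ?expR_ge0 // -powRrM; congr (_ * _).
  rewrite -expRM powR_inv1 ?(ltW t0) //; congr expR.
  by rewrite /c; field; rewrite gt_eqF.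
have e0 x : [set: N.-tuple R] x -> (0 <= (expR (- (c * sqnorm x)))%:E)%E.
  by rewrite lee_fin expR_ge0.
have me : measurable_fun setT (fun x => (expR (- (c * sqnorm x)))%:E).
  apply/measurable_EFinP; apply: measurableT_comp => //.
  apply: measurableT_comp => //; apply: measurable_funM => //.
  exact: measurable_sqnorm.
rewrite (ge0_integralZl_EFin (@lebesgue_tuple R N) measurableT e0 me K0).
rewrite gauss_integral_tuple // -EFinM lee_fin.
have -> : - (N%:R / 2 * (p - 1)) = - (N%:R / 2) * p + N%:R / 2 by ring.
rewrite powRD ?(gt_eqF v0) ?implybT // ler_wpM2l //.
have -> : v `^ (N%:R / 2) = Num.sqrt v ^+ N.
  by rewrite mulrC powRrM powR12_sqrt ?(ltW v0) // powR_mulrn ?sqrtr_ge0.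
rewrite lerXn2r ?nnegrE ?sqrtr_ge0 // ler_sqrt ?(ltW v0) //.
have -> : pi / c = v / p by rewrite /c /v; field; rewrite !gt_eqF.
by rewrite ler_pdivrMr // ler_peMr // ltW.
Qed.

End Kernel.

Section Norm.
Context {R : realType}.
Notation mu := (@lebesgue_measure R).
Notation D := (`]0, +oo[%classic : set R).
Let mD : @measurable _ (measurableTypeR R) D. Proof. exact: measurable_itv. Qed.

Variables (N : nat) (r h alpha : R) (n : nat).
Hypotheses (N0 : (0 < N)%N) (r01 : 0 < r < 1) (h0 : 0 < h) (al01 : 0 < alpha < 1)
  (n0 : (0 < n)%N).

Let k := h `^ (- alpha).
Let w t := wright_density alpha n.-1 k t.
Let k0 : 0 < k. Proof. by rewrite powR_gt0. Qed.

Lemma fundamental_solution_subordination (x : N.-tuple R) : 0 < sqnorm x ->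
  (`|fundamental_solution r h alpha n x| <=
   \int[mu]_(t in D) (w t * gauss_joint t x)%:E)%E.
Proof.
move=> S0; apply: (le_trans (fundamental_solution_le n r01 h0 al01 S0)).
have kE : h `^ (1 - alpha) * h^-1 = k.
  rewrite -powR_inv1 ?(ltW h0) // -powRD ?(gt_eqF h0) ?implybT //.
  by congr (_ `^ _); ring.
have -> : (\int[mu]_(t in D) (w t * gauss_joint t x)%:E =
    \int[mu]_(t in D) (abel_density h^-1 (h `^ (1 - alpha)) n.-1 (wright_coef alpha n.-1) 1 t *
      gauss_time (N%:R / 2) (sqnorm x / 4) ((4 * pi) `^ (- (N%:R / 2))) t)%:E)%E.
  apply: eq_integral => t; rewrite inE /= in_itv /= andbT => t0.
  by rewrite abel_density_wright kE -gauss_kernel_time // gauss_jointE.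
have fine_le (I : \bar R) : (0 <= I -> (fine I)%:E <= I)%E.
  by case: I => //= _; rewrite leey.
apply: fine_le; apply: integral_ge0 => t; rewrite /= in_itv /= andbT => t0.
rewrite abel_density_wright kE lee_fin mulr_ge0 //.
  by rewrite wright_density_ge0 // ltW.
by rewrite /gauss_time !mulr_ge0 ?powR_ge0 ?expR_ge0.
Qed.

Lemma scaled_rate th : 
  k `^ th * n.-1.+1%:R `^ (- (alpha * th)) = ((n%:R * h) `^ (alpha * th))^-1.
Proof.
rewrite prednK // /k -powRrM -powRN powRM ?(ltW h0) // mulrC.
by congr (_ * _ `^ _); ring.
Qed.

(** Jensen's inequality for the weight w(t) t^(- th) and the function
    t^th G_t(x), followed by Tonelli's theorem: this proves Minkowski's integral
    inequality directly, and the choice of th makes the p-th power of t^th G_t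
    have an integral over x that does not depend on t. *)
Lemma Lnorm_finite_le p th : 1 <= p -> th = N%:R / 2 * (1 - p^-1) -> th < 1 ->
  (Lnorm (@lebesgue_tuple R N) p%:E (fundamental_solution r h alpha n) <=
   ((4 * pi) `^ (- th) * (2 / (1 - th)) / (n%:R * h) `^ (alpha * th))%:E)%E.
Proof.
move=> p1 thE th1.
have p0 : 0 < p by exact: lt_le_trans p1.
have th0 : 0 <= th by rewrite thE mulr_ge0 ?divr_ge0 // subr_ge0 invf_le1.
have th01 : 0 <= th < 1 by rewrite th0.
have thp : th * p = N%:R / 2 * (p - 1).
  by rewrite thE; field; rewrite gt_eqF.
have pi0 : 0 < 4 * pi :> R by rewrite mulr_gt0 // pi_gt0.
pose V := 2 / (1 - th) / (n%:R * h) `^ (alpha * th).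
have V0 : 0 < V.
  apply: divr_gt0; first by rewrite divr_gt0 // subr_gt0.
  by rewrite powR_gt0 // mulr_gt0 // ltr0n.
have wV : (\int[mu]_(t in D) (w t * t `^ (- th))%:E <= V%:E)%E.
  apply: (le_trans (wright_density_moment_le n.-1 al01 k0 th01)).
  by rewrite /V -scaled_rate mulrA.
pose wt t := w t * t `^ (- th).
pose f x t := t `^ th * @gauss_joint R N t x.
have mw : measurable_fun setT w by exact: measurable_wright_density.
have mwt : measurable_fun setT wt.
  by apply: measurable_funM => //; exact: measurable_powR.
have wt0 t : D t -> 0 <= wt t.
  rewrite /= in_itv /= andbT => t0.
  by rewrite mulr_ge0 ?powR_ge0 // wright_density_ge0 // ltW.
have f0 x t : 0 <= f x t by rewrite mulr_ge0 ?powR_ge0 ?gauss_joint_ge0.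
have mf2 : measurable_fun setT (fun u : N.-tuple R * measurableTypeR R => f u.1 u.2).
  apply: measurable_funM; last exact: measurable_gauss_joint.
  by apply: (measurableT_comp (measurable_powR th)); exact: measurable_snd.
have mf x : measurable_fun setT (f x).
  exact: (measurableT_comp mf2 (pair1_measurable x)).
pose Z x := (\int[mu]_(t in D) (wt t * f x t `^ p)%:E)%E.
have Z0 x : (0 <= Z x)%E.
  by apply: integral_ge0 => t Dt; rewrite lee_fin mulr_ge0 ?powR_ge0 ?wt0.
pose H (u : N.-tuple R * measurableTypeR R) : \bar R :=
  (\1_D u.2 * (wt u.2 * f u.1 u.2 `^ p))%:E.
have H0 u : (0 <= H u)%E.
  rewrite /H lee_fin indicE; case: (boolP (_ \in _)) => [|_]; last by rewrite mul0r.
  by rewrite inE => Du; rewrite mul1r mulr_ge0 ?powR_ge0 ?wt0.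
have mH : measurable_fun setT H.
  apply/measurable_EFinP; apply: measurable_funM.
    apply: (measurableT_comp (f := \1_D : measurableTypeR R -> R)).
      exact: measurable_indic.
    exact: measurable_snd.
  apply: measurable_funM.
    by apply: (measurableT_comp mwt); exact: measurable_snd.
  exact: (measurableT_comp (measurable_powR p) mf2).
have indicD (g : R -> R) : (\int[mu]_(t in D) (g t)%:E =
    \int[mu]_t (\1_D t * g t)%:E)%E.
  rewrite integral_mkcond; apply: eq_integral => t _.
  by rewrite patchE indicE; case: ifP; rewrite ?mul1r ?mul0r.
have ZE x : Z x = fubini_F mu H x by rewrite /Z indicD.
have mZ : measurable_fun setT Z.
  rewrite (_ : Z = fubini_F mu H); last by apply/funext.
  exact: measurable_fun_fubini_tonelli_F.
have step1 : (\int[@lebesgue_tuple R N]_x (`|fundamental_solution r h alpha n x| `^ p) <=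
    \int[@lebesgue_tuple R N]_x ((V `^ (p - 1))%:E * Z x))%E.
  apply: (@ge0_le_integral_outside _ _ _ _ [set x | sqnorm x = 0]).
  - exact: measurable_sqnorm0.
  - exact: lebesgue_tuple_zero.
  - by move=> x; exact: poweR_ge0.
  - by move=> x; apply: mule_ge0; rewrite ?lee_fin ?powR_ge0.
  - exact: measurable_funeM.
  move=> x /eqP Sx; have S0 : 0 < sqnorm x by rewrite lt_neqAle eq_sym Sx sqnorm_ge0.
  have sub := fundamental_solution_subordination S0.
  have J := @weighted_jensen _ _ _ mu D mD wt (f x) p V p1 V0
    (measurable_funTS mwt) (measurable_funTS (mf x)) wt0 (fun t _ => f0 x t) wV.
  apply: le_trans J; apply: gt0_ler_poweR; rewrite ?(ltW p0) //.
  - by rewrite in_itv /= leey andbT.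
  - rewrite in_itv /= leey andbT; apply: integral_ge0 => t Dt.
    by rewrite lee_fin mulr_ge0 ?wt0.
  apply: (le_trans sub); rewrite le_eqVlt; apply/orP; left; apply/eqP.
  apply: eq_integral => t; rewrite inE /= in_itv /= andbT => t0.
  congr (_%:E); rewrite /wt /f -mulrA (mulrA (t `^ (- th))) -powRD; last first.
    by rewrite (gt_eqF t0) implybT.
  by rewrite addNr powRr0 mul1r.
have step2 : (\int[@lebesgue_tuple R N]_x Z x <= ((4 * pi) `^ (- (th * p)) * V)%:E)%E.
  have -> : (\int[@lebesgue_tuple R N]_x Z x = \int[@lebesgue_sfinite R N]_x fubini_F mu H x)%E.
    by apply: eq_integral => x _; exact: ZE.
  rewrite (fubini_tonelli H mH H0).
  apply: (@le_trans _ _ (\int[mu]_(t in D) (((4 * pi) `^ (- (th * p)))%:E * (wt t)%:E))%E).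
    rewrite [leRHS]integral_mkcond.
    apply: ge0_le_integral => //.
    - by move=> t _; apply: integral_ge0 => x _; exact: H0.
    - exact: measurable_fun_fubini_tonelli_G.
    - apply/(measurable_restrictT _ _).1 => //; apply: measurable_funeM.
      by apply/measurable_EFinP; exact: measurable_funTS.
    move=> t _; rewrite patchE; case: ifPn => [|tD]; last first.
      by rewrite /fubini_G integral0_eq // => x _; rewrite /H indicE (negbTE tD) mul0r.
    rewrite inE => Dt; have := Dt; rewrite /= in_itv /= andbT => t0.
    have c0 : 0 <= wt t * t `^ (th * p) by rewrite mulr_ge0 ?powR_ge0 ?wt0.
    have gp0 x : [set: N.-tuple R] x -> (0 <= (gauss_joint t x `^ p)%:E)%E.
      by rewrite lee_fin powR_ge0.
    have mgp : measurable_fun setT (fun x : N.-tuple R => (gauss_joint t x `^ p)%:E).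
      apply/measurable_EFinP; apply: (measurableT_comp (measurable_powR p)).
      exact: (measurableT_comp (@measurable_gauss_joint R N) (pair2_measurable t)).
    rewrite /fubini_G.
    have -> : (\int[@lebesgue_sfinite R N]_x H (x, t) =
        (wt t * t `^ (th * p))%:E * \int[@lebesgue_tuple R N]_x (gauss_joint t x `^ p)%:E)%E.
      rewrite -(ge0_integralZl_EFin (@lebesgue_tuple R N) measurableT gp0 mgp c0).
      apply: eq_integral => x _; rewrite -EFinM /H indicE mem_set //= mul1r /f.
      by rewrite powRM ?powR_ge0 ?gauss_joint_ge0 // -powRrM mulrA.
    apply: (le_trans (lee_wpmul2l _ (gauss_joint_pnorm N t0 p1))).
      by rewrite lee_fin.
    rewrite -!EFinM lee_fin -thp powRM ?(ltW pi0) ?(ltW t0) //.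
    have -> : wt t * t `^ (th * p) * ((4 * pi) `^ (- (th * p)) * t `^ (- (th * p))) =
      (4 * pi) `^ (- (th * p)) * wt t * (t `^ (th * p) * t `^ (- (th * p))) by ring.
    rewrite -powRD; last by rewrite (gt_eqF t0) implybT.
    by rewrite subrr powRr0 mulr1.
  have wt0E t : D t -> (0 <= (wt t)%:E)%E by move=> Dt; rewrite lee_fin wt0.
  have mwtE : measurable_fun D (fun t => (wt t)%:E).
    by apply/measurable_EFinP; exact: measurable_funTS.
  rewrite (ge0_integralZl_EFin mu mD wt0E mwtE (powR_ge0 _ _)) EFinM.
  by apply: lee_wpmul2l wV; rewrite lee_fin powR_ge0.
have VV0 : 0 <= V `^ (p - 1) by exact: powR_ge0.
have step3 : (\int[@lebesgue_tuple R N]_x (`|fundamental_solution r h alpha n x| `^ p) <=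
    (((4 * pi) `^ (- th) * V) `^ p)%:E)%E.
  apply: (le_trans step1).
  rewrite (ge0_integralZl_EFin (@lebesgue_tuple R N) measurableT (fun x _ => Z0 x) mZ VV0).
  apply: (le_trans (lee_wpmul2l _ step2)); first by rewrite lee_fin.
  rewrite -EFinM lee_fin (powRM p (powR_ge0 (4 * pi) (- th)) (ltW V0)) -powRrM mulNr.
  rewrite mulrCA (mulrC _ V) mulr_powRB1 ?(ltW V0) //.
rewrite unlock /Lnorm.
apply: (@le_trans _ _ ((((4 * pi) `^ (- th) * V) `^ p)%:E `^ p^-1)%E).
  apply: gt0_ler_poweR => //.
  - by rewrite invr_ge0 ltW.
  - by rewrite in_itv /= leey andbT; apply: integral_ge0 => x _; exact: poweR_ge0.
  - by rewrite in_itv /= leey andbT lee_fin powR_ge0.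
rewrite poweR_EFin lee_fin -powRrM mulfV ?gt_eqF // powRr1; last first.
  by rewrite mulr_ge0 ?powR_ge0 ?(ltW V0).
by rewrite /V !mulrA.
Qed.

Lemma Lnorm_infinite_le th : th = N%:R / 2 -> th < 1 ->
  (Lnorm (@lebesgue_tuple R N) +oo%E (fundamental_solution r h alpha n) <=
   ((4 * pi) `^ (- th) * (2 / (1 - th)) / (n%:R * h) `^ (alpha * th))%:E)%E.
Proof.
move=> thE th1; have th0 : 0 <= th by rewrite thE divr_ge0.
have th01 : 0 <= th < 1 by rewrite th0.
set M := (X in (_ <= X%:E)%E); have M0 : 0 <= M.
  by rewrite divr_ge0 ?powR_ge0 // mulr_ge0 ?powR_ge0 // divr_ge0 // subr_ge0 ltW.
rewrite unlock /Lnorm; case: ifP => _; last by rewrite lee_fin.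
apply: ereal_inf_lbound => /=.
exists [set x | sqnorm x = 0]; split.
- exact: measurable_sqnorm0.
- exact: lebesgue_tuple_zero.
move=> x /= H; apply: contrapT => Sx; apply: H.
have S0 : 0 < sqnorm x by rewrite lt_neqAle eq_sym sqnorm_ge0 andbT; apply/eqP.
apply: (le_trans (fundamental_solution_subordination S0)).
have wm := wright_density_moment_le n.-1 al01 k0 th01.
have w0 t : 0 < t -> 0 <= w t by move=> t0; rewrite wright_density_ge0 // ltW.
have mw : measurable_fun setT w by exact: measurable_wright_density.
apply: (@le_trans _ _ (((4 * pi) `^ (- th))%:E *
    \int[mu]_(t in D) (w t * t `^ (- th))%:E)%E); last first.
  apply: (le_trans (lee_wpmul2l _ wm)); first by rewrite lee_fin powR_ge0.
  by rewrite -EFinM lee_fin /M -mulrA -scaled_rate !mulrA.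
have mwt : measurable_fun D (fun t => (w t * t `^ (- th))%:E).
  have : measurable_fun setT (fun t => w t * t `^ (- th)).
    by apply: measurable_funM => //; exact: measurable_powR.
  by move=> m; apply/measurable_EFinP; exact: measurable_funTS.
have wt0 t : D t -> (0 <= (w t * t `^ (- th))%:E)%E.
  by rewrite /= in_itv /= andbT => t0; rewrite lee_fin mulr_ge0 ?powR_ge0 ?w0.
rewrite -(ge0_integralZl_EFin mu mD wt0 mwt (powR_ge0 _ _)).
apply: ge0_le_integral => //.
- by move=> t; rewrite /= in_itv /= andbT => t0; rewrite lee_fin mulr_ge0 ?gauss_joint_ge0 ?w0.
- have : measurable_fun setT (fun t => w t * gauss_joint t x).
    apply: measurable_funM => //.
    exact: (measurableT_comp (@measurable_gauss_joint R N) (pair1_measurable x)).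
  by move=> m; apply/measurable_EFinP; exact: measurable_funTS.
- exact: measurable_funeM.
move=> t; rewrite /= in_itv /= andbT => t0; rewrite -EFinM lee_fin.
apply: (le_trans (ler_wpM2l (w0 t t0) (gauss_joint_le t x))).
rewrite powRM ?mulr_ge0 ?pi_ge0 ?(ltW t0) // -thE.
by rewrite mulrCA.
Qed.

End Norm.

Theorem lemma6p1 (R : realType) (N : nat) (alpha : R) (p : \bar R) :
  (0 < N)%N -> 0 < alpha < 1 -> admissible_exponent N p ->
  exists C : R, forall (r h : R) (n : nat), 0 < r < 1 -> 0 < h -> (0 < n)%N ->
    (Lnorm (lebesgue_tuple N) p (fundamental_solution r h alpha n)
     <= (C / (n%:R * h) `^ (alpha * N%:R / 2 * (1 - fine p^-1)))%:E)%E.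
Proof.
move=> N0 al01 [p1 [pN2 pN3]].
case: p p1 pN2 pN3 => [p| |]; last by [].
- rewrite lee_fin => p1 _ pN3.
  have p0 : 0 < p by exact: lt_le_trans p1.
  pose th := N%:R / 2 * (1 - p^-1).
  have th1 : th < 1.
    have N2 : (N <= 2)%N \/ (2 < N)%N by case: leqP; [left|right].
    case: N2 => [N2|N2].
      have h1 : N%:R / 2 <= 1 :> R by rewrite ler_pdivrMr // mul1r ler_nat.
      have h2 : 1 - p^-1 < 1 by rewrite gtrBl invr_gt0.
      apply: (@le_lt_trans _ _ (1 - p^-1)) => //.
      by rewrite /th ler_piMl // subr_ge0 invf_le1.
    have N2R : 0 < N%:R - 2 :> R by rewrite subr_gt0 ltr_nat.
    have NR : 0 < N%:R :> R by rewrite ltr0n.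
    move: (pN3 N2); rewrite lte_fin ltr_pdivlMr // => H.
    rewrite /th -(ltr_pM2r (_ : 0 < 2 * p)) ?mulr_gt0 //.
    have -> : N%:R / 2 * (1 - p^-1) * (2 * p) = N%:R * p - N%:R.
      by field; rewrite gt_eqF.
    by lra.
  exists ((4 * pi) `^ (- th) * (2 / (1 - th))) => r h n r01 h0 n0.
  have := Lnorm_finite_le N0 r01 h0 al01 n0 p1 erefl th1.
  by rewrite inver (gt_eqF p0) /= /th !mulrA.
- move=> _ pN2 pN3.
  have N1 : N = 1%N.
    case: N N0 pN2 pN3 => [|[|[|N]]] // _ pN2 pN3.
      by have := pN2 erefl; rewrite ltxx.
    by have := pN3 isT; rewrite ltNge leey.
  have th1 : N%:R / 2 < 1 :> R by rewrite N1; lra.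
  exists ((4 * pi) `^ (- (N%:R / 2)) * (2 / (1 - N%:R / 2))) => r h n r01 h0 n0.
  have := Lnorm_infinite_le N0 r01 h0 al01 n0 erefl th1.
  by rewrite invey /= subr0 mulr1 !mulrA.
Qed.
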